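(* There exist a complex separable Hilbert space $\mathcal H$, a self-adjoint operator $H_0$ on $\mathcal H$ with non-empty absolutely continuous spectrum, and a trace-class self-adjoint operator $V$ on $\mathcal H$ such that the pair $(H_0,V)$ is irreducible and the restriction of the singular spectral shift function $\xi^{(s)}_{H_0+V,H_0}$ of the pair $(H_0,H_0+V)$ to the absolutely continuous spectrum of $H_0$ is non-zero.
   Context: Hilbert spaces are complex and separable. For a self-adjoint operator $H$ on $\mathcal H$ with spectral resolution $\{E_\lambda\}$, a vector $f$ is absolutely continuous (respectively singular) with respect to $H$ if the measure with distribution function $\lambda\mapsto\langle E_\lambda f,f\rangle$ is absolutely continuous (respectively singular) with respect to Lebesgue measure. These vectors form closed, mutually orthogonal, $H$-invariant subspaces $\mathcal H^{(a)}$ and $\mathcal H^{(s)}$ with $\mathcal H=\mathcal H^{(a)}\oplus\mathcal H^{(s)}$. The restrictions of $H$ to them are denoted $H^{(a)}$ (absolutely continuous part) and $H^{(s)}$ (singular part). The absolutely continuous spectrum of $H$ is the spectrum of $H^{(a)}$. For $H_0$ self-adjoint and $V$ self-adjoint trace-class, put $H_r=H_0+rV$, $r\in\mathbb R$. The singular spectral shift function $\xi^{(s)}_{H_0+V,H_0}$ is defined as the distribution $$\xi^{(s)}(\phi)=\int_0^1 \operatorname{Tr}\bigl(V\phi(H_r^{(s)})\bigr)\,dr,\qquad \phi\in C_c^\infty(\mathbb R),$$ where $\phi(H_r^{(s)})$ is regarded as an operator on $\mathcal H$ acting as $0$ on the absolutely continuous subspace of $H_r$. It is known that this distribution is an absolutely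 continuous finite measure; it is identified with its density, an $L_1(\mathbb R)$-function (defined up to a.e. equality). ''Non-zero'' on a set means not a.e. equal to zero there. A closed subspace $\mathcal K\subset\mathcal H$ is invariant for an operator $H$ with domain $\mathcal D(H)$ if $\mathcal K\cap\mathcal D(H)$ is dense in $\mathcal K$ and $Hf\in\mathcal K$ for all $f\in\mathcal K\cap\mathcal D(H)$. A pair of operators on $\mathcal H$ is irreducible if the only closed subspaces of $\mathcal H$ invariant for both operators are $\{0\}$ and $\mathcal H$. *)

(* Defs.v *)
From HB Require Import structures.
From mathcomp Require Import all_boot all_order all_algebra.
From mathcomp Require Import all_classical all_reals all_analysis.
From mathcomp.real_closed Require Import complex.
From mathcomp.analysis.showcase Require Import summability.

Set Implicit Arguments.
Unset Strict Implicit.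
Unset Printing Implicit Defensive.

Import Order.TTheory GRing.Theory Num.Theory.
Import numFieldNormedType.Exports.

Local Open Scope classical_set_scope.
Local Open Scope ring_scope.
Local Open Scope complex_scope.

(* The inner product is linear in its first argument. *)
HB.mixin Record NormedModule_isHilbert (R : realType) H
    of CompleteNormedModule R[i] H := {
  inner : {dot H for @Num.conj R[i]} ;
  sqr_norm_inner : forall x : H, `|x| ^+ 2 = inner x x }.

#[short(type=hilbertType)]
HB.structure Definition Hilbert (R : realType) :=
  {H of CompleteNormedModule R[i] H & NormedModule_isHilbert R H}.

Definition separable_space (T : topologicalType) :=
  exists2 D : set T, countable D & dense D.

Definition subspace (R : realType) (H : hilbertType R) (K : set H) :=
  K 0 /\ forall (a : R[i]) f g, K f -> K g -> K (a *: f + g).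

Definition closed_subspace (R : realType) (H : hilbertType R) (K : set H) :=
  subspace K /\ closed K.

(* The values of [op] outside [dom] are irrelevant: no definition below
   inspects them. *)
Record operator (R : realType) (H : hilbertType R) := Operator {
  dom : set H ;
  op :> H -> H }.

Section operators.
Context {R : realType} {H : hilbertType R}.
Implicit Types (A B : operator H) (K : set H) (V T : {linear H -> H}).

Definition everywhere V : operator H := Operator setT V.

Definition perturb A V (r : R) : operator H :=
  Operator (dom A) (fun f => A f + r%:C *: V f).

Definition restrict A K : operator H := Operator (dom A `&` K) A.

Definition linear_operator A :=
  subspace (dom A) /\
  forall (a : R[i]) f g, dom A f -> dom A g -> A (a *: f + g) = a *: A f + A g.

(* The last clause says that the graphs of the adjoint of [A] and of [A]
   coincide. *)
Definition selfadjoint A :=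
  [/\ linear_operator A, dense (dom A) &
      forall g h, (forall f, dom A f -> inner (A f) g = inner f h) <->
                  dom A g /\ A g = h].

Definition invariant_subspace K A :=
  K `<=` closure (K `&` dom A) /\ forall f, K f -> dom A f -> K (A f).

Definition irreducible A B :=
  forall K, closed_subspace K ->
    invariant_subspace K A -> invariant_subspace K B ->
    K = [set 0] \/ K = setT.

(* The spectrum of [A] as an operator on the closed subspace [K], where
   [dom A] is included in [K] and [A] takes values in [K]. *)
Definition resolvent_set K A : set R[i] :=
  [set z | exists S : H -> H,
    [/\ exists M : R[i], forall g, K g -> `|S g| <= M * `|g|,
        forall g, K g -> dom A (S g) /\ A (S g) - z *: S g = g &
        forall f, dom A f -> S (A f - z *: f) = f]].

Definition spectrum K A : set R[i] := ~` resolvent_set K A.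

Definition orthonormal_basis (I : choiceType) (e : I -> H) :=
  (forall i j, inner (e i) (e j) = (i == j)%:R) /\
  (forall f, (forall i, inner f (e i) = 0) -> f = 0).

(* [P] is the absolute value of [V], i.e. [P \o P] is the composition of the
   adjoint of [V] with [V]. *)
Definition is_absolute_value V (P : {linear H -> H}) :=
  [/\ continuous P, forall f, 0 <= inner (P f) f &
      forall f g, inner (P (P f)) g = inner (V f) (V g)].

Definition trace_class V :=
  continuous V /\
  exists2 P, is_absolute_value V P &
    forall (I : choiceType) (e : I -> H), orthonormal_basis e ->
      (\esum_(i in [set: I]) (complex.Re (inner (P (e i)) (e i)))%:E < +oo)%E.

(* The sum is unconditional; [R[i]^o] only serves to find the topology of
   the complex numbers. *)
Definition is_trace (T : H -> H) (t : R[i]) :=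
  forall (I : choiceType) (e : I -> H), orthonormal_basis e ->
    partial_sum (fun i => inner (T (e i)) (e i)) @ totally --> (t : R[i]^o).

End operators.

(* Resolutions of the identity of a closed subspace [K]; the projections act
   on the whole space, and vanish on the orthogonal complement of [K]. *)
Record resolution (R : realType) (H : hilbertType R) (K : set H) := Resolution {
  proj :> R -> {linear H -> H} ;
  proj_sym : forall l f g, inner (proj l f) g = inner f (proj l g) ;
  proj_sub : forall l f, K (proj l f) ;
  proj_min : forall l m f, proj l (proj m f) = proj (Order.min l m) f ;
  proj_rcont : forall l f, proj m f @[m --> l^'+] --> proj l f ;
  proj_ninfty : forall f, proj l f @[l --> -oo] --> (0 : H) ;
  proj_pinfty : forall f, K f -> proj l f @[l --> +oo] --> f }.

Section spectral_measure.
Context {R : realType} {H : hilbertType R} {K : set H}.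
Variables (E : resolution K) (f : H).

Definition spectral_distribution (l : R) : R := complex.Re (inner (E l f) f).

Let distributionB l m : l <= m ->
  (spectral_distribution m - spectral_distribution l)%:C =
  `|E m f - E l f| ^+ 2.
Proof.
move=> lm; rewrite sqr_norm_inner /spectral_distribution.
have norm_proj x : inner (E x f) f = inner (E x f) (E x f).
  by rewrite -proj_sym proj_min minxx.
have cross : inner (E m f) (E l f) = inner (E l f) (E l f).
  by rewrite -proj_sym proj_min (min_idPl lm) norm_proj.
have cross' : inner (E l f) (E m f) = inner (E l f) (E l f).
  by rewrite -proj_sym proj_min (min_idPr lm) norm_proj.
have reE x : (complex.Re (inner (E x f) f))%:C = inner (E x f) (E x f).
  by rewrite norm_proj -sqr_norm_inner RRe_real// rpredX// normr_real.
rewrite rmorphB/= !reE (sesquilinear.linearBr inner).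
by rewrite !(sesquilinear.linearBl inner)/= cross cross' subrr subr0.
Qed.

Let distribution_nd : nondecreasing spectral_distribution.
Proof.
by move=> l m lm; rewrite -subr_ge0 -ler0c distributionB// exprn_ge0.
Qed.

Let distribution_rc : right_continuous spectral_distribution.
Proof.
move=> l; apply/cvgrPdist_lt => e e0.
have e'0 : 0 < (Num.sqrt e)%:C by rewrite ltcR sqrtr_gt0.
have /cvgrPdist_lt/(_ _ e'0) := @proj_rcont _ _ _ E l f.
move=> near_l; near=> m.
have lm : l <= m by apply: ltW; near: m; exact: nbhs_right_gt.
rewrite distrC ger0_norm ?subr_ge0 ?distribution_nd//.
rewrite -ltcR distributionB// -(sqr_sqrtr (ltW e0)) rmorphXn/= ltr_pXn2r ?nnegrE//.
  by rewrite distrC; near: m.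
by rewrite ltW.
Unshelve. all: by end_near. Qed.

HB.instance Definition _ :=
  isCumulative.Build R _ R spectral_distribution distribution_nd distribution_rc.

Definition spectral_measure := lebesgue_stieltjes_measure spectral_distribution.

End spectral_measure.

Definition cintegral d (T : measurableType d) (R : realType)
    (mu : {measure set T -> \bar R}) (D : set T) (phi : T -> R[i]) : R[i] :=
  (\int[mu]_(x in D) complex.Re (phi x)) +i*
  (\int[mu]_(x in D) complex.Im (phi x)).

Definition cintegrable d (T : measurableType d) (R : realType)
    (mu : {measure set T -> \bar R}) (D : set T) (phi : T -> R[i]) :=
  mu.-integrable D (EFin \o (@complex.Re R) \o phi) /\
  mu.-integrable D (EFin \o (@complex.Im R) \o phi).

Definition smooth (R : realType) (phi : R -> R) :=
  forall n x, derivable (derive1n n phi) x 1.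

Definition test_function (R : realType) (phi : R -> R[i]) :=
  [/\ smooth (@complex.Re R \o phi), smooth (@complex.Im R \o phi) &
      exists M : R, forall x, M < `|x| -> phi x = 0].

Section spectral.
Context {R : realType} {H : hilbertType R}.
Implicit Types (A : operator H) (K : set H) (V T : {linear H -> H}).
Local Notation leb := (@lebesgue_measure R).

(* [E] is the spectral resolution of [A] as an operator on [K]: [A] is the
   integral of [l] against [d (E l)]. *)
Definition is_spectral_resolution K A (E : resolution K) :=
  [/\ forall f, dom A f <->
        K f /\ (\int[spectral_measure E f]_l (l ^+ 2)%:E < +oo)%E,
      forall f, dom A f -> K (A f) &
      forall f, dom A f ->
        inner (A f) f = (\int[spectral_measure E f]_l l)%R%:C].

Definition ac_space K (E : resolution K) : set H :=
  [set f | K f /\ spectral_measure E f `<< leb].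

Definition singular_space K (E : resolution K) : set H :=
  [set f | K f /\ exists N, [/\ measurable N, leb N = 0%E &
                                spectral_measure E f (~` N) = 0%E]].

Definition ac_spectrum A : set R :=
  [set l | exists2 E : resolution [set: H], is_spectral_resolution A E &
     spectrum (ac_space E) (restrict A (ac_space E)) l%:C].

(* [T] is [phi(A)], for [A] an operator on [K]; it is regarded as an operator
   on [H] acting as [0] on the orthogonal complement of [K], because spectral
   measures of vectors of the latter vanish. *)
Definition is_functional_calculus K A (phi : R -> R[i]) T :=
  exists2 E : resolution K, is_spectral_resolution A E &
    continuous T /\
    forall f, inner (T f) f = cintegral (spectral_measure E f) setT phi.

Definition is_singular_functional_calculus A (phi : R -> R[i]) T :=
  exists2 E : resolution [set: H], is_spectral_resolution A E &
    is_functional_calculus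
      (singular_space E) (restrict A (singular_space E)) phi T.

(* [xi] is the density of the singular spectral shift function of the pair
   (A, A + V). *)
Definition is_singular_ssf A V (xi : R -> R) :=
  leb.-integrable setT (EFin \o xi) /\
  forall phi, test_function phi ->
    exists t : R -> R[i],
      [/\ forall r, r \in `[0, 1] -> exists2 T,
            is_singular_functional_calculus (perturb A V r) phi T &
            is_trace (V \o T) (t r),
          cintegrable leb `[0, 1] t &
          cintegral leb `[0, 1] t =
            cintegral leb setT (fun x => (xi x)%:C * phi x)].

End spectral.

(* Main.v *)
(* Write e_0, e_1, ... for the standard basis of l^2, and let W_r be the
   weighted shift e_0 -> e_2, e_1 -> r e_2, e_2 -> 2 e_3, e_n -> 3 e_{n+1} for
   n >= 3, and D the projection on the span of e_0, e_1, e_2. The operators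
   H_r = W_r + W_r^* + r D form the affine family H_0 + r V, with
   V = e_0 e_0^* + (e_1 + e_2)(e_1 + e_2)^* of rank two, and r is an eigenvalue
   of H_r, with eigenvector v_r = e_1 - r e_0. For 0 <= r <= 1 the commutator of
   H_r with W_r - W_r^* is bounded below by |u_r><u_r|, u_r = e_0 + r e_1, so by
   Putnam's argument u_r is absolutely continuous for H_r. The closed
   H_r-invariant subspace generated by u_r is the orthogonal complement of v_r,
   so that the singular subspace of H_r is the line spanned by v_r and
   Tr(V phi(H_r^(s))) = phi(r) <V v_r, v_r> / <v_r, v_r> = phi(r). Hence the
   singular spectral shift function is the indicator function of [0, 1].
   Finally [0, 1] consists of absolutely continuous spectrum of H_0: the vector
   e_0 is absolutely continuous, and (H_0 - l) f = e_0 has no solution f in l^2,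
   because away from the first coordinates it is a three-term recurrence with
   constant coefficients, whose only square summable solution is 0. *)

Require Import Defs.
From HB Require Import structures.
From mathcomp Require Import all_boot all_order all_algebra finmap.
From mathcomp Require Import all_classical all_reals all_analysis.
From mathcomp Require Import measurable_realfun.
From mathcomp.real_closed Require Import complex.
From mathcomp.analysis.showcase Require Import summability.
From mathcomp Require Import ring lra.

Set Implicit Arguments.
Unset Strict Implicit.
Unset Printing Implicit Defensive.

Import Order.TTheory GRing.Theory Num.Theory.
Import numFieldNormedType.Exports.

Local Open Scope classical_set_scope.
Local Open Scope ring_scope.
Local Open Scope complex_scope.

(** An embedded eigenvalue generically dissolves under perturbation, so the family is built around
    one that persists. Both W_r and W_r^* annihilate v_r, and r D then makes its eigenvalue r, so
    that it sweeps [0, 1] together with the parameter. The direction of v_r turns with r, which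
    leaves room for irreducibility. D is extended to e_2 because the block of V on e_1, e_2 would
    otherwise be indefinite; as it stands V is positive and equals its absolute value. The weights
    grow because W_r^* W_r - W_r W_r^* must be positive: its diagonal entries at e_2 and e_3 are 4 -
    (1 + r^2) and 9 - 4, large enough to absorb the coupling of e_2 and e_3 that r D introduces.
    From the weight 3 on they are constant, so that the commutator vanishes further out and the
    eigenvalue equation is an elementary recurrence. The definitions ask for spectral resolutions of
    every H_r to be exhibited and for traces in every orthonormal basis; the spectral theorem for
    bounded symmetric operators and Parseval's identity are therefore part of the proof. *)

Lemma sqr_ltr_norm (R : realDomainType) (x e : R) : `|x| < e -> x ^+ 2 < e ^+ 2.
Proof.
move=> xe; rewrite -[x ^+ 2]real_normK ?num_real// ltr_sqr ?nnegrE//.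
exact: le_trans (ltW xe).
Qed.

(** * Real inner products *)

Section real_inner_product.
Context {R : realType} {U : lmodType R[i]}.
Variable form : {dot U for @Num.conj R[i]}.
Implicit Types (f g : U) (a : R).

(* Real counterparts of the inner product and of the norm, whose values are in
   [R[i]]. *)
Definition rip f g : R := complex.Re (form f g).

Lemma rip_conj f g : form f g = (form g f)^*.
Proof.
by rewrite (hermitian_subproof f g) expr0 mul1r.
Qed.

Lemma ripC f g : rip f g = rip g f.
Proof. by rewrite /rip rip_conj; case: (form g f). Qed.

Lemma ripDl f g h : rip (f + g) h = rip f h + rip g h.
Proof. by rewrite /rip sesquilinear.linearDl/= raddfD. Qed.

Lemma ripDr f g h : rip h (f + g) = rip h f + rip h g.
Proof. by rewrite ripC ripDl !(ripC h). Qed.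

Lemma ripNl f g : rip (- f) g = - rip f g.
Proof. by rewrite /rip sesquilinear.linearNl raddfN. Qed.

Lemma ripNr f g : rip g (- f) = - rip g f.
Proof. by rewrite ripC ripNl (ripC g). Qed.

Lemma ripBl f g h : rip (f - g) h = rip f h - rip g h.
Proof. by rewrite ripDl ripNl. Qed.

Lemma ripBr f g h : rip h (f - g) = rip h f - rip h g.
Proof. by rewrite ripDr ripNr. Qed.

Lemma ripZl a f g : rip (a%:C *: f) g = a * rip f g.
Proof.
rewrite /rip sesquilinear.linearZl_LR/=.
by case: (form f g) => x y /=; rewrite mul0r subr0.
Qed.

Lemma ripZr a f g : rip g (a%:C *: f) = a * rip g f.
Proof. by rewrite ripC ripZl ripC. Qed.

Lemma ripBB f g : rip (f - g) (f - g) = rip f f - 2 * rip f g + rip g g.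
Proof. by rewrite ripBl !ripBr (ripC g f); ring. Qed.

Lemma rip0l g : rip 0 g = 0.
Proof. by rewrite -(subrr (0 : U)) ripBl subrr. Qed.

Lemma rip0r g : rip g 0 = 0.
Proof. by rewrite ripC rip0l. Qed.

(** The form is conjugate-linear on the right, so pairing with ['i *: g] turns the imaginary part
    into a real one. Identities and limits for [inner] thus reduce to the real-valued [rip]. *)
Lemma form_ImE f g : complex.Im (form f g) = rip f ('i *: g).
Proof.
rewrite /rip sesquilinear.linearZr_LR/=; case: (form f g) => x y /=.
by rewrite mul0r sub0r mulN1r opprK.
Qed.

Lemma form_ripE f g : form f g = rip f g +i* rip f ('i *: g).
Proof. by rewrite -form_ImE /rip; case: (form f g). Qed.

Lemma form_selfE f : form f f = (rip f f)%:C.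
Proof.
have := congr1 (@complex.Im R) (rip_conj f f).
rewrite /rip; case: (form f f) => x y /= yN.
by congr (_ +i* _); lra.
Qed.

Lemma rip_gt0 f : f != 0 -> 0 < rip f f.
Proof. by move=> f0; rewrite -ltcR -form_selfE neq0_dnorm_gt0. Qed.

Lemma rip_ge0 f : 0 <= rip f f.
Proof.
by have [->|/rip_gt0/ltW//] := eqVneq f 0; rewrite rip0l.
Qed.

Lemma rip_eq0 f : rip f f = 0 -> f = 0.
Proof.
move=> f0; apply/eqP; apply: contraT => /rip_gt0.
by rewrite f0 ltxx.
Qed.

Lemma ripZZ (c : R[i]) f :
  rip (c *: f) (c *: f) = (complex.Re c ^+ 2 + complex.Im c ^+ 2) * rip f f.
Proof.
rewrite /rip sesquilinear.linearZl_LR sesquilinear.linearZr_LR/= form_selfE.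
by case: c => x y /=; ring.
Qed.

Lemma rip_cauchy_schwarz f g : rip f g ^+ 2 <= rip f f * rip g g.
Proof.
have [->|g0] := eqVneq g 0; first by rewrite !rip0r expr0n/= mulr0.
have gg := rip_gt0 g0.
have := rip_ge0 ((rip g g)%:C *: f - (rip f g)%:C *: g).
rewrite ripBl !ripBr !ripZl !ripZr (ripC g f) => h.
rewrite -subr_ge0 -(pmulr_rge0 _ gg).
by move: h; lra.
Qed.

Definition rn f : R := Num.sqrt (rip f f).

Lemma rn_ge0 f : 0 <= rn f. Proof. exact: sqrtr_ge0. Qed.

Lemma sqr_rn f : rn f ^+ 2 = rip f f.
Proof. by rewrite sqr_sqrtr// rip_ge0. Qed.

Lemma rn0 : rn 0 = 0. Proof. by rewrite /rn rip0l sqrtr0. Qed.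

Lemma rn_eq0 f : rn f = 0 -> f = 0.
Proof. by move=> f0; apply: rip_eq0; rewrite -sqr_rn f0 expr0n. Qed.

Lemma rnN f : rn (- f) = rn f.
Proof. by rewrite /rn ripNl ripNr opprK. Qed.

Lemma rnBC f g : rn (f - g) = rn (g - f).
Proof. by rewrite -rnN opprB. Qed.

Lemma rnZ (c : R[i]) f : rn (c *: f) = complex.Re `|c| * rn f.
Proof.
rewrite /rn ripZZ sqrtrM; last by rewrite addr_ge0// sqr_ge0.
by rewrite normc_def.
Qed.

Lemma rnZr a f : rn (a%:C *: f) = `|a| * rn f.
Proof. by rewrite rnZ normc_def/= expr0n/= addr0 sqrtr_sqr. Qed.

Lemma ler_rip f g : `|rip f g| <= rn f * rn g.
Proof.
rewrite -ler_sqr ?nnegrE ?mulr_ge0 ?rn_ge0// real_normK ?num_real//.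
by rewrite exprMn !sqr_rn rip_cauchy_schwarz.
Qed.

Lemma ripl_le f g : rip f g <= rn f * rn g.
Proof. exact: le_trans (ler_norm _) (ler_rip _ _). Qed.

Lemma ler_rnD f g : rn (f + g) <= rn f + rn g.
Proof.
rewrite -ler_sqr ?nnegrE ?addr_ge0 ?rn_ge0// sqrrD !sqr_rn ripDl !ripDr.
by have := ripl_le f g; rewrite (ripC g f); lra.
Qed.

Lemma ler_rnB f g : rn (f - g) <= rn f + rn g.
Proof. by rewrite -(rnN g) ler_rnD. Qed.

Lemma rnB_ge f g : rn f - rn g <= rn (f - g).
Proof. by rewrite lerBlDr -{1}(subrK g f) ler_rnD. Qed.

Lemma rn_dist f g : `|rn f - rn g| <= rn (f - g).
Proof. by rewrite ler_norml rnB_ge andbT lerNl opprB rnBC rnB_ge. Qed.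

End real_inner_product.

Local Notation ip := (rip (@inner _ _)).
Local Notation nrm := (rn (@inner _ _)).

(** * Convergence and bounded operators in Hilbert spaces *)

Section hilbert.
Context {R : realType} {H : hilbertType R}.
Implicit Types (f g h : H).

Lemma norm_rn f : `|f| = (nrm f)%:C.
Proof.
apply: (@pexpIrn _ 2) => //; rewrite ?nnegrE ?normr_ge0 ?ler0c ?rn_ge0//.
by rewrite sqr_norm_inner form_selfE -rmorphXn/= sqr_rn.
Qed.

(** A positive element of [R[i]] is a positive real number, so real radii suffice although the norm
    is [R[i]]-valued. *)
Lemma cvg_rnP T (F : set_system T) {FF : Filter F} (u : T -> H) (l : H) :
  u x @[x --> F] --> l <->
  forall e : R, 0 < e -> \forall x \near F, nrm (l - u x) < e.
Proof.
split=> [/cvgrPdist_lt ul e e0|ul].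
  have e0' : 0 < e%:C by rewrite ltcR.
  by have := ul _ e0'; apply: filterS => x; rewrite norm_rn ltcR.
apply/cvgrPdist_lt => -[e e'] e0.
have : 0 < e by move: e0; rewrite ltcE => /andP[].
move: e0; rewrite ltcE/= => /andP[/eqP -> e0] _.
by have := ul _ e0; apply: filterS => x; rewrite norm_rn ltcR.
Qed.

Lemma cvg_rip T (F : set_system T) {FF : Filter F} (u : T -> H) (l : H) g :
  u x @[x --> F] --> l -> ip (u x) g @[x --> F] --> ip l g.
Proof.
move=> /cvg_rnP ul; apply/cvgrPdist_lt => e e0.
have g0 : 0 < nrm g + 1 by rewrite ltr_pwDr// rn_ge0.
have := ul (e / (nrm g + 1)) (divr_gt0 e0 g0).
apply: filterS => x; rewrite ltr_pdivlMr// -ripBl.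
apply: le_lt_trans; apply: le_trans (ler_rip _ _ _) _.
by rewrite ler_wpM2l ?rn_ge0// lerDl.
Qed.

Lemma cvg_rn T (F : set_system T) {FF : Filter F} (u : T -> H) (l : H) :
  u x @[x --> F] --> l -> nrm (u x) @[x --> F] --> nrm l.
Proof.
move=> /cvg_rnP ul; apply/cvgrPdist_lt => e e0.
apply: filterS (ul e e0) => x; apply: le_lt_trans; exact: rn_dist.
Qed.

Lemma rn_cauchy (u : nat -> H) :
  (forall e : R, 0 < e ->
     exists N, forall m n, (N <= m)%N -> (N <= n)%N -> nrm (u m - u n) < e) ->
  exists l : H, u n @[n --> \oo] --> l.
Proof.
move=> cu; suff /cvg_ex[l ul] : cvg (u n @[n --> \oo]) by exists l.
apply: cauchy_cvg; apply: cauchy_exP.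
move=> -[e e'] e0.
have : 0 < e by move: e0; rewrite ltcE => /andP[].
move: e0; rewrite ltcE/= => /andP[/eqP -> _] e0.
have [N NP] := cu _ e0; exists (u N).
exists N => // n /= Nn; rewrite -ball_normE/= norm_rn ltcR.
exact: NP.
Qed.

Definition bounded_op (T : H -> H) :=
  exists2 c : R, 0 < c & forall f, nrm (T f) <= c * nrm f.

Lemma bounded_continuous (T : {linear H -> H}) : bounded_op T -> continuous T.
Proof.
move=> [c c0 Tc] f; apply/cvg_rnP => e e0.
have /cvg_rnP/(_ _ (divr_gt0 e0 c0)) : x @[x --> f] --> f by exact: cvg_id.
apply: filterS => x; rewrite ltr_pdivlMr// mulrC; apply: le_lt_trans.
by rewrite -linearB; exact: Tc.
Qed.

Lemma bounded_cvg A (F : set_system A) {FF : Filter F} (u : A -> H) (l : H)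
    (T : {linear H -> H}) :
  bounded_op T -> u x @[x --> F] --> l -> T (u x) @[x --> F] --> T l.
Proof. by move=> /bounded_continuous cT ul; apply: cvg_comp ul _; exact: cT. Qed.

End hilbert.

(** * Spectral resolution of a bounded symmetric operator *)

Section operators.
Context {R : realType} {H : hilbertType R}.
Implicit Types (f g h : H) (T S B : {linear H -> H}).

Definition linop (T : H -> H) (lT : linear T) : {linear H -> H} :=
  HB.pack T (GRing.isLinear.Build _ _ _ _ T lT).

Definition symmetric_op (T : H -> H) := forall f g, ip (T f) g = ip f (T g).

Definition commuting (T S : H -> H) := forall f, T (S f) = S (T f).

Lemma cvg_unique_H (u : nat -> H) (l l' : H) :
  u n @[n --> \oo] --> l -> u n @[n --> \oo] --> l' -> l = l'.
Proof. by move=> ul ul'; exact: (@norm_cvg_unique _ H _ _ l l' ul ul'). Qed.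

Lemma limit_op (T : nat -> {linear H -> H}) :
  (forall f, exists l : H, T n f @[n --> \oo] --> l) ->
  exists L : {linear H -> H}, forall f, T n f @[n --> \oo] --> L f.
Proof.
move=> /choice[L TL].
have lL : linear L.
  move=> a f g; apply: cvg_unique_H (TL _) _.
  under eq_fun do rewrite linearP.
  by apply: cvgD; [apply: cvgZl_tmp; exact: TL|exact: TL].
by exists (linop lL).
Qed.

Section limit_op.
Variables (T : nat -> {linear H -> H}) (L : {linear H -> H}).
Hypothesis TL : forall f, T n f @[n --> \oo] --> L f.

Lemma limit_symmetric : (forall n, symmetric_op (T n)) -> symmetric_op L.
Proof.
move=> sT f g.
have h1 : ip (T n f) g @[n --> \oo] --> ip (L f) g by apply: cvg_rip; exact: TL.
have h2 : ip (T n g) f @[n --> \oo] --> ip (L g) f by apply: cvg_rip; exact: TL.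
have E : (fun n => ip (T n f) g) = (fun n => ip (T n g) f).
  by apply/funext => n; rewrite sT ripC.
by rewrite (ripC _ f); move: h1; rewrite E => /(cvg_unique (@Rhausdorff R)); exact.
Qed.

Lemma limit_contraction : (forall n f, nrm (T n f) <= nrm f) ->
  forall f, nrm (L f) <= nrm f.
Proof.
move=> cT f; have h : nrm (T n f) @[n --> \oo] --> nrm (L f).
  by apply: cvg_rn; exact: TL.
rewrite -(cvg_lim _ h)//; apply: limr_le; first by apply/cvg_ex; exists (nrm (L f)).
by near=> n; exact: cT.
Unshelve. all: by end_near. Qed.

Lemma limit_commuting B : bounded_op B -> (forall n, commuting (T n) B) ->
  commuting L B.
Proof.
move=> bB cT f; apply: cvg_unique_H (@TL _) _.
under eq_fun do rewrite cT.
exact: bounded_cvg (@TL f).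
Qed.

(** A uniform bound makes strong convergence compatible with moving arguments: L l - T_n u_n = (L l
    - T_n l) + T_n (l - u_n). This lets the quadratic term of the square root iteration pass to the
    limit. *)
Lemma limit_comp (u : nat -> H) (l : H) : (forall n f, nrm (T n f) <= nrm f) ->
  u n @[n --> \oo] --> l -> T n (u n) @[n --> \oo] --> L l.
Proof.
move=> cT /cvg_rnP ul; apply/cvg_rnP => e e0.
have e20 : 0 < e / 2 by lra.
have := @TL l => /cvg_rnP/(_ _ e20); apply: filter_app.
apply: filterS (ul _ e20) => n un Tn.
have -> : L l - T n (u n) = (L l - T n l) + T n (l - u n).
  by rewrite linearB addrA subrK.
have := ler_rnD (@inner _ H) (L l - T n l) (T n (l - u n)).
by have := cT n (l - u n); lra.
Qed.

End limit_op.

(** * Square roots by iteration *)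

Section square_root_iteration.
Variable S : {linear H -> H}.
Hypothesis cS : forall f, nrm (S f) <= nrm f.

(* The iterates of Y -> (S + Y^2) / 2 converge to a solution of
   (1 - Y)^2 = 1 - S; their increments are dominated by those of the same
   iteration on scalars, with 1 instead of S. *)
Definition sqrt_step (Y : {linear H -> H}) : {linear H -> H} :=
  (2^-1)%:C \*: (S \+ (Y \o Y)).

Definition sqrt_op n : {linear H -> H} := iter n sqrt_step \0.

Definition sqrt_maj n : R := iter n (fun y => (1 + y ^+ 2) / 2) 0.

Lemma sqrt_opS n f :
  sqrt_op n.+1 f = (2^-1)%:C *: (S f + sqrt_op n (sqrt_op n f)).
Proof. by []. Qed.

Lemma sqrt_majS n : sqrt_maj n.+1 = (1 + sqrt_maj n ^+ 2) / 2.
Proof. by []. Qed.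

Lemma sqrt_maj_itv n : 0 <= sqrt_maj n <= 1.
Proof.
elim: n => [|n /andP[IH0 IH1]]; first by rewrite lexx ler01.
by rewrite sqrt_majS; apply/andP; split; nra.
Qed.

Lemma sqrt_maj_nd : nondecreasing_seq sqrt_maj.
Proof.
apply/nondecreasing_seqP => n; rewrite sqrt_majS.
by have := sqr_ge0 (1 - sqrt_maj n); lra.
Qed.

Lemma sqrt_op_le n f : nrm (sqrt_op n f) <= sqrt_maj n * nrm f.
Proof.
elim: n f => [|n IH] f; first by rewrite mul0r /= rn0.
rewrite sqrt_opS sqrt_majS rnZr ger0_norm ?invr_ge0//.
have := ler_rnD (@inner _ H) (S f) (sqrt_op n (sqrt_op n f)).
have := cS f; have := IH (sqrt_op n f); have := IH f.
have /andP[y0 y1] := sqrt_maj_itv n.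
have := rn_ge0 (@inner _ H) f => f0 h1 h2 h3 h4.
have : sqrt_maj n * nrm (sqrt_op n f) <= sqrt_maj n * (sqrt_maj n * nrm f).
  exact: ler_wpM2l.
by lra.
Qed.

(** Writing Y'^2 - Y^2 = Y' (Y' - Y) + (Y' - Y) Y bounds an increment by the preceding one times (y'
    + y) / 2, where y' and y majorise the norms of Y' and Y; this is exactly the factor in the
    scalar recursion. *)
Lemma sqrt_op_step n f :
  nrm (sqrt_op n.+1 f - sqrt_op n f) <= (sqrt_maj n.+1 - sqrt_maj n) * nrm f.
Proof.
elim: n f => [|n IH] f.
  by have := sqrt_op_le 1 f; rewrite /= !subr0.
set Y' := sqrt_op n.+1 in IH *; set Y := sqrt_op n in IH *.
have -> : sqrt_op n.+2 f - Y' f =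
    (2^-1)%:C *: (Y' (Y' f - Y f) + (Y' (Y f) - Y (Y f))).
  have E2 : sqrt_op n.+2 f = (2^-1)%:C *: (S f + Y' (Y' f)) by [].
  have E1 : Y' f = (2^-1)%:C *: (S f + Y (Y f)) by [].
  rewrite E2 [X in _ - X = _]E1 -scalerBr; congr (_ *: _).
  by rewrite opprD addrACA subrr add0r linearB addrA subrK.
rewrite rnZr ger0_norm ?invr_ge0//.
have := ler_rnD (@inner _ H) (Y' (Y' f - Y f)) (Y' (Y f) - Y (Y f)).
have := IH f; have := IH (Y f); have := sqrt_op_le n f.
have := sqrt_op_le n.+1 (Y' f - Y f).
have /andP[y0 y1] := sqrt_maj_itv n.
have /andP[y'0 y'1] := sqrt_maj_itv n.+1.
have yy' : 0 <= sqrt_maj n.+1 - sqrt_maj n.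
  by rewrite subr_ge0; exact: sqrt_maj_nd.
rewrite -/Y -/Y'.
have e2 : sqrt_maj n.+2 = (1 + sqrt_maj n.+1 ^+ 2) / 2 by [].
have e1 : sqrt_maj n.+1 = (1 + sqrt_maj n ^+ 2) / 2 by [].
have -> : sqrt_maj n.+2 - sqrt_maj n.+1 =
    (sqrt_maj n.+1 - sqrt_maj n) * (sqrt_maj n.+1 + sqrt_maj n) / 2.
  by rewrite e2 [X in _ - X = _]e1; lra.
set y := sqrt_maj n in y0 y1 yy' *; set y' := sqrt_maj n.+1 in y'0 y'1 yy' *.
move=> h1 h2 h3 h4 h5.
have := ler_wpM2l y'0 h4; have := ler_wpM2l yy' h2.
by lra.
Qed.

Lemma sqrt_op_dist n k f :
  nrm (sqrt_op (n + k) f - sqrt_op n f) <=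
  (sqrt_maj (n + k) - sqrt_maj n) * nrm f.
Proof.
elim: k => [|k IH]; first by rewrite addn0 !subrr rn0 mul0r.
have := sqrt_op_step (n + k) f; rewrite addnS.
have -> : sqrt_op (n + k).+1 f - sqrt_op n f =
  (sqrt_op (n + k).+1 f - sqrt_op (n + k) f) +
  (sqrt_op (n + k) f - sqrt_op n f) by rewrite addrA subrK.
have := ler_rnD (@inner _ H) (sqrt_op (n + k).+1 f - sqrt_op (n + k) f)
  (sqrt_op (n + k) f - sqrt_op n f).
by lra.
Qed.

Lemma sqrt_op_cvg f : exists l : H, sqrt_op n f @[n --> \oo] --> l.
Proof.
apply: rn_cauchy => e e0.
have f1 : 0 < nrm f + 1 by have := rn_ge0 (@inner _ H) f; lra.
have cy : cvgn sqrt_maj.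
  apply: nondecreasing_is_cvgn; first exact: sqrt_maj_nd.
  by exists 1 => _ [n _ <-]; have /andP[] := sqrt_maj_itv n.
have e'0 : 0 < e / (nrm f + 1) / 2 by rewrite !divr_gt0.
move/cvgrPdist_lt : cy => /(_ _ e'0)[N _ NP]; exists N.
have yl n : sqrt_maj n <= limn sqrt_maj.
  apply: nondecreasing_cvgn_le => //; first exact: sqrt_maj_nd.
  apply: nondecreasing_is_cvgn; first exact: sqrt_maj_nd.
  by exists 1 => _ [m _ <-]; have /andP[] := sqrt_maj_itv m.
have hN k : nrm (sqrt_op (N + k) f - sqrt_op N f) < e / 2.
  apply: le_lt_trans (sqrt_op_dist _ _ _) _.
  have := NP N (leqnn N); rewrite ger0_norm ?subr_ge0//= => yN.
  have : sqrt_maj (N + k) - sqrt_maj N < e / (nrm f + 1) / 2.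
    by apply: le_lt_trans yN; rewrite lerD2r.
  rewrite -mulrA (mulrC _^-1) mulrA ltr_pdivlMr// => h; apply: le_lt_trans h.
  rewrite ler_wpM2l ?lerDl// subr_ge0; apply: sqrt_maj_nd.
  exact: leq_addr.
move=> m n Nm Nn; rewrite -(subnKC Nm) -(subnKC Nn).
set a := sqrt_op _ f; set b := sqrt_op _ f.
have -> : a - b = (a - sqrt_op N f) - (b - sqrt_op N f).
  by rewrite opprB addrA subrK.
apply: le_lt_trans (ler_rnB _ _ _) _.
by have := hN (m - N)%N; have := hN (n - N)%N; rewrite -/a -/b; lra.
Qed.

Lemma sqrt_op_contraction n f : nrm (sqrt_op n f) <= nrm f.
Proof.
apply: le_trans (sqrt_op_le _ _) _.
have /andP[y0 y1] := sqrt_maj_itv n.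
by rewrite ler_piMl// rn_ge0.
Qed.

End square_root_iteration.

Lemma sqrt_complement S : (forall f, nrm (S f) <= nrm f) -> symmetric_op S ->
  exists Y : {linear H -> H}, [/\ symmetric_op Y,
    forall f, nrm (Y f) <= nrm f,
    forall f, Y f = (2^-1)%:C *: (S f + Y (Y f)) &
    forall B, bounded_op B -> commuting S B -> commuting Y B].
Proof.
move=> cS sS.
have [Y YP] := limit_op (sqrt_op_cvg cS).
exists Y; split.
- apply: (limit_symmetric YP); elim=> [|n IH] f g; first by rewrite /= rip0l rip0r.
  by rewrite !sqrt_opS ripZl ripZr ripDl ripDr sS !IH.
- by apply: (limit_contraction YP) => n f; exact: sqrt_op_contraction.
- move=> f; have := YP f; rewrite -(cvg_shiftS (sqrt_op S ^~ f)) => YSf.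
  apply: cvg_unique_H YSf _.
  under eq_fun do rewrite sqrt_opS.
  apply: cvgZl_tmp; apply: cvgD; first exact: cvg_cst.
  by apply: (limit_comp YP) (YP f) => n g; exact: sqrt_op_contraction.
- move=> B bB cSB; apply: (limit_commuting YP bB); elim=> [|n IH] f.
    by rewrite /= linear0.
  by rewrite !sqrt_opS cSB !IH -linearD -linearZZ.
Qed.

End operators.

(** * From absolute values to spectral projections *)

Section spectral_projections.
Context {R : realType} {H : hilbertType R}.
Implicit Types (f g h : H) (T S B : {linear H -> H}).

(** Positivity is used at f - c^-1 P f: when <P f, f> = 0, the linear term -2 c^-1 |P f|^2 outweighs
    the quadratic one, which is at most c^-1 |P f|^2. *)
Lemma positive_op_eq0 (P : {linear H -> H}) f :
  symmetric_op P -> bounded_op P -> (forall f, 0 <= ip (P f) f) ->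
  ip (P f) f = 0 -> P f = 0.
Proof.
move=> sP [c c0 cP] P0 Pf0; apply: (@rip_eq0 _ _ (@inner _ H)).
apply/eqP; rewrite eq_le rip_ge0 andbT.
have := P0 (f - (c^-1)%:C *: P f).
rewrite linearB linearZZ ripBl !ripBr !ripZl !ripZr Pf0 (sP f (P f)).
rewrite -(sP f (P f)) (sP (P f) f).
have := ripl_le (@inner _ H) (P (P f)) (P f).
have := ler_wpM2r (rn_ge0 (@inner _ H) (P f)) (cP (P f)).
rewrite -mulrA -expr2 sqr_rn => h1 h2.
have /(ler_wpM2l (ltW c0)) := le_trans h2 h1.
have ci0 : 0 < c^-1 by rewrite invr_gt0.
move=> h3 h4.
have : c^-1 * ip (P f) (P f) <= 0.
  have /(ler_wpM2l (ltW ci0))/(ler_wpM2l (ltW ci0)) := le_trans h2 h1.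
  by rewrite [c^-1 * (c * _)]mulKf ?gt_eqF//; lra.
by rewrite pmulr_rle0.
Qed.

(** For |T| <= c this is a symmetric contraction whose fixed vectors form the kernel of T, and 1
    minus it is T^2 / c^2. The first fact serves kernel projections, the second absolute values. *)
Definition complement_op (c : R) T : {linear H -> H} :=
  idfun \- ((c ^- 2)%:C \*: (T \o T)).

Section complement.
Variables (T : {linear H -> H}) (c : R).
Hypotheses (sT : symmetric_op T) (c0 : 0 < c).
Hypothesis (cT : forall f, nrm (T f) <= c * nrm f).

Lemma complement_opE f : complement_op c T f = f - (c ^- 2)%:C *: T (T f).
Proof. by []. Qed.

Lemma complement_symmetric : symmetric_op (complement_op c T).
Proof.
by move=> f g; rewrite !complement_opE ripBl ripBr ripZl ripZr !sT.
Qed.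

(** The cross term gives -2 c^-2 |T f|^2, and the bound on T makes c^-4 |T^2 f|^2 at most c^-2 |T
    f|^2. *)
Lemma complement_decrease f :
  ip (complement_op c T f) (complement_op c T f) <=
  ip f f - c ^- 2 * ip (T f) (T f).
Proof.
rewrite !complement_opE ripBl !ripBr !ripZl !ripZr (ripC _ (T (T f)) f).
rewrite -(sT f (T f)).
have := cT (T f); rewrite -ler_sqr ?nnegrE ?mulr_ge0 ?rn_ge0 ?(ltW c0)//.
rewrite exprMn !sqr_rn => h.
have ci0 : 0 < c ^- 2 by rewrite invr_gt0 exprn_gt0.
have := ler_wpM2l (ltW ci0) (ler_wpM2l (ltW ci0) h).
by rewrite [c ^- 2 * (c ^+ 2 * _)]mulKf ?expf_neq0 ?gt_eqF//; lra.
Qed.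

Lemma complement_contraction f : nrm (complement_op c T f) <= nrm f.
Proof.
rewrite -ler_sqr ?nnegrE ?rn_ge0// !sqr_rn.
apply: le_trans (complement_decrease f) _.
by rewrite gerBl mulr_ge0 ?rip_ge0// invr_ge0 exprn_ge0// ltW.
Qed.

Lemma complement_commuting B : commuting T B -> commuting (complement_op c T) B.
Proof. by move=> TB f; rewrite !complement_opE !TB -linearZZ -linearB. Qed.

End complement.

(* [P] is c (1 - Y), where (1 - Y)^2 = T^2 / c^2. *)
Lemma abs_op T : symmetric_op T -> bounded_op T ->
  exists P : {linear H -> H}, [/\ symmetric_op P, bounded_op P,
    forall f, 0 <= ip (P f) f, forall f, P (P f) = T (T f) &
    forall B, bounded_op B -> commuting T B -> commuting P B].
Proof.
move=> sT [c c0 cT].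
have [Y [sY cY YE YB]] := sqrt_complement (complement_contraction sT c0 cT)
  (complement_symmetric c sT).
pose P : {linear H -> H} := c%:C \*: (idfun \- Y).
have PE f : P f = c%:C *: (f - Y f) by [].
exists P; split.
- by move=> f g; rewrite !PE ripZl ripZr ripBl ripBr sY.
- exists (c * 2); first by rewrite mulr_gt0.
  move=> f; rewrite PE rnZr gtr0_norm// -mulrA ler_wpM2l ?(ltW c0)//.
  by have := ler_rnB (@inner _ H) f (Y f); have := cY f; lra.
- move=> f; rewrite PE ripZl mulr_ge0 ?(ltW c0)// ripBl subr_ge0.
  apply: le_trans (ripl_le _ _ _) _; rewrite -sqr_rn expr2.
  by rewrite ler_wpM2r ?rn_ge0.
- move=> f; rewrite !PE (linearZZ Y) (linearB Y) -scalerBr scalerA.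
  have -> : Y (Y f) = Y f + Y f - (f - (c ^- 2)%:C *: T (T f)).
    rewrite -complement_opE [in RHS](YE f) -scalerDl.
    have -> : (2^-1)%:C + (2^-1)%:C = 1 :> R[i].
      by rewrite -rmorphD/= -[RHS](rmorph1 (real_complex R)); congr (_ %:C); lra.
    by rewrite scale1r addrAC subrr add0r.
  rewrite (opprB (Y f)) (addrAC (Y f + Y f)) addrK addrA subrK subKr.
  rewrite scalerA -!rmorphM/= -expr2 divff ?expf_neq0 ?gt_eqF//.
  by rewrite rmorph1 scale1r.
- move=> B bB TB f; rewrite !PE YB ?linearZZ ?linearB//.
  exact: complement_commuting.
Qed.

Section kernel_projection.
Variables (C : {linear H -> H}).
Hypotheses (sC : symmetric_op C) (cC : forall f, nrm (C f) <= nrm f).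

Definition op_pow n : {linear H -> H} :=
  iter n (fun D : {linear H -> H} => C \o D) idfun.

Lemma op_powD m n f : op_pow (m + n) f = op_pow m (op_pow n f).
Proof. by elim: m => //= m ->. Qed.

Lemma op_pow_symmetric n : symmetric_op (op_pow n).
Proof.
elim: n => // n IH f g.
rewrite -[X in _ = ip f (op_pow X g)]addn1 op_powD.
by rewrite (_ : op_pow n.+1 f = C (op_pow n f))// sC IH.
Qed.

Let a f n := ip (op_pow n f) (op_pow n f).

Lemma op_pow_rip m n f : ip (op_pow (m + m) f) (op_pow (n + n) f) = a f (m + n).
Proof.
by rewrite op_powD (op_pow_symmetric m) -op_powD addnCA op_powD
  -(op_pow_symmetric n) -op_powD addnC.
Qed.

(** By symmetry <C^(2m) f, C^(2n) f> = |C^(m+n) f|^2, and these numbers decrease to a limit, so the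
    three terms of |C^(2m) f - C^(2n) f|^2 cancel asymptotically. Even powers are what makes the
    mixed product a squared norm. *)
Lemma op_pow_cvg f : exists l : H, op_pow (n + n) f @[n --> \oo] --> l.
Proof.
have nd : nonincreasing_seq (a f).
  apply/nonincreasing_seqP => n; rewrite /a -!sqr_rn ler_sqr ?nnegrE ?rn_ge0//.
  exact: cC.
have ca : cvgn (a f).
  apply: nonincreasing_is_cvgn => //; exists 0 => _ [n _ <-].
  exact: rip_ge0.
have al n : limn (a f) <= a f n by exact: nonincreasing_cvgn_ge.
apply: rn_cauchy => e e0; have e2 : 0 < e ^+ 2 / 2 by rewrite divr_gt0// exprn_gt0.
move/cvgrPdist_lt : (ca) => /(_ _ e2)[N _ NP]; exists N => m n Nm Nn.
rewrite -ltr_sqr ?nnegrE ?rn_ge0 ?(ltW e0)// sqr_rn ripBl !ripBr !op_pow_rip.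
rewrite (addnC n m).
have hN k : (N <= k)%N -> a f (k + k) < limn (a f) + e ^+ 2 / 2.
  move=> Nk; have /= := NP (k + k)%N (leq_trans Nk (leq_addr _ _)).
  by rewrite distrC ger0_norm ?subr_ge0// ltrBlDl.
by have := hN _ Nm; have := hN _ Nn; have := al (m + n)%N; lra.
Qed.

End kernel_projection.

(* The projection is the strong limit of the even powers of the contraction
   1 - G^2 / c^2. *)
Lemma kernel_projection (G : {linear H -> H}) : symmetric_op G -> bounded_op G ->
  exists E : {linear H -> H}, [/\ symmetric_op E,
    forall f, E f = f <-> G f = 0, forall f, E (E f) = E f &
    forall B, bounded_op B -> commuting G B -> commuting E B].
Proof.
move=> sG [c c0 cG].
pose C := complement_op c G.
have sC : symmetric_op C by exact: complement_symmetric.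
have cC : forall f, nrm (C f) <= nrm f by exact: complement_contraction.
have [E EP] := limit_op (op_pow_cvg sC cC).
have CCE f : C (C (E f)) = E f.
  have := EP f; rewrite -(cvg_shiftS (fun n => op_pow C (n + n) f)) => h.
  have cvC (u : nat -> H) (l : H) : u n @[n --> \oo] --> l ->
      C (u n) @[n --> \oo] --> C l.
    by apply: bounded_cvg; exists 1 => // g; rewrite mul1r.
  apply: cvg_unique_H (cvC _ _ (cvC _ _ (EP f))) _.
  have E2 : (fun n => C (C (op_pow C (n + n) f))) =
      (fun n => op_pow C (n.+1 + n.+1) f) by apply/funext => n; rewrite addnS.
  by rewrite E2.
(* Here |f| = |C (C f)| <= |C f|, whereas |C f|^2 <= |f|^2 - c^-2 |G f|^2. *)
have ker f : C (C f) = f -> G f = 0.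
  move=> CCf; have := complement_decrease sG c0 cG f.
  have := complement_contraction sG c0 cG (C f).
  rewrite -/C CCf -ler_sqr ?nnegrE ?rn_ge0// !sqr_rn => h1 h2.
  have ci0 : 0 < c ^- 2 by rewrite invr_gt0 exprn_gt0.
  apply: (@rip_eq0 _ _ (@inner _ H)); apply/eqP; rewrite eq_le rip_ge0 andbT.
  rewrite -(pmulr_rle0 _ ci0); move: (le_trans h1 h2); lra.
have Eker f : G f = 0 -> E f = f.
  move=> Gf; apply: cvg_unique_H (EP f) _.
  have Cf : C f = f by rewrite /C complement_opE Gf linear0 scaler0 subr0.
  have powf n : op_pow C n f = f by elim: n => //= n ->.
  by under eq_fun do rewrite powf; exact: cvg_cst.
exists E; split.
- by apply: (limit_symmetric EP) => n; exact: op_pow_symmetric.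
- by move=> f; split=> [Ef|]; [apply: ker; rewrite -Ef CCE|exact: Eker].
- by move=> f; apply/Eker/ker/CCE.
- move=> B bB GB; apply: (limit_commuting EP bB) => n f.
  elim: (n + n)%N => //= k ->.
  by apply: (complement_commuting c).
Qed.

(* [E] projects on the kernel of |A - l| + (A - l). *)
Lemma spectral_projection (A : {linear H -> H}) (l : R) :
  symmetric_op A -> bounded_op A ->
  exists E : {linear H -> H}, [/\ symmetric_op E, forall f, E (E f) = E f,
    forall B, bounded_op B -> commuting A B -> commuting E B,
    forall f, E f = f -> ip (A f) f <= l * ip f f &
    forall f, E f = 0 -> l * ip f f <= ip (A f) f /\
      (ip (A f) f = l * ip f f -> f = 0)].
Proof.
move=> sA [c c0 cA].
pose T : {linear H -> H} := A \- (l%:C \*: idfun).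
have TE f : T f = A f - l%:C *: f by [].
have bT : bounded_op T.
  exists (c + `|l|); first by rewrite ltr_pwDl.
  move=> f; rewrite TE; apply: le_trans (ler_rnB _ _ _) _.
  by rewrite rnZr mulrDl lerD2r.
have sT : symmetric_op T by move=> f g; rewrite !TE ripBl ripBr ripZl ripZr sA.
have TB (B : {linear H -> H}) : commuting A B -> commuting T B.
  by move=> AB f; rewrite !TE AB -linearZZ -linearB.
have [P [sP bP P0 PP PB]] := abs_op sT bT.
pose G : {linear H -> H} := P \+ T.
have GE f : G f = P f + T f by [].
have bG : bounded_op G.
  have [a a0 aT] := bT; have [b b0 bP'] := bP; exists (b + a); first exact: addr_gt0.
  move=> f; rewrite GE mulrDl; apply: le_trans (ler_rnD _ _ _) _.
  exact: lerD.
have sG : symmetric_op G by move=> f g; rewrite !GE ripDl ripDr sP sT.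
have [E [sE Eker EE EB]] := kernel_projection sG bG.
have PT : commuting P T by apply: PB.
have GB (B : {linear H -> H}) : bounded_op B -> commuting A B -> commuting G B.
  move=> bB AB f; rewrite !GE (PB B)//; last exact: TB.
  by rewrite (TB B)// -linearD.
have ETP : commuting E P.
  by apply: EB => // f; rewrite !GE -PT -linearD.
have ET : commuting E T.
  by apply: EB => // f; rewrite !GE PT -linearD.
have Tneg f : E f = f -> T f = - P f.
  by move=> /Eker; rewrite GE => /eqP; rewrite addrC addr_eq0 => /eqP.
(* Since G (P - T) = P^2 - T^2 = 0, E fixes P f - T f; as E commutes with P and T, it also kills
   this vector when E f = 0. *)
have Tpos f : E f = 0 -> T f = P f.
  move=> Ef; have : E (P f - T f) = P f - T f.
    by apply/Eker; rewrite GE (linearB P) (linearB T) PP PT addrA subrK subrr.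
  rewrite (linearB E) ETP ET Ef (linear0 P) (linear0 T) subrr => /esym/eqP.
  by rewrite subr_eq0 => /eqP.
have TA f : ip (T f) f = ip (A f) f - l * ip f f by rewrite TE ripBl ripZl.
exists E; split => //.
- by move=> B bB AB; apply: EB => //; exact: GB.
- move=> f /Tneg Tf; rewrite -subr_le0 -TA Tf ripNl oppr_le0; exact: P0.
- move=> f Ef; have Tf := Tpos _ Ef; split; first by rewrite -subr_ge0 -TA Tf P0.
  (* The kernel of T lies in the range of E, so equality forces f = 0 when E f = 0. This clause is
     the source of right-continuity. *)
  move=> /eqP; rewrite -subr_eq0 -TA Tf => /eqP/(positive_op_eq0 sP bP P0) Pf.
  have : E f = f by apply/Eker; rewrite GE Tf Pf addr0.
  by rewrite Ef.
Qed.

End spectral_projections.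

Section symmetric.
Context {R : realType} {H : hilbertType R}.
Implicit Types (f g h : H).

Lemma symmetric_inner (T : {linear H -> H}) : symmetric_op T ->
  forall f g, inner (T f) g = inner f (T g).
Proof.
by move=> sT f g; rewrite [LHS]form_ripE [RHS]form_ripE !sT linearZZ.
Qed.

Lemma symmetric_inner_real (T : {linear H -> H}) : symmetric_op T ->
  forall f, inner (T f) f = (ip (T f) f)%:C.
Proof.
move=> sT f; have := rip_conj (@inner _ H) (T f) f.
rewrite -(symmetric_inner sT) /rip; case: (inner (T f) f) => x y [] /= yN.
by congr (_ +i* _); lra.
Qed.

End symmetric.

(** * The spectral family of a bounded symmetric operator *)

Section spectral_family.
Context {R : realType} {H : hilbertType R}.
Implicit Types (f g h : H).
Variable A : {linear H -> H}.
Hypotheses (sA : symmetric_op A) (bA : bounded_op A).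
Variable E : R -> {linear H -> H}.
Hypotheses (E_sym : forall l, symmetric_op (E l))
  (E_idem : forall l f, E l (E l f) = E l f)
  (E_comm : forall l (B : {linear H -> H}), bounded_op B -> commuting A B ->
     commuting (E l) B)
  (E_le : forall l f, E l f = f -> ip (A f) f <= l * ip f f)
  (E_ge : forall l f, E l f = 0 -> l * ip f f <= ip (A f) f)
  (E_eq : forall l f, E l f = 0 -> ip (A f) f = l * ip f f -> f = 0).

Lemma proj_ripE l f : ip (E l f) f = ip (E l f) (E l f).
Proof. by rewrite [RHS]E_sym E_idem ripC. Qed.

Lemma proj_contraction l f : nrm (E l f) <= nrm f.
Proof.
rewrite -ler_sqr ?nnegrE ?rn_ge0// !sqr_rn.
have := rip_ge0 (@inner _ H) (f - E l f).
by rewrite ripBl !ripBr (ripC _ f (E l f)) proj_ripE; lra.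
Qed.

Lemma proj_bounded l : bounded_op (E l).
Proof. by exists 1 => // f; rewrite mul1r proj_contraction. Qed.

Lemma proj_commA l : commuting (E l) A.
Proof. by apply: E_comm => // f. Qed.

Lemma proj_commE l m : commuting (E l) (E m).
Proof.
by apply: E_comm; [exact: proj_bounded|move=> f; rewrite proj_commA].
Qed.

(** The defect g = E_l f - E_m E_l f lies in the range of E_l and in the kernel of E_m, so m |g|^2
    <= <A g, g> <= l |g|^2, which forces g = 0 when l < m. *)
Lemma proj_le l m f : l <= m -> E m (E l f) = E l f.
Proof.
rewrite le_eqVlt => /predU1P[->|lm]; first exact: E_idem.
apply/eqP; rewrite eq_sym -subr_eq0; apply/eqP; set g := E l f - _.
have Elg : E l g = g by rewrite /g linearB E_idem -proj_commE E_idem.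
have Emg : E m g = 0 by rewrite /g linearB E_idem subrr.
apply: (@rip_eq0 _ _ (@inner _ H)); apply/eqP; rewrite eq_le rip_ge0 andbT.
have := le_trans (E_ge Emg) (E_le Elg).
by rewrite -subr_ge0 -mulrBl nmulr_rge0 ?subr_lt0.
Qed.

Lemma projM l m f : E l (E m f) = E (Order.min l m) f.
Proof.
have [lm|/ltW ml] := leP l m; last by rewrite proj_le.
by rewrite proj_commE proj_le.
Qed.

Lemma projB_rip l m f : l <= m ->
  ip (E m f - E l f) (E m f - E l f) = ip (E m f) f - ip (E l f) f.
Proof.
move=> lm.
have c1 : ip (E m f) (E l f) = ip (E l f) f by rewrite E_sym proj_le// ripC.
by rewrite ripBl !ripBr -!proj_ripE (ripC _ (E l f) (E m f)) c1; lra.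
Qed.

Lemma proj_rip_nd f : nondecreasing (fun l => ip (E l f) f).
Proof.
by move=> l m lm; rewrite -subr_ge0 -projB_rip// rip_ge0.
Qed.

Lemma proj_out : exists2 c : R, 0 < c &
  forall l f, (l < - c -> E l f = 0) /\ (c < l -> E l f = f).
Proof.
have [c c0 cA] := bA; exists c => // l f.
have hA g : `|ip (A g) g| <= c * ip g g.
  apply: le_trans (ler_rip _ _ _) _; rewrite -sqr_rn expr2 mulrA.
  by rewrite ler_wpM2r ?rn_ge0.
split=> lc.
  apply: (@rip_eq0 _ _ (@inner _ H)); apply/eqP; rewrite eq_le rip_ge0 andbT.
  have := E_le (E_idem l f); have := hA (E l f); rewrite ler_norml => /andP[h _] h'.
  have : (l + c) * ip (E l f) (E l f) >= 0 by lra.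
  by rewrite nmulr_rge0//; lra.
apply/esym/eqP; rewrite -subr_eq0; apply/eqP; set g := f - _.
have Eg : E l g = 0 by rewrite /g linearB E_idem subrr.
apply: (@rip_eq0 _ _ (@inner _ H)); apply/eqP; rewrite eq_le rip_ge0 andbT.
have := E_ge Eg; have := hA g; rewrite ler_norml => /andP[_ h] h'.
have : (l - c) * ip g g <= 0 by lra.
by rewrite pmulr_rle0//; lra.
Qed.

(** Monotonicity gives a limit g fixed by every E_m with m > l. Then h = g - E_l g is killed by E_l
    and fixed by these E_m, so <A h, h> = l |h|^2 and [E_eq] yields h = 0. *)
Lemma proj_right_limit l f :
  E (l + n.+1%:R^-1) f @[n --> \oo] --> E l f.
Proof.
pose u n : H := E (l + n.+1%:R^-1) f.
pose a n := ip (u n) f.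
have um m n : (m <= n)%N -> l + n.+1%:R^-1 <= l + m.+1%:R^-1 :> R.
  by move=> mn; rewrite lerD2l lef_pV2 ?posrE ?ltr0n// ler_nat.
have na : nonincreasing_seq a by move=> m n /um; exact: proj_rip_nd.
have ca : cvgn a.
  apply: nonincreasing_is_cvgn => //; exists 0 => _ [n _ <-].
  by rewrite /a proj_ripE rip_ge0.
have al n : limn a <= a n by exact: nonincreasing_cvgn_ge.
have [g ug] : exists g : H, u n @[n --> \oo] --> g.
  apply: rn_cauchy => e e0; have e20 : 0 < e ^+ 2 by rewrite exprn_gt0.
  move/cvgrPdist_lt : (ca) => /(_ _ e20)[N _ NP]; exists N.
  have hN k : (N <= k)%N -> a k < limn a + e ^+ 2.
    move=> Nk; have /= := NP k Nk.
    by rewrite distrC ger0_norm ?subr_ge0// ltrBlDl.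
  have main m n : (N <= m)%N -> (m <= n)%N -> nrm (u m - u n) < e.
    move=> Nm mn; rewrite -ltr_sqr ?nnegrE ?rn_ge0 ?(ltW e0)// sqr_rn.
    rewrite projB_rip ?um// -/(a m) -/(a n).
    by have := hN _ Nm; have := al n; lra.
  move=> m n Nm Nn; have [mn|/ltnW nm] := leqP m n; first exact: main.
  by rewrite rnBC; exact: main.
have Eg m : l < m -> E m g = g.
  move=> lm; apply: cvg_unique_H (bounded_cvg (proj_bounded m) ug) _.
  apply: cvg_trans ug; apply: near_eq_cvg.
  have ml0 : 0 < m - l by rewrite subr_gt0.
  near=> n; rewrite /u proj_le//.
  rewrite -lerBrDl -[leRHS]invrK lef_pV2 ?posrE ?invr_gt0 ?ltr0n//.
  rewrite -natr1; apply: le_trans (_ : n%:R <= _); last by rewrite lerDl.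
  by near: n; exact: nbhs_infty_ger.
have El : E l g = E l f.
  apply: cvg_unique_H (bounded_cvg (proj_bounded l) ug) _.
  have E2 : (fun n => E l (u n)) = fun=> E l f.
    by apply/funext => n; rewrite /u projM min_l// lerDl invr_ge0.
  by rewrite E2; exact: cvg_cst.
suff -> : E l f = g by [].
rewrite -El; apply/esym/eqP; rewrite -subr_eq0; apply/eqP; set h := g - _.
have Elh : E l h = 0 by rewrite /h linearB E_idem subrr.
apply: (E_eq Elh); apply/eqP; rewrite eq_le (E_ge Elh) andbT.
apply/ler_addgt0Pr => e e0.
have hh : 0 < ip h h + 1 by rewrite ltr_wpDl ?rip_ge0.
have d0 : 0 < e / (ip h h + 1) by rewrite divr_gt0.
have lm : l < l + e / (ip h h + 1) by rewrite ltrDl.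
have Emh : E (l + e / (ip h h + 1)) h = h.
  by rewrite /h (linearB (E _)) (Eg _ lm) projM min_r// ltW.
apply: le_trans (E_le Emh) _; rewrite mulrDl lerD2l.
rewrite -mulrA ger_pMr// mulrC ler_pdivrMr// mul1r lerDl//.
Unshelve. all: by end_near. Qed.

Lemma proj_right_continuous l f : E m f @[m --> l^'+] --> E l f.
Proof.
apply/cvg_rnP => e e0.
have /cvg_rnP/(_ _ e0)[N _ NP] := @proj_right_limit l f.
have := NP N (leqnn N) => /= hN.
near=> m; have lm : l <= m by apply: ltW; near: m; exact: nbhs_right_gt.
have mN : m <= l + N.+1%:R^-1.
  by near: m; apply: nbhs_right_le; rewrite ltrDl invr_gt0.
apply: le_lt_trans hN; rewrite rnBC [leRHS]rnBC.
rewrite -ler_sqr ?nnegrE ?rn_ge0// !sqr_rn !projB_rip// ?lerD2r.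
  exact: proj_rip_nd.
exact: le_trans mN.
Unshelve. all: by end_near. Qed.

Lemma proj_cvg_ninfty f : E l f @[l --> -oo] --> (0 : H).
Proof.
have [c c0 cE] := proj_out; apply: cvg_near_cst.
near=> l; apply: (cE l f).1.
by near: l; exact: (nbhs_ninfty_lt (num_real _)).
Unshelve. all: by end_near. Qed.

Lemma proj_cvg_pinfty f : E l f @[l --> +oo] --> f.
Proof.
have [c c0 cE] := proj_out; apply: cvg_near_cst.
near=> l; apply: (cE l f).2.
by near: l; exact: (nbhs_pinfty_gt (num_real _)).
Unshelve. all: by end_near. Qed.

Definition spectral_resolution : resolution [set: H] :=
  @Resolution R H setT E (fun l => symmetric_inner (E_sym l)) (fun _ _ => I)
    projM (@proj_right_continuous) (@proj_cvg_ninfty) (fun f _ => @proj_cvg_pinfty f).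

End spectral_family.

Lemma spectral_family_exists (R : realType) (H : hilbertType R)
    (A : {linear H -> H}) :
  symmetric_op A -> bounded_op A ->
  exists E : resolution [set: H], [/\
    forall l, commuting (E l) A,
    forall l f, E l f = f -> ip (A f) f <= l * ip f f,
    forall l f, E l f = 0 -> l * ip f f <= ip (A f) f &
    exists2 c : R, 0 < c &
      forall l f, (l < - c -> E l f = 0) /\ (c < l -> E l f = f)].
Proof.
move=> sA bA.
have /choice[E EP] l := spectral_projection l sA bA.
have E1 l : symmetric_op (E l) by have [] := EP l.
have E2 l f : E l (E l f) = E l f by have [_ ->] := EP l.
have E3 l (B : {linear H -> H}) : bounded_op B -> commuting A B -> commuting (E l) B.
  by have [_ _ + _ _] := EP l; exact.
have E4 l f : E l f = f -> ip (A f) f <= l * ip f f.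
  by have [_ _ _ + _] := EP l; exact.
have E5 l f : E l f = 0 -> l * ip f f <= ip (A f) f.
  by have [_ _ _ _ h] := EP l => /h[].
have E6 l f : E l f = 0 -> ip (A f) f = l * ip f f -> f = 0.
  by have [_ _ _ _ h] := EP l => /h[].
exists (spectral_resolution bA E1 E2 E3 E4 E5 E6); split => //=.
- by move=> l; exact: proj_commA.
- exact: (proj_out bA E2 E4 E5).
Qed.

(** * Spectral measures *)

Section lebesgue_stieltjes.
Context {R : realType}.
Implicit Types (F G : cumulative R R) (A : set R).
Local Notation ls := lebesgue_stieltjes_measure.

Lemma ls_itv F (a b : R) : a <= b -> ls F `]a, b]%classic = (F b - F a)%:E.
Proof.
move=> ab; rewrite /ls /measure_extension/= measurable_mu_extE//=.
  by rewrite wlength_itv_bnd.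
exact: is_ocitv.
Qed.

(** Both measures are infima over the same countable covers by half-open intervals, which are
    compared interval by interval. *)
Lemma ls_le F G A :
  (forall a b, a <= b -> F b - F a <= G b - G a) -> (ls F A <= ls G A)%E.
Proof.
move=> FG; apply: le_ereal_inf_tmp => _ [B [mB AB] <-].
apply: ge_ereal_inf; exists (\sum_(k <oo) wlength F (B k))%E.
  by exists B.
apply: lee_nneseries => k _; first by move=> _; exact: wlength_ge0.
have [[x y] _ <-] := mB k.
have [xy|yx] := leP x y; first by rewrite /= !wlength_itv_bnd// lee_fin FG.
by rewrite /= set_itv_ge ?wlength0//= bnd_simp -leNgt ltW.
Qed.

(** The combination c1 G1 + c2 G2 is again a distribution function, and by uniqueness its measure is
    the same combination of measures. Dominations between spectral measures reduce through this to
    inequalities between increments. *)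
Lemma ls_le2 F G1 G2 (c1 c2 : R) A : 0 <= c1 -> 0 <= c2 ->
  (forall a b, a <= b -> F b - F a <=
     c1 * (G1 b - G1 a) + c2 * (G2 b - G2 a)) ->
  measurable A ->
  (ls F A <= c1%:E * ls G1 A + c2%:E * ls G2 A)%E.
Proof.
move=> c10 c20 FG mA.
pose g l := c1 * G1 l + c2 * G2 l.
have nd : nondecreasing g.
  move=> l m lm; rewrite lerD// ler_wpM2l//; exact: cumulative_is_nondecreasing.
have rc : right_continuous g.
  move=> l; apply: cvgD; apply: cvgMl_tmp; exact: cumulative_is_right_continuous.
pose G : cumulative R R := HB.pack g (isCumulative.Build _ _ _ g nd rc).
apply: (@le_trans _ _ (ls G A)).
  by apply: ls_le => a b ab; apply: le_trans (FG _ _ ab) _; rewrite /= /g; lra.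
pose nu : {measure set (measurableTypeR R) -> \bar R} :=
  measure_add (mscale (NngNum c10) (ls G1)) (mscale (NngNum c20) (ls G2)).
have nuE X : nu X = (c1%:E * ls G1 X + c2%:E * ls G2 X)%E.
  exact: measure_addE.
rewrite -nuE (@lebesgue_stieltjes_measure_unique _ G nu)//.
move=> _ [[a b] _ <-]; rewrite nuE /=.
have [ab|ba] := leP a b; last first.
  by rewrite set_itv_ge ?measure0 ?mule0 ?adde0//= bnd_simp -leNgt ltW.
rewrite !ls_itv// -!EFinM -EFinD /= /g; congr (_ %:E).
by ring.
Qed.

Lemma ls_null_compl F (a b : R) :
  (forall l, l <= a -> F l = F a) -> (forall l, b <= l -> F l = F b) ->
  ls F (~` `]a, b]%classic) = 0%E.
Proof.
move=> Fa Fb.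
have -> : ~` `]a, b]%classic =
    \bigcup_n `]a - n%:R, a]%classic `|` \bigcup_n `]b, b + n%:R]%classic.
  apply/seteqP; split=> x.
    rewrite /= in_itv/= => /negP; rewrite negb_and -!ltNge -leNgt => /orP[xa|bx].
      left; exists (Num.bound (a - x)) => //=; rewrite in_itv/= xa andbT.
      by rewrite ltrBlDl -ltrBlDr; apply: archi_boundP; lra.
    right; exists (Num.bound (x - b)) => //=; rewrite in_itv/= bx/=.
    by rewrite -lerBlDl; apply/ltW/archi_boundP; lra.
  move=> [[n _ /=]|[n _ /=]]; rewrite !in_itv/= => /andP[h1 h2] /andP[h3 h4]; lra.
have mu0 x y : x <= y -> F x = F y -> (ls F).-negligible `]x, y]%classic.
  move=> xy Fxy; apply/negligibleP; first exact: measurable_itv.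
  by have := ls_itv F xy; rewrite Fxy subrr.
apply: measure_negligible.
  by apply: measurableU; apply: bigcup_measurable => n _; exact: measurable_itv.
apply: negligibleU; apply: negligible_bigcup => n; apply: mu0; rewrite ?gerBl ?lerDl//.
  by rewrite Fa// gerBl.
by rewrite [RHS]Fb// lerDl.
Qed.

Lemma ls_itv_lty F (x y : R) : (ls F `]x, y]%classic < +oo)%E.
Proof.
have [xy|yx] := leP x y; first by rewrite ls_itv// ltry.
by rewrite set_itv_ge ?measure0//= bnd_simp -leNgt ltW.
Qed.

Section integral_id.
Variables (F : cumulative R R) (G : R -> R).

Lemma integrable_id_itv x y : (ls F).-integrable `]x, y] (EFin \o id).
Proof.
apply: measurable_bounded_integrable => //.
- exact: ls_itv_lty.
- exists (`|x| + `|y|); split; first by rewrite num_real.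
  move=> M hM z /=; rewrite in_itv/= => /andP[xz zy].
  apply: ltW; apply: le_lt_trans hM.
  by rewrite ler_norml; have := ler_norm x; have := ler_norm (- x);
    have := ler_norm y; have := ler_norm (- y); rewrite !normrN; lra.
Qed.

Lemma ls_integral_bounds x y : x <= y ->
  x * (F y - F x) <= \int[ls F]_(z in `]x, y]) z <= y * (F y - F x).
Proof.
move=> xy; have mxy : fine (ls F `]x, y]%classic) = F y - F x.
  by rewrite ls_itv.
have ic r : (ls F).-integrable `]x, y] (EFin \o (fun=> r)).
  apply: measurable_bounded_integrable => //; first exact: ls_itv_lty.
  by exists `|r|; split; rewrite ?num_real// => M /ltW hM z _.
rewrite -mxy -!Rintegral_cst//; apply/andP; split; apply: le_Rintegral => //;
  try exact: integrable_id_itv; by move=> z /=; rewrite in_itv/= => /andP[/ltW + +].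
Qed.

Variables (a b : R).
Hypothesis FG : forall x y, a <= x -> x <= y -> y <= b ->
  x * (F y - F x) <= G y - G x <= y * (F y - F x).

Let J x y := \int[ls F]_(z in `]x, y]) z.

Let JD x m y : x <= m -> m <= y -> J x y = J x m + J m y.
Proof.
move=> xm my; rewrite /J -Rintegral_setU//.
- by rewrite -itv_bndbnd_setU.
- by rewrite -itv_bndbnd_setU//; exact: integrable_id_itv.
- apply/disj_setPS => z /= []; rewrite !in_itv/= => /andP[_ zm] /andP[mz _]; lra.
Qed.

(* Cutting [x, y] into 2^k intervals divides the error by 2^k, because both
   [J] and the increments of [G] are additive. *)
Let dyadic k x y : a <= x -> x <= y -> y <= b ->
  `|J x y - (G y - G x)| * 2 ^+ k <= (y - x) * (F y - F x).
Proof.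
elim: k x y => [|k IH] x y ax xy yb.
  rewrite expr0 mulr1.
  have /andP[h1 h2] := ls_integral_bounds xy.
  have /andP[h3 h4] := FG ax xy yb.
  by rewrite ler_norml /J; apply/andP; split; lra.
pose m := (x + y) / 2.
have xm : x <= m by rewrite /m; lra.
have my : m <= y by rewrite /m; lra.
have := IH x m ax xm (le_trans my yb); have := IH m y (le_trans ax xm) my yb.
rewrite (JD xm my); move: (J x m) (J m y) => I1 I2 h2 h1.
have e1 : m - x = (y - x) / 2 by rewrite /m; lra.
have e2 : y - m = (y - x) / 2 by rewrite /m; lra.
rewrite e1 in h1; rewrite e2 in h2.
have -> : I1 + I2 - (G y - G x) = (I1 - (G m - G x)) + (I2 - (G y - G m)) by lra.
have p0 : 0 < 2 ^+ k :> R by rewrite exprn_gt0.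
have := ler_wpM2r (ltW p0) (ler_normD (I1 - (G m - G x)) (I2 - (G y - G m))).
by rewrite exprS; lra.
Qed.

(** The hypothesis [FG] is the mean value form of dG = z dF, and the dyadic estimate bounds the
    error by C / 2^k for every k. *)
Lemma ls_integral_id : a <= b -> \int[ls F]_(z in `]a, b]) z = G b - G a.
Proof.
move=> ab; apply/eqP; rewrite -subr_eq0 -normr_eq0 eq_le normr_ge0 andbT.
set d := `| _ |; set C := (b - a) * (F b - F a).
have h k : d * 2 ^+ k <= C by exact: dyadic.
rewrite leNgt; apply/negP => d0.
(* As n < 2^n, this value of k already contradicts the bound when d > 0. *)
have /(_ (Num.bound (C / d))) := h.
rewrite leNgt => /negP; apply; rewrite mulrC -ltr_pdivrMr//.
apply: lt_le_trans (archi_boundP _) _.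
  rewrite divr_ge0// ?(ltW d0)//; apply: le_trans (h 0%N).
  by rewrite mulr_ge0// ltW.
by rewrite -natrX ler_nat ltnW// ltn_expl.
Qed.

End integral_id.

Lemma ls_integral_id_full F (G : R -> R) (a b : R) : a <= b ->
  (forall x y, a <= x -> x <= y -> y <= b ->
     x * (F y - F x) <= G y - G x <= y * (F y - F x)) ->
  ls F (~` `]a, b]%classic) = 0%E ->
  \int[ls F]_z z = G b - G a /\ (\int[ls F]_z (z ^+ 2)%:E < +oo)%E.
Proof.
move=> ab FG N0.
have mI : measurable (`]a, b]%classic : set (measurableTypeR R)).
  exact: measurable_itv.
have mC : measurable (~` `]a, b]%classic : set (measurableTypeR R)).
  exact: measurableC.
have DI : [set: measurableTypeR R] `\` ~` `]a, b]%classic = `]a, b]%classic.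
  by rewrite setDE setCK setTI.
have mf : measurable_fun [set: measurableTypeR R] (@EFin R).
  exact: EFin_measurable.
have intid : (ls F).-integrable setT (@EFin R).
  have [_ h] := negligible_integrable (mu := ls F) mC measurableT mf N0.
  by apply: h; rewrite DI; exact: integrable_id_itv.
split.
  rewrite -(ls_integral_id FG)// /Rintegral; congr fine.
  by rewrite (negligible_integral mC measurableT intid N0) DI.
rewrite (ge0_negligible_integral mC measurableT _ _ N0)//; last 2 first.
- by apply/measurable_EFinP; exact: measurable_funX.
- by move=> z _; rewrite lee_fin sqr_ge0.
rewrite DI.
apply: (@le_lt_trans _ _ (\int[ls F]_(z in `]a, b]) ((`|a| + `|b|) ^+ 2)%:E)%E).
  apply: ge0_le_integral => //.
  - by move=> z _; rewrite lee_fin sqr_ge0.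
  - apply: measurable_funS (_ : measurable_fun setT _) => //.
    by apply/measurable_EFinP; exact: measurable_funX.
  - move=> z /=; rewrite in_itv/= lee_fin => /andP[az zb].
    rewrite -[z ^+ 2]real_normK ?num_real// ler_sqr ?nnegrE ?addr_ge0//.
    by rewrite ler_norml; have := ler_norm a; have := ler_norm (- a);
      have := ler_norm b; have := ler_norm (- b); rewrite !normrN; lra.
rewrite integral_cst//.
by apply: lte_mul_pinfty; [rewrite lee_fin sqr_ge0|by []|exact: ls_itv_lty].
Qed.

Section step.
Variables (F : cumulative R R) (c m : R).
Hypothesis Fstep : forall l, F l = if c <= l then m else 0.

Lemma ls_step_null : ls F (~` [set c]) = 0%E.
Proof.
have -> : ~` [set c] = \bigcup_n ~` `]c - n.+1%:R^-1, c]%classic.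
  apply/seteqP; split=> x /=; last first.
    move=> [n _ /=]; rewrite in_itv/= => + xc; rewrite xc lexx andbT => /negP.
    by rewrite ltrBlDr ltrDl invr_gt0 ltr0n.
  move=> xc; have [cx|xltc] := ltP c x.
    by exists 0%N => //=; rewrite in_itv/= leNgt cx andbF.
  have dx : 0 < c - x by rewrite subr_gt0 lt_neqAle xltc andbT; apply/eqP.
  exists (Num.bound (c - x)^-1) => //=; rewrite in_itv/= => /andP[+ _].
  apply/negP; rewrite -leNgt lerBrDl -lerBrDr.
  rewrite -[leRHS]invrK lef_pV2 ?posrE ?invr_gt0 ?ltr0n//.
  apply/ltW/(lt_trans (archi_boundP _)); first by rewrite invr_ge0 ltW.
  by rewrite ltr_nat.
apply: measure_negligible.
  apply: bigcup_measurable => n _; apply: measurableC; exact: measurable_itv.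
apply: negligible_bigcup => n; apply/negligibleP.
  by apply: measurableC; exact: measurable_itv.
have n0 : 0 < n.+1%:R^-1 :> R by rewrite invr_gt0 ltr0n.
apply: ls_null_compl => l hl; rewrite !Fstep.
  have ac : c - n.+1%:R^-1 < c by rewrite ltrBlDr ltrDl.
  by rewrite !leNgt ac (le_lt_trans hl ac).
by rewrite hl lexx.
Qed.

Lemma ls_step_set1 : ls F [set c] = m%:E.
Proof.
have m1 : measurable ([set c] : set (measurableTypeR R)).
  exact: (@measurable_set1 R).
have m2 : measurable (`]c - 1, c]%classic : set (measurableTypeR R)).
  exact: measurable_itv.
have -> : m%:E = ls F `]c - 1, c]%classic.
  rewrite ls_itv ?gerBl// !Fstep lexx leNgt ltrBlDr ltrDl ltr01/= subr0.
  by [].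
apply/eqP; rewrite eq_le; apply/andP; split.
  apply: le_measure; rewrite ?inE// => x ->/=.
  by rewrite in_itv/= lexx ltrBlDr ltrDl ltr01.
have mC : measurable (~` [set c] : set (measurableTypeR R)).
  exact: measurableC.
apply: (@le_trans _ _ (ls F ([set c] `|` ~` [set c]))).
  by apply: le_measure; rewrite ?inE// ?setUv.
apply: le_trans (measureU2 _ m1 mC) _.
have h : (ls F (~` [set c]) <= 0)%E by rewrite ls_step_null.
by rewrite -[leRHS]adde0; exact: leeD.
Qed.

Lemma ls_step_integral (h : R -> R) : measurable_fun setT h ->
  \int[ls F]_x h x = h c * m.
Proof.
move=> mh.
have m1 : measurable ([set c] : set (measurableTypeR R)).
  exact: (@measurable_set1 R).
have mC : measurable (~` [set c] : set (measurableTypeR R)).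
  exact: measurableC.
have D1 : [set: measurableTypeR R] `\` ~` [set c] = [set c].
  by rewrite setDE setCK setTI.
have mE : measurable_fun [set: measurableTypeR R] (EFin \o h).
  exact/measurable_EFinP.
have ih : (ls F).-integrable setT (EFin \o h).
  have [_ k] := negligible_integrable (mu := ls F) mC measurableT mE ls_step_null.
  apply: k; rewrite D1; apply: measurable_bounded_integrable => //.
  - by rewrite [X in (X < _)%E](_ : _ = m%:E) ?ltry//; exact: ls_step_set1.
  - exact: measurable_funTS.
  - exists `|h c|; split; first by rewrite num_real.
    by move=> M /ltW hM z /= ->.
rewrite /Rintegral (negligible_integral mC measurableT ih ls_step_null) D1.
transitivity (fine ((h c)%:E * ls F [set c])%E); last by rewrite ls_step_set1.
congr fine; rewrite (eq_integral (fun=> (h c)%:E)); last first.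
  by move=> z; rewrite inE => ->.
by rewrite integral_cst.
Qed.

End step.

End lebesgue_stieltjes.

(** * Spectral measures of a bounded symmetric operator *)

Section bounded_spectral.
Context {R : realType} {H : hilbertType R}.
Implicit Types (f g h : H).
Variable A : {linear H -> H}.
Variable E : resolution [set: H].
Hypotheses (sA : symmetric_op A) (bA : bounded_op A).
Hypotheses
  (EA : forall l, commuting (E l) A)
  (E_le : forall l f, E l f = f -> ip (A f) f <= l * ip f f)
  (E_ge : forall l f, E l f = 0 -> l * ip f f <= ip (A f) f)
  (E_out : exists2 c : R, 0 < c &
      forall l f, (l < - c -> E l f = 0) /\ (c < l -> E l f = f)).
Local Notation F f := (spectral_distribution E f).
Local Notation mu f := (spectral_measure E f).
Local Notation leb := (@lebesgue_measure R).

Lemma resolution_idem l f : E l (E l f) = E l f.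
Proof. by rewrite proj_min minxx. Qed.

Lemma resolution_le l m f : l <= m -> E m (E l f) = E l f.
Proof. by move=> lm; rewrite proj_min min_r. Qed.

Lemma resolution_ge l m f : l <= m -> E l (E m f) = E l f.
Proof. by move=> lm; rewrite proj_min min_l. Qed.

Lemma resolution_sym l : symmetric_op (E l).
Proof. by move=> f g; rewrite /rip proj_sym. Qed.

Lemma distributionE l f : F f l = ip (E l f) (E l f).
Proof. by rewrite resolution_sym resolution_idem ripC. Qed.

Lemma distribution_incr l m f : l <= m ->
  F f m - F f l = ip (E m f - E l f) (E m f - E l f).
Proof.
move=> lm; rewrite ripBl !ripBr -!distributionE (ripC _ (E l f) (E m f)).
by rewrite resolution_sym resolution_le// (ripC _ f) -/(F f l); lra.
Qed.

Lemma increment_le m l f : l <= m -> E m (E m f - E l f) = E m f - E l f.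
Proof. by move=> lm; rewrite linearB resolution_idem resolution_le. Qed.

Lemma increment_ge m l f : l <= m -> E l (E m f - E l f) = 0.
Proof. by move=> lm; rewrite linearB resolution_idem resolution_ge// subrr. Qed.

Lemma increment_idem m l f : l <= m ->
  ip (E m f - E l f) f = ip (E m f - E l f) (E m f - E l f).
Proof. by move=> lm; rewrite -distribution_incr// ripBl. Qed.

(** The cross terms collapse because E_l is symmetric and commutes with A. This makes l -> <A E_l f,
    E_l f> the primitive G required by the mean value inequalities of [ls_integral_id_full]. *)
Lemma quadratic_incr l m f : l <= m ->
  ip (A (E m f)) (E m f) - ip (A (E l f)) (E l f) =
  ip (A (E m f - E l f)) (E m f - E l f).
Proof.
move=> lm; rewrite linearB ripBl !ripBr.
have c1 : ip (A (E m f)) (E l f) = ip (A (E l f)) (E l f).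
  by rewrite -[in LHS](resolution_idem l f) -resolution_sym EA resolution_ge.
have c2 : ip (A (E l f)) (E m f) = ip (A (E l f)) (E l f).
  by rewrite ripC -sA c1.
by rewrite c1 c2; lra.
Qed.

Lemma spectral_bounded : exists a b : R, [/\ a <= b,
  forall f l, l <= a -> E l f = 0 & forall f l, b <= l -> E l f = f].
Proof.
have [c c0 Ec] := E_out; exists (- c - 1), (c + 1); split; first by lra.
- by move=> f l lc; apply: (Ec l f).1; lra.
- by move=> f l lc; apply: (Ec l f).2; lra.
Qed.

Lemma spectral_measure_compl (a b : R) f :
  (forall l, l <= a -> E l f = 0) -> (forall l, b <= l -> E l f = f) ->
  (mu f (~` `]a, b]%classic) = 0)%E.
Proof.
move=> Ea Eb; apply: ls_null_compl => l hl; rewrite /= /spectral_distribution.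
  by rewrite !Ea.
by rewrite !Eb.
Qed.

Lemma spectral_measure_le f N : measurable N ->
  (mu f N <= (ip f f)%:E)%E.
Proof.
move=> mN; have [a [b [ab Ea Eb]]] := spectral_bounded.
apply: (@le_trans _ _ (mu f (`]a, b]%classic `|` ~` `]a, b]%classic))).
  by apply: le_measure; rewrite ?inE// ?setUv.
have mI : measurable (`]a, b]%classic : set (measurableTypeR R)).
  exact: measurable_itv.
have mC : measurable (~` `]a, b]%classic : set (measurableTypeR R)).
  exact: measurableC.
apply: le_trans (measureU2 _ mI mC) _.
have h1 : (mu f (~` `]a, b]%classic) <= 0)%E.
  by rewrite (spectral_measure_compl (Ea f) (Eb f)).
have h2 : (mu f `]a, b]%classic <= (ip f f)%:E)%E.
  have -> : mu f `]a, b]%classic = (F f b - F f a)%:E by exact: ls_itv.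
  by rewrite lee_fin !distributionE (Ea f a)// (Eb f b)// rip0l subr0.
by rewrite -[leRHS]adde0; exact: leeD.
Qed.

Lemma spectral_measure_setT f : (mu f setT = (ip f f)%:E)%E.
Proof.
apply/eqP; rewrite eq_le spectral_measure_le//=.
have [a [b [ab Ea Eb]]] := spectral_bounded.
apply: (@le_trans _ _ (mu f `]a, b]%classic)).
  have -> : mu f `]a, b]%classic = (F f b - F f a)%:E by exact: ls_itv.
  by rewrite lee_fin !distributionE (Ea f a)// (Eb f b)// rip0l subr0.
apply: le_measure; rewrite ?inE//; exact: measurable_itv.
Qed.

Lemma spectral_integrals f :
  (\int[mu f]_l l)%R = ip (A f) f /\ (\int[mu f]_l (l ^+ 2)%:E < +oo)%E.
Proof.
have [a [b [ab Ea Eb]]] := spectral_bounded.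
have -> : ip (A f) f = ip (A (E b f)) (E b f) - ip (A (E a f)) (E a f).
  by rewrite (Eb f b)// (Ea f a)// linear0 rip0l subr0.
apply: (ls_integral_id_full (G := fun l => ip (A (E l f)) (E l f)) ab).
  move=> x y _ xy _; rewrite quadratic_incr// /= distribution_incr//.
  by rewrite E_ge ?E_le ?increment_le ?increment_ge.
exact: (spectral_measure_compl (Ea f) (Eb f)).
Qed.

Lemma bounded_spectral_resolution (O : operator H) :
  dom O = setT -> (forall f, O f = A f) -> is_spectral_resolution O E.
Proof.
move=> dO OA; split=> [f|//|f _]; rewrite ?dO.
  by split=> // _; split => //; exact: (spectral_integrals f).2.
by rewrite OA symmetric_inner_real// (spectral_integrals f).1.
Qed.

(** On the range of E_b - E_a, which is stable under A, the operator T = A - a lies between 0 and d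
    = b - a. Positivity at h = g - d^-1 T g, together with <T^2 g, T g> <= d |T g|^2, gives |T g|^2
    <= d <T g, g> <= d^2 |g|^2. *)
Lemma interval_norm (a b : R) g : a <= b -> E b g = g -> E a g = 0 ->
  nrm (A g - a%:C *: g) <= (b - a) * nrm g.
Proof.
rewrite le_eqVlt => /predU1P[<-|ab] Eb Ea.
  by rewrite -Eb Ea linear0 scaler0 subrr rn0 mulr0.
pose T h := A h - a%:C *: h.
have d0 : 0 < b - a by rewrite subr_gt0.
have ETh h : E b h = h -> E a h = 0 -> E b (T h) = T h /\ E a (T h) = 0.
  move=> hb ha; rewrite /T (linearB (E b)) (linearB (E a)).
  rewrite (linearZZ (E b)) (linearZZ (E a)).
  by rewrite !EA hb ha (linear0 A) scaler0 subr0.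
have Tpos h : E b h = h -> E a h = 0 ->
    0 <= ip (T h) h /\ ip (T h) h <= (b - a) * ip h h.
  move=> hb ha; rewrite /T ripBl ripZl.
  by have := E_ge ha; have := E_le hb; split; lra.
have [Tb Ta] := ETh g Eb Ea.
have [p1 p2] := Tpos _ Eb Ea; have [p3 p4] := Tpos _ Tb Ta.
pose h := g - ((b - a)^-1)%:C *: T g.
have [] := Tpos h.
- by rewrite /h linearB linearZZ Eb Tb.
- by rewrite /h linearB linearZZ Ea Ta scaler0 subrr.
have -> : T h = T g - ((b - a)^-1)%:C *: T (T g).
  rewrite {1}/T /h (linearB A) (linearZZ A) scalerBr /T.
  rewrite [in RHS]scalerBr !scalerA (mulrC a%:C).
  by rewrite !opprD !opprK addrACA.
rewrite /h ripBl !ripBr !ripZl !ripZr => q _.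
have sT : ip (T (T g)) g = ip (T g) (T g).
  by rewrite {1}/T /T ripBl ripZl sA [in RHS]ripBr ripZr.
rewrite sT in q.
have d1 : 0 < (b - a)^-1 by rewrite invr_gt0.
have := ler_wpM2l (ltW d1) (ler_wpM2l (ltW d1) p4).
rewrite [(b - a)^-1 * ((b - a) * _)]mulKf ?gt_eqF// => q2.
rewrite -ler_sqr ?nnegrE ?mulr_ge0 ?rn_ge0 ?(ltW d0)// exprMn !sqr_rn.
rewrite -/(T g).
have : (b - a)^-1 * ip (T g) (T g) <= ip (T g) g by lra.
rewrite ler_pdivrMl// => q3; apply: le_trans q3 _.
by rewrite expr2 -mulrA ler_wpM2l// ltW.
Qed.

(* Putnam's argument: for g = (E b - E a) u one has <g, u> = |g|^2, and
   <A g, K g> = <(A - a) g, K g> <= c (b - a) |g|^2. *)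
Lemma commutator_lipschitz (K : {linear H -> H}) (c : R) u : 0 <= c ->
  (forall f, nrm (K f) <= c * nrm f) -> (forall f, ip f (K f) = 0) ->
  (forall f, ip f u ^+ 2 <= ip (A f) (K f)) ->
  forall a b, a <= b -> F u b - F u a <= c * (b - a).
Proof.
move=> c0 cK K0 AK a b ab; rewrite distribution_incr//.
set g := E b u - E a u.
have Eb : E b g = g by exact: increment_le.
have Ea : E a g = 0 by exact: increment_ge.
have gu : ip g u = ip g g by exact: increment_idem.
have [->|g0] := eqVneq g 0.
  by rewrite rip0l mulr_ge0 ?subr_ge0.
have gg : 0 < ip g g by exact: rip_gt0.
have h1 := AK g; rewrite gu in h1.
have h2 : ip (A g) (K g) = ip (A g - a%:C *: g) (K g).
  by rewrite ripBl ripZl K0 mulr0 subr0.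
have h3 := ripl_le (@inner _ H) (A g - a%:C *: g) (K g).
have h4 := interval_norm ab Eb Ea.
have h5 := ler_pM (rn_ge0 _ _) (rn_ge0 _ _) h4 (cK g).
have h6 : (b - a) * nrm g * (c * nrm g) = c * (b - a) * ip g g.
  by rewrite -sqr_rn; ring.
have : ip g g ^+ 2 <= c * (b - a) * ip g g by rewrite h6 -h2 in h5 h3; lra.
by rewrite expr2 ler_pM2r.
Qed.

Lemma spectral_measure_le2 (c1 c2 : R) f g h N : 0 <= c1 -> 0 <= c2 ->
  (forall a b, ip (E b h - E a h) (E b h - E a h) <=
     c1 * ip (E b f - E a f) (E b f - E a f) +
     c2 * ip (E b g - E a g) (E b g - E a g)) ->
  measurable N ->
  (mu h N <= c1%:E * mu f N + c2%:E * mu g N)%E.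
Proof.
move=> c10 c20 le2 mN; apply: ls_le2 => // a b ab /=.
by rewrite !distribution_incr.
Qed.

Lemma ac_spaceP f : ac_space E f <->
  forall N : set R, measurable N -> leb N = 0%E -> mu f N = 0%E.
Proof.
split=> [[_ /null_content_dominatesP]//|h]; split=> //.
exact/null_content_dominatesP.
Qed.

Lemma spectral_measure_null f (N : set R) : (mu f N <= 0)%E -> mu f N = 0%E.
Proof. by move=> h; apply/eqP; rewrite eq_le h; exact: measure_ge0. Qed.

(** Lebesgue measure is the Stieltjes measure of the identity, so the spectral measure is at most c
    times Lebesgue measure. *)
Lemma lipschitz_ac f (c : R) : 0 <= c ->
  (forall a b, a <= b -> F f b - F f a <= c * (b - a)) -> ac_space E f.
Proof.
move=> c0 lip; apply/ac_spaceP => N mN N0; apply: spectral_measure_null.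
have := @ls_le2 R (F f) idfun idfun c 0 N c0 (lexx 0) _ mN.
rewrite mul0e adde0 -/(leb N) N0 mule0; apply=> a b ab.
by rewrite mul0r addr0 lip.
Qed.

Lemma rip_sqrD_le f g : ip (f + g) (f + g) <= 2 * ip f f + 2 * ip g g.
Proof.
have := rip_ge0 (@inner _ H) (f - g).
by rewrite ripBl !ripBr ripDl !ripDr (ripC _ g f); lra.
Qed.

Lemma ac_lin (a : R[i]) f g : ac_space E f -> ac_space E g ->
  ac_space E (a *: f + g).
Proof.
move=> /ac_spaceP acf /ac_spaceP acg; apply/ac_spaceP => N mN N0.
apply: spectral_measure_null.
have a0 : 0 <= 2 * (complex.Re a ^+ 2 + complex.Im a ^+ 2).
  by rewrite mulr_ge0// addr_ge0// sqr_ge0.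
have := @spectral_measure_le2 _ 2 f g (a *: f + g) N a0 (ler0n _ _) _ mN.
rewrite acf// acg// !mule0 adde0; apply => x y.
rewrite (linearP (E y)) (linearP (E x)) opprD addrACA -scalerBr.
apply: le_trans (rip_sqrD_le _ _) _.
by rewrite ripZZ lerD2r mulrA.
Qed.

Lemma ac_0 : ac_space E 0.
Proof.
apply/ac_spaceP => N mN _; apply: spectral_measure_null.
by apply: le_trans (spectral_measure_le _ mN) _; rewrite rip0l.
Qed.

Lemma ac_op f : ac_space E f -> ac_space E (A f).
Proof.
move=> /ac_spaceP acf; apply/ac_spaceP => N mN N0; apply: spectral_measure_null.
have [c c0 cA] := bA.
have c20 : 0 <= c ^+ 2 by rewrite exprn_ge0// ltW.
have := @spectral_measure_le2 _ 0 f f (A f) N c20 (lexx 0) _ mN.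
rewrite acf// !mule0 adde0; apply => x y; rewrite mul0r addr0.
rewrite !EA -linearB -!sqr_rn -exprMn ler_sqr ?nnegrE ?rn_ge0//.
by rewrite mulr_ge0 ?rn_ge0// ltW.
Qed.

(** For an approximant g, the measures satisfy mu_f(N) <= 2 mu_g(N) + 2 |f - g|^2, and the first
    term vanishes on null sets. *)
Lemma ac_closed f :
  (forall e : R, 0 < e -> exists2 g, ac_space E g & nrm (f - g) < e) ->
  ac_space E f.
Proof.
move=> fg; apply/ac_spaceP => N mN N0; apply: spectral_measure_null.
apply/lee_addgt0Pr => e e0; rewrite add0e.
have s0 : 0 < Num.sqrt (e / 2) by rewrite sqrtr_gt0 divr_gt0.
have [g /ac_spaceP acg fge] := fg _ s0.
have := @spectral_measure_le2 2 2 g (f - g) f N (ler0n _ _) (ler0n _ _) _ mN.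
rewrite acg// mule0 add0e => /(_ _)/le_trans; apply.
  move=> x y; rewrite [in leLHS](_ : E y f - E x f =
    (E y g - E x g) + (E y (f - g) - E x (f - g))); first exact: rip_sqrD_le.
  have D l : E l f = E l g + E l (f - g) by rewrite -linearD addrC subrK.
  by rewrite (D y) (D x) opprD addrACA.
apply: (@le_trans _ _ (2%:E * (ip (f - g) (f - g))%:E)%E).
  by apply: lee_wpmul2l => //; exact: spectral_measure_le.
rewrite -EFinM lee_fin -sqr_rn.
have : nrm (f - g) ^+ 2 <= Num.sqrt (e / 2) ^+ 2.
  by rewrite ler_sqr ?nnegrE ?rn_ge0 ?(ltW s0)// ltW.
by rewrite sqr_sqrtr ?divr_ge0 ?(ltW e0)//; lra.
Qed.

(** * An eigenspace with absolutely continuous complement *)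

Section eigenspace.
Variables (P : {linear H -> H}) (c : R).
Hypotheses (sP : symmetric_op P) (P_idem : forall f, P (P f) = P f)
  (AP : forall f, A (P f) = c%:C *: P f).

(** On w = E_m v the quadratic form is c |w|^2, against the bound m |w|^2 on the range of E_m, so w
    = 0 for m < c; symmetrically v - E_m v = 0 for m > c. Right-continuity settles m = c. *)
Lemma resolution_eigen l f : E l (P f) = if c <= l then P f else 0.
Proof.
set v := P f.
have AEv m : ip (A (E m v)) (E m v) = c * ip (E m v) (E m v).
  by rewrite -EA AP linearZZ ripZl.
have Ev_lt m : m < c -> E m v = 0.
  move=> mc; apply: (@rip_eq0 _ _ (@inner _ H)); apply/eqP.
  rewrite eq_le rip_ge0 andbT.
  have := E_le (resolution_idem m v); rewrite AEv -subr_le0 -mulrBl.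
  by rewrite pmulr_rle0// subr_gt0.
have Ev_gt m : c < m -> E m v = v.
  move=> cm; apply/esym/eqP; rewrite -subr_eq0; apply/eqP.
  set w := v - E m v.
  have Ew : E m w = 0 by rewrite /w linearB resolution_idem subrr.
  have Aw : A w = c%:C *: w by rewrite /w linearB -EA AP linearZZ scalerBr.
  apply: (@rip_eq0 _ _ (@inner _ H)); apply/eqP; rewrite eq_le rip_ge0 andbT.
  have := E_ge Ew; rewrite Aw ripZl -subr_le0 -mulrBl.
  by rewrite pmulr_rle0// subr_gt0.
case: ltgtP => [cl|lc|<-]; [exact: Ev_gt|exact: Ev_lt|].
have h1 := @proj_rcont _ _ _ E c v.
have h2 : E m v @[m --> c^'+] --> v.
  apply: cvg_near_cst; near=> m; apply: Ev_gt.
  by near: m; exact: nbhs_right_gt.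
exact: (@norm_cvg_unique _ H _ _ _ _ h1 h2).
Unshelve. all: by end_near. Qed.

Hypothesis acP : forall f, ac_space E (f - P f).

(** Let f be carried by a null set N and g = f - P f. Then mu_g(N) = 0 by absolute continuity, while
    mu_g <= mu_f because the increments of P f and of g are orthogonal; so mu_g has total mass 0,
    and this mass is |g|^2. Conversely the measure of an eigenvector is a point mass at c. *)
Lemma singular_spaceP f : singular_space E f <-> P f = f.
Proof.
split=> [[_ [N [mN N0 fN]]]|Pf].
  set g := f - P f; have /ac_spaceP acg := acP f; rewrite -/g in acg.
  have gN : mu g N = 0%E by exact: acg.
  have fg : (mu g (~` N) <= mu f (~` N))%E.
    have := @spectral_measure_le2 1 0 f f g (~` N) ler01 (lexx 0) _ (measurableC mN).
    rewrite mul1e mul0e adde0; apply=> x y; rewrite mul1r mul0r addr0.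
    pose Q h := E y h - E x h.
    have Q0 : ip (Q (P f)) (Q g) = 0.
      have vE l : ip (P f) (E l g) = 0.
        have vg : ip (P f) g = 0 by rewrite /g ripBr -sP P_idem subrr.
        rewrite -resolution_sym resolution_eigen; case: ifP => // _.
        by rewrite rip0l.
      have QE : Q (P f) = ((c <= y)%R%:R - (c <= x)%R%:R)%:C *: P f.
        rewrite /Q !resolution_eigen; do 2![case: ifP => _] => /=.
        - by rewrite !subrr scale0r.
        - by rewrite !subr0 scale1r.
        - by rewrite !sub0r rmorphN/= scaleNr scale1r.
        - by rewrite !subrr scale0r.
      by rewrite QE ripZl /Q ripBr !vE subrr mulr0.
    have -> : E y f - E x f = Q (P f) + Q g.
      have D l : E l f = E l (P f) + E l g by rewrite -linearD addrC subrK.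
      by rewrite /Q (D y) (D x) opprD addrACA.
    rewrite -/(Q g); move: (Q (P f)) (Q g) Q0 => a b ab0.
    rewrite ripDl !ripDr (ripC _ b a) ab0.
    by have := rip_ge0 (@inner _ H) a; lra.
  have gT : (mu g setT <= 0)%E.
    apply: (@le_trans _ _ (mu g (N `|` ~` N))); first by rewrite setUv.
    apply: le_trans (measureU2 _ mN (measurableC mN)) _.
    have h1 : (mu g N <= 0)%E by rewrite gN.
    have h2 : (mu g (~` N) <= 0)%E by apply: le_trans fg _; rewrite fN.
    by rewrite -[leRHS]adde0; exact: leeD.
  apply/esym/eqP; rewrite -subr_eq0; apply/eqP/(@rip_eq0 _ _ (@inner _ H)).
  by apply/eqP; rewrite eq_le rip_ge0 andbT -lee_fin -spectral_measure_setT.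
split=> //; exists [set c]; split.
- exact: measurable_set1.
- exact: lebesgue_measure_set1.
- apply: (@ls_step_null _ _ c (ip f f)) => l /=.
  rewrite distributionE -Pf resolution_eigen.
  by case: ifP => // _; rewrite rip0l.
Qed.

End eigenspace.

End bounded_spectral.

(** * The resolution of a scalar operator on a subspace *)

Section eigen_resolution.
Context {R : realType} {H : hilbertType R}.
Implicit Types (f g h : H).
Variables (P : {linear H -> H}) (c : R) (K : set H).
Hypotheses (sP : symmetric_op P) (KP : forall f, K f <-> P f = f)
  (P_idem : forall f, P (P f) = P f).

(** A single jump at c, from 0 to P. It will resolve the restriction of H_r to its singular
    subspace. *)
Definition eigen_proj (l : R) : {linear H -> H} := if c <= l then P else \0.

Lemma eigen_projE l f : eigen_proj l f = if c <= l then P f else 0.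
Proof. by rewrite /eigen_proj; case: ifP. Qed.

Lemma eigen_proj_sym l f g : inner (eigen_proj l f) g = inner f (eigen_proj l g).
Proof.
apply: symmetric_inner => {}f {}g; rewrite !eigen_projE.
by case: ifP => _; rewrite ?sP// rip0l rip0r.
Qed.

Lemma eigen_proj_sub l f : K (eigen_proj l f).
Proof.
by apply/KP; rewrite eigen_projE; case: ifP; rewrite ?linear0.
Qed.

Lemma eigen_proj_min l m f :
  eigen_proj l (eigen_proj m f) = eigen_proj (Order.min l m) f.
Proof.
rewrite !eigen_projE le_min; case: (c <= l); case: (c <= m) => //=.
by rewrite linear0.
Qed.

Lemma eigen_proj_rcont l f : eigen_proj m f @[m --> l^'+] --> eigen_proj l f.
Proof.
have [cl|lc] := leP c l; apply: cvg_near_cst; near=> m; rewrite !eigen_projE.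
  rewrite cl ifT//; apply: le_trans cl _; apply: ltW.
  by near: m; exact: nbhs_right_gt.
rewrite !ifF//; first by apply/negbTE; rewrite -ltNge.
apply/negbTE; rewrite -ltNge; near: m; exact: nbhs_right_lt.
Unshelve. all: by end_near. Qed.

Lemma eigen_proj_ninfty f : eigen_proj l f @[l --> -oo] --> (0 : H).
Proof.
apply: cvg_near_cst; near=> l; rewrite eigen_projE leNgt (_ : l < c)//.
by near: l; exact: (nbhs_ninfty_lt (num_real _)).
Unshelve. all: by end_near. Qed.

Lemma eigen_proj_pinfty f : K f -> eigen_proj l f @[l --> +oo] --> f.
Proof.
move=> /KP Pf; apply: cvg_near_cst; near=> l.
have cl : c < l by near: l; exact: (nbhs_pinfty_gt (num_real _)).
by rewrite eigen_projE (ltW cl).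
Unshelve. all: by end_near. Qed.

Definition eigen_resolution : resolution K :=
  @Resolution R H K eigen_proj eigen_proj_sym eigen_proj_sub eigen_proj_min
    (@eigen_proj_rcont) (@eigen_proj_ninfty) (@eigen_proj_pinfty).

Lemma eigen_distribution f l :
  spectral_distribution eigen_resolution f l = if c <= l then ip (P f) f else 0.
Proof.
rewrite /spectral_distribution /= eigen_projE; case: ifP => // _.
exact: rip0l.
Qed.

Lemma eigen_integral f (h : R -> R) : measurable_fun setT h ->
  (\int[spectral_measure eigen_resolution f]_l h l)%R = h c * ip (P f) f.
Proof. by apply: ls_step_integral => l; exact: eigen_distribution. Qed.

Lemma eigen_spectral_resolution (O : operator H) :
  dom O = K -> (forall f, K f -> O f = c%:C *: f) ->
  is_spectral_resolution O eigen_resolution.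
Proof.
move=> dO OE; split; rewrite dO.
- move=> f; split=> [Kf|[]//]; split=> //.
  pose F : cumulative R R := spectral_distribution eigen_resolution f.
  have F0 : lebesgue_stieltjes_measure F (~` `]c - 1, c]%classic) = 0%E.
    apply: ls_null_compl => l hl; rewrite /F/= !eigen_distribution.
      have c1 : c - 1 < c by rewrite ltrBlDr ltrDl.
      by rewrite !leNgt c1 (le_lt_trans hl c1).
    by rewrite hl lexx.
  (* For a point mass at c the primitive of z dF is c F. Only the finiteness of the second moment is
     extracted here. *)
  apply: (ls_integral_id_full (F := F) (G := fun l => c * F l) _ _ F0).2.
    by rewrite gerBl.
  move=> x y _ xy yc; rewrite /F/= !eigen_distribution.
  have := rip_ge0 (@inner _ H) (P f); rewrite sP P_idem ripC => Pf0.
  case: (leP c x) => h1; case: (leP c y) => h2; apply/andP; split; nra.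
- by move=> f Kf; rewrite OE//; apply/KP; rewrite linearZZ; congr (_ *: _); apply/KP.
- move=> f Kf; rewrite OE// (eigen_integral f (h := id))//.
  rewrite sesquilinear.linearZl_LR/= form_selfE.
  by move/KP : Kf => ->; rewrite rmorphM.
Qed.

Lemma eigen_functional_calculus (phi : R -> R[i]) (T : {linear H -> H}) :
  measurable_fun setT (@complex.Re R \o phi) ->
  measurable_fun setT (@complex.Im R \o phi) ->
  (forall f, T f = phi c *: P f) ->
  forall f, inner (T f) f = cintegral (spectral_measure eigen_resolution f) setT phi.
Proof.
move=> mR mI TE f.
rewrite /cintegral (eigen_integral f mR) (eigen_integral f mI) TE.
rewrite sesquilinear.linearZl_LR/= symmetric_inner_real//.
by case: (phi c) => x y /=; simpc.
Qed.

End eigen_resolution.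

(** * Square summable sequences *)

Section square_modulus.
Context {R : realType}.
Implicit Types (z w : R[i]).

Definition sqm z : R := complex.Re z ^+ 2 + complex.Im z ^+ 2.

Lemma sqm_ge0 z : 0 <= sqm z.
Proof. by rewrite addr_ge0// sqr_ge0. Qed.

Lemma sqm0 : sqm 0 = 0.
Proof. by rewrite /sqm/= expr0n addr0. Qed.

Lemma sqm_gt0 z : z != 0 -> 0 < sqm z.
Proof.
move=> z0; rewrite lt_neqAle sqm_ge0 andbT eq_sym.
rewrite paddr_eq0 ?sqr_ge0// !sqrf_eq0.
by move: z0; case: z => x y; rewrite eq_complex/=.
Qed.

(** The difference of the two sides is |a z - w|^2. *)
Lemma sqmD a z w : sqm (a * z + w) <= (2 * sqm a) * sqm z + 2 * sqm w.
Proof.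
case: a z w => a b [x y] [u v]; rewrite /sqm /=.
rewrite -subr_ge0 [leRHS](_ : _ =
  (a * x - b * y - u) ^+ 2 + (a * y + b * x - v) ^+ 2); last by ring.
by rewrite addr_ge0// sqr_ge0.
Qed.

Lemma mul_conj_self z : z * (z^*)%C = (sqm z)%:C.
Proof. by case: z => x y; rewrite /sqm /=; simpc; congr (_ +i* _); ring. Qed.

Lemma Re_mul_conj_le z w : `|complex.Re (z * (w^*)%C)| <= sqm z + sqm w.
Proof.
case: z w => x y [u v]; rewrite /sqm /= ler_norml.
have := sqr_ge0 (x - u); have := sqr_ge0 (y - v).
have := sqr_ge0 (x + u); have := sqr_ge0 (y + v).
by have := sqr_ge0 (x); have := sqr_ge0 (y); have := sqr_ge0 u;
  have := sqr_ge0 v; move=> *; apply/andP; split; lra.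
Qed.

Lemma Im_mul_conj_le z w : `|complex.Im (z * (w^*)%C)| <= sqm z + sqm w.
Proof.
case: z w => x y [u v]; rewrite /sqm /= ler_norml.
have := sqr_ge0 (x - v); have := sqr_ge0 (y - u).
have := sqr_ge0 (x + v); have := sqr_ge0 (y + u).
by have := sqr_ge0 (x); have := sqr_ge0 (y); have := sqr_ge0 u;
  have := sqr_ge0 v; move=> *; apply/andP; split; lra.
Qed.

End square_modulus.

Section complex_series.
Context {R : realType}.
Implicit Types (a b : nat -> R) (c d : nat -> R[i]).

Lemma dominated_series_cvg a b : (forall n, `|a n| <= b n) ->
  cvgn (series b) -> cvgn (series a).
Proof.
move=> ab cb; apply: normed_cvg; apply: series_le_cvg cb => n //=.
exact: le_trans (ab n).
Qed.

Definition csummable c :=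
  cvgn (series (@complex.Re R \o c)) /\ cvgn (series (@complex.Im R \o c)).

Definition csum c : R[i] :=
  limn (series (@complex.Re R \o c)) +i* limn (series (@complex.Im R \o c)).

Lemma csum_linear (z : R[i]) c d : csummable c -> csummable d ->
  csum (fun n => z * c n + d n) = z * csum c + csum d.
Proof.
move=> [c1 c2] [d1 d2]; case: z => x y; rewrite /csum /=.
have -> : @complex.Re R \o (fun n => (x +i* y) * c n + d n) =
    x *: (@complex.Re R \o c : R^o^nat) - y *: (@complex.Im R \o c : R^o^nat) + (@complex.Re R \o d).
  by apply/funext => n /=; rewrite /GRing.scale/= !fctE/=; case: (c n) (d n) => [u v] [u' v'].
have -> : @complex.Im R \o (fun n => (x +i* y) * c n + d n) =
    x *: (@complex.Im R \o c : R^o^nat) + y *: (@complex.Re R \o c : R^o^nat) + (@complex.Im R \o d).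
  by apply/funext => n /=; rewrite /GRing.scale/= !fctE/=; case: (c n) (d n) => [u v] [u' v'].
have hx1 : cvgn (series (x *: (@complex.Re R \o c : R^o^nat))) by exact: is_cvg_seriesZ.
have hy1 : cvgn (series (y *: (@complex.Re R \o c : R^o^nat))) by exact: is_cvg_seriesZ.
have hx2 : cvgn (series (x *: (@complex.Im R \o c : R^o^nat))) by exact: is_cvg_seriesZ.
have hy2 : cvgn (series (y *: (@complex.Im R \o c : R^o^nat))) by exact: is_cvg_seriesZ.
congr (_ +i* _).
  rewrite lim_seriesD//; last exact: is_cvg_seriesB.
  by rewrite lim_seriesB// !lim_seriesZ.
rewrite lim_seriesD//; last exact: is_cvg_seriesD.
by rewrite lim_seriesD// !lim_seriesZ.
Qed.

Lemma csum_conj c : csummable c -> csum (fun n => (c n)^*%C) = (csum c)^*%C.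
Proof.
move=> [c1 c2]; rewrite /csum/=; congr (_ +i* _).
  by congr (limn (series _)); apply/funext => n /=; case: (c n).
rewrite -lim_seriesN//; congr (limn (series _)).
apply/funext => n; rewrite [RHS](_ : _ = - complex.Im (c n))//=.
by case: (c n).
Qed.

Lemma csum_real a : csum (fun n => (a n)%:C) = (limn (series a))%:C.
Proof.
rewrite /csum /=; congr (_ +i* _).
rewrite (_ : series _ = fun=> 0) ?lim_cst//.
by apply/funext => n; rewrite /series/= big1.
Qed.

End complex_series.

(** Boolean-valued, so that the corresponding subtype inherits the vector space structure of [nat ->
    R[i]]. *)
Definition square_summable {R : realType} : pred (nat -> R[i]) :=
  fun u => `[< cvgn (series (sqm \o u)) >].

Section l2.
Context {R : realType}.

Lemma square_summable_submod : submod_closed (@square_summable R).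
Proof.
split=> [|a u v /asboolP cu /asboolP cv]; apply/asboolP.
  rewrite (_ : series _ = fun=> 0); first exact: is_cvg_cst.
  by apply/funext => n; rewrite /series/= big1// => i _; rewrite /= sqm0.
apply: (@series_le_cvg _ _ ((2 * sqm a) *: (sqm \o u : R^o^nat) + 2 *: (sqm \o v : R^o^nat))).
- by move=> n /=; exact: sqm_ge0.
- move=> n; rewrite fctE/= /GRing.scale/= addr_ge0// ?mulr_ge0 ?sqm_ge0//.
- by move=> n /=; exact: sqmD.
by apply: is_cvg_seriesD; apply: is_cvg_seriesZ.
Qed.

HB.instance Definition _ :=
  GRing.isSubmodClosed.Build R[i] (nat -> R[i]) (@square_summable R)
    square_summable_submod.

End l2.

Record l2 (R : realType) := L2 {
  l2_seq :> nat -> R[i] ;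
  l2_summable : l2_seq \in @square_summable R }.

HB.instance Definition _ (R : realType) := [isSub for @l2_seq R].
HB.instance Definition _ (R : realType) := [Choice of l2 R by <:].
HB.instance Definition _ (R : realType) :=
  [SubChoice_isSubLmodule of l2 R by <:].

(** * The inner product of l^2 *)

Section l2_inner_product.
Context {R : realType}.
Implicit Types u v w : l2 R.

Lemma l2D u v n : (u + v) n = u n + v n. Proof. by []. Qed.

Lemma l2Z (a : R[i]) u n : (a *: u) n = a * u n. Proof. by []. Qed.

Lemma l2N u n : (- u) n = - u n. Proof. by []. Qed.

Lemma l2_ext u v : (forall n, u n = v n) -> u = v.
Proof. by move=> uv; apply/val_inj/funext. Qed.

Lemma l2_cvg u : cvgn (series (sqm \o u)).
Proof. by case: u => u uP; exact/asboolP. Qed.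

Lemma l2_csummable u v : csummable (fun n => u n * (v n)^*%C).
Proof.
have cuv : cvgn (series ((sqm \o u : R^o^nat) + (sqm \o v : R^o^nat))).
  by apply: is_cvg_seriesD; exact: l2_cvg.
split; apply: dominated_series_cvg cuv => n /=.
  exact: Re_mul_conj_le.
exact: Im_mul_conj_le.
Qed.

Definition l2_dot u v : R[i] := csum (fun n => u n * (v n)^*%C).

Lemma l2_dot_linear w : linear_for *%R (l2_dot ^~ w).
Proof.
move=> a u v; rewrite /l2_dot -csum_linear; try exact: l2_csummable.
by congr csum; apply/funext => n; rewrite l2D l2Z mulrDl mulrA.
Qed.

Lemma l2_dot_conj u v : l2_dot u v = (l2_dot v u)^*%C.
Proof.
rewrite /l2_dot -csum_conj; last exact: l2_csummable.
by congr csum; apply/funext => n; rewrite rmorphM/= conjcK mulrC.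
Qed.

Lemma l2_dot_bilinear :
  bilinear_for *%R (@Num.conj R[i] \; *%R) l2_dot.
Proof.
split=> w; first exact: l2_dot_linear.
move=> a u v /=; rewrite l2_dot_conj l2_dot_linear rmorphD rmorphM/=.
by rewrite (l2_dot_conj w u) (l2_dot_conj w v).
Qed.

HB.instance Definition _ :=
  bilinear_isBilinear.Build R[i] (l2 R) (l2 R) R[i] _ _ l2_dot l2_dot_bilinear.

Lemma l2_dot_hermitian u v : l2_dot u v = (-1) ^+ false * Num.conj (l2_dot v u).
Proof. by rewrite expr0 mul1r; exact: l2_dot_conj. Qed.

HB.instance Definition _ :=
  isHermitianSesquilinear.Build R[i] (l2 R) false (@Num.conj R[i]) l2_dot
    l2_dot_hermitian.

Lemma l2_dot_selfE u : l2_dot u u = (limn (series (sqm \o u)))%:C.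
Proof.
by rewrite -csum_real; congr csum; apply/funext => n; rewrite mul_conj_self.
Qed.

Lemma l2_partial_le u n : series (sqm \o u) n <= limn (series (sqm \o u)).
Proof.
apply: nondecreasing_cvgn_le; last exact: l2_cvg.
by apply: nondecreasing_series => k _ _ /=; exact: sqm_ge0.
Qed.

Lemma l2_dot_gt0 u : u != 0 -> 0 < l2_dot u u.
Proof.
move=> u0; rewrite l2_dot_selfE ltcR.
have [n un] : exists n, u n != 0.
  apply: contrapT => /forallNP un; move/eqP: u0; apply.
  by apply: l2_ext => n; have /negP := un n; rewrite negbK => /eqP.
apply: lt_le_trans (l2_partial_le u n.+1); rewrite seriesSr.
by rewrite ltr_wpDl ?sqm_gt0// /series/= sumr_ge0// => i _; exact: sqm_ge0.
Qed.

HB.instance Definition _ :=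
  isDotProduct.Build R[i] (l2 R) l2_dot l2_dot_gt0.

Definition l2_norm u : R[i] := (rn l2_dot u)%:C.

Lemma l2_normD u v : l2_norm (u + v) <= l2_norm u + l2_norm v.
Proof. by rewrite -rmorphD lecR; exact: ler_rnD. Qed.

Lemma l2_normZ (a : R[i]) u : l2_norm (a *: u) = `|a| * l2_norm u.
Proof.
by rewrite /l2_norm rnZ -[in RHS](RRe_real (normr_real a)) rmorphM.
Qed.

Lemma l2_norm_eq0 u : l2_norm u = 0 -> u = 0.
Proof. by move=> [] /rn_eq0. Qed.

End l2_inner_product.

HB.instance Definition _ (R : realType) :=
  Lmodule_isNormed.Build R[i] (l2 R) (@l2_normD R) (@l2_normZ R) (@l2_norm_eq0 R).

(** * Completeness of l^2 *)

Section l2_complete.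
Context {R : realType}.
Implicit Types u v w : l2 R.
Local Notation nr := (rn (@l2_dot R)).

Lemma l2_rnE u : nr u ^+ 2 = limn (series (sqm \o u)).
Proof. by rewrite sqr_rn; exact: (congr1 (@complex.Re R) (l2_dot_selfE u)). Qed.

Lemma l2_rn_le u (e : R) : 0 <= e ->
  (forall n, series (sqm \o u) n <= e ^+ 2) -> nr u <= e.
Proof.
move=> e0 ue; rewrite -ler_sqr ?nnegrE ?rn_ge0// l2_rnE.
by apply: limr_le; [exact: l2_cvg|near=> n].
Unshelve. all: by end_near. Qed.

Lemma l2_partial_rn u n : series (sqm \o u) n <= nr u ^+ 2.
Proof. by rewrite l2_rnE l2_partial_le. Qed.

Lemma sqm_le_rn u n : sqm (u n) <= nr u ^+ 2.
Proof.
apply: le_trans (l2_partial_rn u n.+1); rewrite seriesSr lerDr.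
by rewrite /series/= sumr_ge0// => i _; exact: sqm_ge0.
Qed.

Lemma Re_le_rn u n : `|complex.Re (u n)| <= nr u.
Proof.
rewrite -ler_sqr ?nnegrE ?rn_ge0// real_normK ?num_real//.
by apply: le_trans (sqm_le_rn u n); rewrite lerDl sqr_ge0.
Qed.

Lemma Im_le_rn u n : `|complex.Im (u n)| <= nr u.
Proof.
rewrite -ler_sqr ?nnegrE ?rn_ge0// real_normK ?num_real//.
by apply: le_trans (sqm_le_rn u n); rewrite lerDr sqr_ge0.
Qed.

(** Coordinates are contractive, so they converge along F to some sequence x. Finite partial sums of
    |f - x|^2 inherit the Cauchy bound; this gives both the square summability of x, obtained as
    [f0] minus a square summable sequence, and the convergence in norm. *)
Lemma l2_complete (F : set_system (l2 R)) :
  ProperFilter F -> cauchy F -> cvg F.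
Proof.
move=> FF /cauchyP cF.
have ex (e : R) : 0 < e -> exists f, \forall g \near F, nr (f - g) < e.
  move=> e0; have e0' : 0 < e%:C by rewrite ltcR.
  have [f fe] := cF _ e0'; exists f; apply: filterS fe => g.
  by rewrite -ball_normE/= ltcR.
have cvRe n : exists x, complex.Re (g n) @[g --> F] --> (x : R).
  apply/cvg_ex; apply: cauchy_cvg; apply: cauchy_exP => e e0.
  have [f fe] := ex _ e0; exists (complex.Re (f n)); apply: filterS fe => g.
  rewrite /= -ball_normE/=; apply: le_lt_trans.
  by rewrite -raddfB; exact: (Re_le_rn (f - g)).
have cvIm n : exists x, complex.Im (g n) @[g --> F] --> (x : R).
  apply/cvg_ex; apply: cauchy_cvg; apply: cauchy_exP => e e0.
  have [f fe] := ex _ e0; exists (complex.Im (f n)); apply: filterS fe => g.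
  rewrite /= -ball_normE/=; apply: le_lt_trans.
  by rewrite -raddfB; exact: (Im_le_rn (f - g)).
have [xr xrP] := choice cvRe; have [xi xiP] := choice cvIm.
pose x n := xr n +i* xi n.
have bound f e : 0 < e -> (\forall g \near F, nr (f - g) < e) ->
    forall n, series (fun k => sqm (f k - x k)) n <= e ^+ 2.
  move=> e0 fe n.
  have ht k : sqm ((f - g) k) @[g --> F] --> sqm (f k - x k).
    rewrite (_ : (fun g : l2 R => _) = fun g : l2 R =>
      (complex.Re (f k) - complex.Re (g k)) * (complex.Re (f k) - complex.Re (g k)) +
      (complex.Im (f k) - complex.Im (g k)) * (complex.Im (f k) - complex.Im (g k))).
      rewrite /sqm raddfB [complex.Im (_ - _)]raddfB !expr2.
      by apply: cvgD; apply: cvgM; apply: cvgB;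
        [exact: cvg_cst|exact: xrP|exact: cvg_cst|exact: xrP
        |exact: cvg_cst|exact: xiP|exact: cvg_cst|exact: xiP].
    apply/funext => g; rewrite l2D l2N /sqm.
    by case: (f k) (g k) => [a b] [c d] /=; rewrite !expr2.
  have h : series (sqm \o (f - g)) n @[g --> F] --> series (fun k => sqm (f k - x k)) n.
    elim: n => [|n IHn].
      rewrite [X in _ --> X]/series/= big_geq//.
      rewrite (_ : (fun g : l2 R => _) = fun=> 0); first exact: cvg_cst.
      by apply/funext => g; rewrite /series/= big_geq.
    rewrite [X in _ --> X]seriesSr.
    rewrite (_ : (fun g : l2 R => _) =
      fun g => series (sqm \o (f - g)) n + sqm ((f - g) n)).
      by apply: cvgD.
    by apply/funext => g; rewrite seriesSr.
  rewrite -(cvg_lim _ h)//; apply: limr_le; first by apply/cvg_ex; eexists; exact: h.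
  apply: filterS fe => g fge; apply: le_trans (l2_partial_rn (f - g) n) _.
  by rewrite ler_sqr ?nnegrE ?rn_ge0 ?(ltW e0)// ltW.
have [f0 f0P] := ex 1 ltr01.
have dP : (fun k => f0 k - x k) \in @square_summable R.
  apply/asboolP; apply: nondecreasing_is_cvgn.
    by apply: nondecreasing_series => k _ _ /=; exact: sqm_ge0.
  by exists (1 ^+ 2) => _ [n _ <-]; exact: bound.
pose X : l2 R := f0 - L2 dP.
have XE k : X k = x k.
  by rewrite /X l2D l2N /= opprB addrC subrK.
apply/cvg_ex; exists X; apply/cvgrPdist_lt => -[e e'] e0.
have : 0 < e by move: e0; rewrite ltcE => /andP[].
move: e0; rewrite ltcE/= => /andP[/eqP -> _] e0.
have e20 : 0 < e / 2 by rewrite divr_gt0.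
have [f fe] := ex _ e20.
have fX : nr (f - X) <= e / 2.
  apply: l2_rn_le; first exact: ltW.
  move=> n; apply: le_trans (bound f _ e20 fe n).
  by rewrite le_eqVlt; apply/orP; left; apply/eqP/eq_bigr => k _; rewrite -XE.
apply: filterS fe => g fge; rewrite ltcR.
have -> : X - g = (f - g) - (f - X) by rewrite opprB [RHS]addrC subrKA.
by apply: le_lt_trans (ler_rnB _ _ _) _; lra.
Qed.

End l2_complete.

HB.instance Definition _ (R : realType) :=
  Uniform_isComplete.Build (l2 R) (@l2_complete R).

Definition l2_inner (R : realType) : {dot (l2 R) for @Num.conj R[i]} := @l2_dot R.

Lemma l2_sqr_norm (R : realType) (u : l2 R) : `|u| ^+ 2 = l2_inner R u u.
Proof. by rewrite (form_selfE (l2_inner R)) -sqr_rn rmorphXn. Qed.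

HB.instance Definition _ (R : realType) :=
  NormedModule_isHilbert.Build R (l2 R) (@l2_sqr_norm R).

(** * Coordinates, dense subspaces and separability of l^2 *)

Section l2_structure.
Context {R : realType}.
Implicit Types (u v w : l2 R) (a b : R[i]).

Lemma csum_recl (c : nat -> R[i]) : csummable c ->
  csum c = c 0%N + csum (fun n => c n.+1).
Proof.
have recl (d : nat -> R) : cvgn (series d) ->
    limn (series d) = d 0%N + limn (series (fun n => d n.+1)).
  move=> cd.
  have dS n : series d n.+1 = d 0%N + series (fun n => d n.+1) n.
    by rewrite /series/= big_nat_recl.
  have h : (fun n => series d n.+1) @ \oo --> limn (series d).
    by rewrite (cvg_shiftS (series d)).
  suff -> : limn (series (fun n => d n.+1)) = limn (series d) - d 0%N.
    by rewrite addrC subrK.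
  apply: cvg_lim => //.
  have -> : series (fun n => d n.+1) = (fun n => series d n.+1 - d 0%N).
    by apply/funext => n; rewrite dS addrC addKr.
  by apply: cvgB => //; exact: cvg_cst.
move=> [c1 c2]; rewrite /csum recl// [X in _ +i* X]recl//.
by rewrite /=; case: (c 0%N).
Qed.

Lemma l2_cons_subproof a u :
  (fun n => if n is m.+1 then u m else a) \in @square_summable R.
Proof.
apply/asboolP; apply: nondecreasing_is_cvgn.
  by apply: nondecreasing_series => k _ _ /=; exact: sqm_ge0.
exists (sqm a + rn (@l2_dot R) u ^+ 2) => _ [[|n] _ <-].
  by rewrite /series/= big_geq// addr_ge0 ?sqm_ge0 ?sqr_ge0.
rewrite /series/= big_nat_recl//= lerD2l.
exact: (l2_partial_rn u n).
Qed.

Definition l2_cons a u : l2 R := L2 (l2_cons_subproof a u).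

Lemma l2_tail_subproof u : (fun n => u n.+1) \in @square_summable R.
Proof.
apply/asboolP; apply: nondecreasing_is_cvgn.
  by apply: nondecreasing_series => k _ _ /=; exact: sqm_ge0.
exists (rn (@l2_dot R) u ^+ 2) => _ [n _ <-].
apply: le_trans (l2_partial_rn u n.+1).
by rewrite /series/= big_nat_recl//= lerDr sqm_ge0.
Qed.

Definition l2_tail u : l2 R := L2 (l2_tail_subproof u).

Lemma l2_tailE u n : l2_tail u n = u n.+1. Proof. by []. Qed.

Lemma l2_consK a u : l2_tail (l2_cons a u) = u.
Proof. exact: l2_ext. Qed.

Lemma l2_tail_linear : linear l2_tail.
Proof. by move=> a u v; exact: l2_ext. Qed.

HB.instance Definition _ :=
  GRing.isLinear.Build R[i] (l2 R) (l2 R) *:%R l2_tail l2_tail_linear.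

(** Beyond their first coordinates the operators of the model are combinations of shifts or zero, so
    peeling off finitely many coordinates turns identities about them into polynomial ones. *)
Lemma inner_tail u v :
  inner u v = u 0%N * (v 0%N)^*%C + inner (l2_tail u) (l2_tail v).
Proof. exact: (csum_recl (l2_csummable u v)). Qed.

(** The real part of a times the conjugate of b: the contribution of one coordinate to [ip]. *)
Definition rprod a b : R :=
  complex.Re a * complex.Re b + complex.Im a * complex.Im b.

Lemma ip_tail u v : ip u v = rprod (u 0%N) (v 0%N) + ip (l2_tail u) (l2_tail v).
Proof.
rewrite /rip inner_tail raddfD/=; congr (_ + _).
by rewrite /rprod; case: (u 0%N) (v 0%N) => x y [x' y'] /=; ring.
Qed.

Lemma ip_consl a u v : ip (l2_cons a u) v = rprod a (v 0%N) + ip u (l2_tail v).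
Proof. by rewrite ip_tail l2_consK. Qed.

Lemma ip_consr a u v : ip v (l2_cons a u) = rprod (v 0%N) a + ip (l2_tail v) u.
Proof. by rewrite ip_tail l2_consK. Qed.

Lemma rprod_self a : rprod a a = sqm a.
Proof. by rewrite /rprod /sqm !expr2. Qed.

Lemma ip_tail_iter n u :
  ip u u = \sum_(k < n) sqm (u k) + ip (iter n l2_tail u) (iter n l2_tail u).
Proof.
elim: n u => [|n IH] u; first by rewrite big_ord0 add0r.
by rewrite ip_tail rprod_self (IH (l2_tail u)) big_ord_recl -iterSr addrA.
Qed.

Lemma iter_tailE n u k : iter n l2_tail u k = u (n + k)%N.
Proof. by elim: n k => //= n IH k; rewrite IH addnS. Qed.

Lemma tail_cvg0 u (e : R) : 0 < e -> exists n, nrm (iter n l2_tail u) < e.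
Proof.
move=> e0; have e20 : 0 < e ^+ 2 by rewrite exprn_gt0.
have /cvgrPdist_lt/(_ _ e20)[N _ /(_ N (leqnn N)) /=] := @l2_cvg _ u.
have hu : ip u u = limn (series (sqm \o u)) by rewrite -sqr_rn; exact: l2_rnE.
rewrite ger0_norm ?subr_ge0 ?l2_partial_le// => h; exists N.
rewrite -ltr_sqr ?nnegrE ?rn_ge0 ?(ltW e0)// sqr_rn.
move: h; rewrite -hu (ip_tail_iter N u) seriesEord /=.
by rewrite addrC addKr.
Qed.

Fixpoint l2_basis n : l2 R :=
  if n is m.+1 then l2_cons 0 (l2_basis m) else l2_cons 1 0.

Lemma l2_basisE n k : l2_basis n k = (n == k)%:R.
Proof. by elim: n k => [|n IH] [|k] //=; exact: IH. Qed.

Definition l2_trunc n u : l2 R := \sum_(k < n) u k *: l2_basis k.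

Lemma l2_sumE (I : Type) (s : seq I) (F : I -> l2 R) k :
  (\sum_(i <- s) F i) k = \sum_(i <- s) F i k.
Proof. by elim/big_rec2 : _ => [//|i x y _ <-]. Qed.

Lemma l2_truncE n u k : l2_trunc n u k = if (k < n)%N then u k else 0.
Proof.
rewrite /l2_trunc l2_sumE; case: ifPn => kn.
  rewrite (bigD1 (Ordinal kn))// big1 ?addr0 => [|i ik].
    by rewrite l2Z l2_basisE /= eqxx mulr1 addr0.
  rewrite l2Z l2_basisE (_ : (_ == _) = false) ?mulr0//.
  apply/negbTE; move: ik; rewrite andTb; apply: contra => /eqP ik.
  exact/eqP/val_inj.
rewrite big1// => i _; rewrite l2Z l2_basisE.
rewrite (_ : (_ == _) = false) ?mulr0//; apply/negbTE.
by apply: contra kn => /eqP <-.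
Qed.

Lemma l2_trunc_dist n u : nrm (u - l2_trunc n u) = nrm (iter n l2_tail u).
Proof.
rewrite /rn; congr Num.sqrt; rewrite (ip_tail_iter n) big1 ?add0r.
  have -> // : iter n l2_tail (u - l2_trunc n u) = iter n l2_tail u.
  apply: l2_ext => k; rewrite !iter_tailE l2D l2N l2_truncE.
  by rewrite ltnNge leq_addr subr0.
by move=> k _; rewrite l2D l2N l2_truncE ltn_ord subrr sqm0.
Qed.

(** Truncations lie in K and converge. Closedness is expressed by approximation so that K may be a
    property handled by estimates, such as absolute continuity of f - P f. *)
Lemma l2_dense_span (K : set (l2 R)) :
  K 0 -> (forall a u v, K u -> K v -> K (a *: u + v)) ->
  (forall u, (forall e : R, 0 < e -> exists2 v, K v & nrm (u - v) < e) -> K u) ->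
  (forall n, K (l2_basis n)) -> forall u, K u.
Proof.
move=> K0 KD Kc Kb u; apply: Kc => e e0; have [n un] := tail_cvg0 u e0.
exists (l2_trunc n u); last by rewrite l2_trunc_dist.
rewrite /l2_trunc; elim/big_rec : _ => // i x _ Kx; exact: KD.
Qed.

Lemma nrm_basis n : nrm (l2_basis n) = 1.
Proof.
rewrite /rn -[RHS]sqrtr1; congr Num.sqrt; elim: n => [|n IH] /=.
  by rewrite ip_consl rip0l addr0 /rprod/= mulr1 mulr0 addr0.
by rewrite ip_consl l2_consK IH /rprod/= mulr0 addr0 add0r.
Qed.

(** Indexing by the countable type [seq (rat * rat)] makes the range countable at once. *)
Definition rational_comb (s : seq (rat * rat)) : l2 R :=
  \sum_(k < size s) (ratr (nth (0, 0) s k).1 +i* ratr (nth (0, 0) s k).2)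
     *: l2_basis k.

Lemma rat_approx (x d : R) : 0 < d -> exists q : rat, `|x - ratr q| < d.
Proof.
move=> d0; have xd : x - d < x + d by lra.
have [q] := rat_in_itvoo xd; rewrite in_itv/= => /andP[h1 h2].
by exists q; rewrite ltr_norml; apply/andP; split; lra.
Qed.

Lemma rational_approx (z : R[i]) (e : R) : 0 < e ->
  exists q : rat * rat, complex.Re `|z - (ratr q.1 +i* ratr q.2)| < e.
Proof.
move=> e0; have e20 : 0 < e / 2 by rewrite divr_gt0.
case: z => x y; have [q1 h1] := rat_approx x e20; have [q2 h2] := rat_approx y e20.
exists (q1, q2); rewrite normc_def/=.
rewrite -ltr_sqr ?nnegrE ?sqrtr_ge0 ?(ltW e0)// sqr_sqrtr ?addr_ge0 ?sqr_ge0//.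
have := sqr_ltr_norm h1; have := sqr_ltr_norm h2.
by have := sqr_ge0 e; lra.
Qed.

Lemma l2_separable : separable_space (l2 R).
Proof.
exists (range rational_comb).
  apply: card_le_trans (card_image_le _ _) _; exact: countableP.
move=> O [u Ou] oO; have : nbhs u O by exact: open_nbhs_nbhs.
move=> /nbhs_ballP[[e e'] /=]; rewrite ltcE/= => /andP[/eqP -> e0] uO.
have e20 : 0 < e / 2 by rewrite divr_gt0.
have [n un] := tail_cvg0 u e20.
(* The n coordinate errors of this size add up to at most e / 2; the successor keeps the divisor
   nonzero when n = 0. *)
have d0 : 0 < e / 2 / n.+1%:R by rewrite divr_gt0.
have [q qP] := choice (fun k => rational_approx (u k) d0).
exists (rational_comb (mkseq q n)); split; last by exists (mkseq q n).
apply: uO; rewrite -ball_normE/= norm_rn ltcR.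
set w := rational_comb _.
have -> : u - w = (u - l2_trunc n u) + (l2_trunc n u - w) by rewrite addrA subrK.
apply: le_lt_trans (ler_rnD _ _ _) _; rewrite l2_trunc_dist.
suff : nrm (l2_trunc n u - w) <= e / 2 by lra.
have -> : l2_trunc n u - w =
    \sum_(k < n) (u k - (ratr (q k).1 +i* ratr (q k).2)) *: l2_basis k.
  rewrite /w /rational_comb size_mkseq -sumrB; apply: eq_bigr => k _.
  by rewrite nth_mkseq// scalerBl.
apply: (@le_trans _ _ (\sum_(k < n) (e / 2 / n.+1%:R))).
  elim/big_rec2 : _ => [|k x y _ xy]; first by rewrite rn0.
  apply: le_trans (ler_rnD _ _ _) _; apply: lerD => //.
  by rewrite rnZ nrm_basis mulr1 ltW.
rewrite sumr_const card_ord -[_ *+ n]mulr_natr -mulrA ger_pMr//.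
by rewrite ler_pdivrMl ?ltr0n// mulr1 ler_nat.
Qed.

End l2_structure.

(** * Fourier expansions *)

Lemma cvg_complex (R : realType) T (F : set_system T) {FF : Filter F}
    (u : T -> R[i]) (l : R[i]) :
  complex.Re (u x) @[x --> F] --> complex.Re l ->
  complex.Im (u x) @[x --> F] --> complex.Im l ->
  u x @[x --> F] --> (l : R[i]^o).
Proof.
move=> /cvgrPdist_lt ur /cvgrPdist_lt ui; apply/(@cvgrPdist_lt _ (R[i]^o)) => -[e e'] e0.
have : 0 < e by move: e0; rewrite ltcE => /andP[].
move: e0; rewrite ltcE/= => /andP[/eqP -> _] e0.
have e20 : 0 < e / 2 by rewrite divr_gt0.
apply: filter_app (ur _ e20); apply: filterS (ui _ e20) => x.
move: (complex.Re l) (complex.Im l) (complexE l) => a b ->.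
move: (complex.Re (u x)) (complex.Im (u x)) (complexE (u x)) => c d -> h1 h2.
rewrite [l in `|l|](_ : _ = (a - c) +i* (b - d)); last by simpc.
rewrite normc_def/= ltcR -ltr_sqr ?nnegrE ?sqrtr_ge0 ?(ltW e0)//.
rewrite sqr_sqrtr ?addr_ge0 ?sqr_ge0//.
have := sqr_ltr_norm h1; have := sqr_ltr_norm h2.
by have := sqr_ge0 e; lra.
Qed.

Section bessel.
Context {R : realType} {H : hilbertType R} {I : choiceType}.
Variable e : I -> H.
Hypothesis eP : forall i j, inner (e i) (e j) = (i == j)%:R.
Implicit Types (x y : H) (s : seq I).

Definition fourier_sum x s : H := \sum_(i <- s) inner x (e i) *: e i.

Lemma inner_sumZl (J : Type) (s : seq J) (c : J -> R[i]) (F : J -> H) y :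
  inner (\sum_(i <- s) c i *: F i) y = \sum_(i <- s) c i * inner (F i) y.
Proof.
elim: s => [|i s IH]; first by rewrite !big_nil sesquilinear.linear0l.
by rewrite !big_cons sesquilinear.linearPl/= IH.
Qed.

Lemma fourier_coef x s j : uniq s ->
  inner (fourier_sum x s) (e j) = if j \in s then inner x (e j) else 0.
Proof.
move=> us; rewrite inner_sumZl; case: ifPn => js.
  rewrite (bigD1_seq j)//= eP eqxx mulr1 big1 ?addr0// => i ij.
  by rewrite eP (negbTE ij) mulr0.
rewrite big_seq big1// => i is_; rewrite eP; have [ij|] := eqVneq i j.
  by rewrite ij (negbTE js) in is_.
by rewrite mulr0.
Qed.

Lemma fourier_dist x s : uniq s ->
  ip (x - fourier_sum x s) (x - fourier_sum x s) =
  ip x x - \sum_(i <- s) sqm (inner x (e i)).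
Proof.
elim: s => [_|j s IH /andP[js us]].
  by rewrite /fourier_sum !big_nil !subr0.
rewrite big_cons /fourier_sum big_cons -/(fourier_sum x s).
set c := inner x (e j); set y := x - fourier_sum x s in IH *.
have -> : x - (c *: e j + fourier_sum x s) = y - c *: e j.
  by rewrite opprD addrCA addrC.
have yc : ip y (c *: e j) = sqm c.
  rewrite /rip sesquilinear.linearZr_LR/= /y sesquilinear.linearBl/=.
  rewrite fourier_coef// (negbTE js) subr0 -/c /sqm.
  by case: c => a b /=; ring.
have cc : ip (c *: e j) (c *: e j) = sqm c.
  by rewrite ripZZ /rip eP eqxx/= mulr1.
by rewrite ripBB yc cc IH//; lra.
Qed.

Lemma bessel x s : uniq s -> \sum_(i <- s) sqm (inner x (e i)) <= ip x x.
Proof.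
by move=> us; rewrite -subr_ge0 -fourier_dist// rip_ge0.
Qed.

(** The distance formula is applied to y = S_t x in place of x: S_t y = y gives |y|^2 as the sum
    over t, and S_s y = S_s x. *)
Lemma fourier_incr x s t : uniq s -> uniq t -> {subset s <= t} ->
  ip (fourier_sum x t - fourier_sum x s) (fourier_sum x t - fourier_sum x s) =
  \sum_(i <- t) sqm (inner x (e i)) - \sum_(i <- s) sqm (inner x (e i)).
Proof.
move=> us ut st; set y := fourier_sum x t.
have yE s' : {subset s' <= t} -> fourier_sum y s' = fourier_sum x s'.
  move=> s't; apply: eq_big_seq => i /s't it; rewrite /y fourier_coef//.
  by rewrite it.
have yS s' : {subset s' <= t} -> \sum_(i <- s') sqm (inner y (e i)) =
    \sum_(i <- s') sqm (inner x (e i)).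
  move=> s't; apply: eq_big_seq => i /s't it; rewrite /y fourier_coef//.
  by rewrite it.
have := fourier_dist y ut; rewrite yE// subrr rip0l yS//.
rewrite -(yE s)// fourier_dist// yS// => /esym/eqP.
by rewrite subr_eq0 => /eqP ->.
Qed.

End bessel.

Section parseval.
Context {R : realType} {H : hilbertType R} {I : choiceType}.
Variable e : I -> H.
Hypothesis eP : orthonormal_basis e.
Implicit Types (x y : H).

#[local] Instance totally_proper : ProperFilter (@totally I) := totally_filter.

(** By Bessel the finite sums of squared coefficients have a supremum, and a finite set nearly
    attaining it witnesses the Cauchy property. Each coefficient of the sums is eventually constant,
    so the limit has the coefficients of x, and completeness of the basis identifies the two. *)
Lemma fourier_cvg x : fourier_sum e x (A : {fset I}) @[A --> totally] --> x.
Proof.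
have [eO eT] := eP.
pose S : set R := [set \sum_(i <- (A : {fset I})) sqm (inner x (e i)) | A in setT].
have hS : has_sup S.
  split; first by exists (\sum_(i <- (fset0 : {fset I})) sqm (inner x (e i))); exists fset0.
  by exists (ip x x) => _ [A _ <-]; exact: bessel.
have cv : cvg (fourier_sum e x (A : {fset I}) @[A --> totally]).
  apply: cauchy_cvg; apply: cauchy_exP => -[d d'] d0.
  have : 0 < d by move: d0; rewrite ltcE => /andP[].
  move: d0; rewrite ltcE/= => /andP[/eqP -> _] d0.
  have d20 : 0 < d ^+ 2 by rewrite exprn_gt0.
  have [_ [A _ <-] hA] := sup_adherent d20 hS.
  exists (fourier_sum e x A); exists A => // B AB.
  rewrite /= -ball_normE/= norm_rn ltcR rnBC.
  rewrite -ltr_sqr ?nnegrE ?rn_ge0 ?(ltW d0)// sqr_rn fourier_incr//; last first.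
    exact/fsubsetP.
  have : \sum_(i <- B) sqm (inner x (e i)) <= sup S.
    by apply: sup_upper_bound => //; exists B.
  by lra.
move: cv => /cvg_ex[y xy].
suff yx : y = x by move: xy; rewrite yx.
apply/eqP; rewrite -subr_eq0; apply/eqP/eT => i.
rewrite sesquilinear.linearBl/=; apply/eqP; rewrite subr_eq0; apply/eqP.
have co g : ip y g = ip x g -> True by [].
have coef (g : H) (c : R) : (forall A : {fset I}, i \in A -> ip (fourier_sum e x A) g = c) -> ip y g = c.
  move=> h; have h1 : ip (fourier_sum e x (A : {fset I})) g @[A --> totally] --> ip y g.
    exact: cvg_rip.
  have h2 : ip (fourier_sum e x (A : {fset I})) g @[A --> totally] --> c.
    apply: cvg_near_cst; exists [fset i]%fset => // A /=.
    by rewrite fsub1set; exact: h.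
  exact: (cvg_unique (@Rhausdorff R) h1 h2).
rewrite [LHS]form_ripE [RHS]form_ripE; congr (_ +i* _); apply: coef => A iA.
  by rewrite /rip fourier_coef// iA.
have := fourier_coef eO x i (fset_uniq A); rewrite iA.
by rewrite [LHS]form_ripE [RHS]form_ripE => -[].
Qed.

(** This evaluates the trace of a rank one operator in an arbitrary orthonormal basis, with the
    summation prescribed by [is_trace]. *)
Lemma parseval x y :
  partial_sum (fun i => inner x (e i) * inner (e i) y) @ totally -->
  (inner x y : R[i]^o).
Proof.
have E (A : {fset I}) : partial_sum (fun i => inner x (e i) * inner (e i) y) A =
    inner (fourier_sum e x A) y.
  rewrite inner_sumZl /partial_sum.
  by rewrite big_seq_fsetE.
rewrite (_ : partial_sum _ = fun A : {fset I} => inner (fourier_sum e x A) y);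
  last exact/funext.
apply: cvg_complex; first exact: (cvg_rip (g := y) (@fourier_cvg x)).
under eq_fun do rewrite form_ImE.
rewrite form_ImE; exact: (cvg_rip (g := 'i *: y) (@fourier_cvg x)).
Qed.

End parseval.

(** * The model *)

Section bounded_operations.
Context {R : realType} {H : hilbertType R}.
Implicit Types T S : {linear H -> H}.

Lemma bounded_opD T S : bounded_op T -> bounded_op S -> bounded_op (T \+ S).
Proof.
move=> [c c0 cT] [d d0 dS]; exists (c + d); first exact: addr_gt0.
by move=> f; rewrite mulrDl; apply: le_trans (ler_rnD _ _ _) _; exact: lerD.
Qed.

Lemma bounded_opZ (a : R[i]) T : bounded_op T -> bounded_op (a \*: T).
Proof.
move=> [c c0 cT].
have a0 : 0 <= complex.Re `|a| by rewrite normc_def sqrtr_ge0.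
exists ((complex.Re `|a| + 1) * c); first by rewrite mulr_gt0// ltr_wpDl.
move=> f /=; rewrite rnZ -mulrA; apply: ler_pM; rewrite ?rn_ge0//.
by rewrite lerDl.
Qed.

Lemma bounded_op_sqr T (c : R) : 0 < c ->
  (forall f, ip (T f) (T f) <= c ^+ 2 * ip f f) -> bounded_op T.
Proof.
move=> c0 cT; exists c => // f.
rewrite -ler_sqr ?nnegrE ?mulr_ge0 ?rn_ge0 ?(ltW c0)//.
by rewrite exprMn !sqr_rn.
Qed.

End bounded_operations.

Section model.
Context {R : realType}.
Implicit Types (f g : l2 R) (r : R).
Local Notation L := (@l2_tail R).

Lemma l2_cons0 (a : R[i]) f : l2_cons a f 0%N = a. Proof. by []. Qed.

Lemma l2_consS (a : R[i]) f n : l2_cons a f n.+1 = f n. Proof. by []. Qed.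

Definition l2E := (@l2D R, @l2Z R, @l2N R, l2_cons0, l2_consS, @l2_tailE R).

(* [raising r], [lowering r], [coupling] and [hamiltonian r] are W_r, W_r^*, V
   and H_r. *)
Definition raising_fun r f : l2 R :=
  l2_cons 0 (l2_cons 0 (l2_cons (f 0%N + r%:C * f 1%N)
    (l2_cons (2%:C * f 2%N) (3%:C *: L (L (L f)))))).

Lemma raising_linear r : linear (raising_fun r).
Proof.
move=> a f g; apply: l2_ext; rewrite /raising_fun.
by case=> [|[|[|[|n]]]]; rewrite ?l2E; ring.
Qed.

Definition raising r : {linear l2 R -> l2 R} := linop (raising_linear r).

Definition lowering_fun r f : l2 R :=
  l2_cons (f 2%N) (l2_cons (r%:C * f 2%N)
    (l2_cons (2%:C * f 3%N) (3%:C *: L (L (L (L f)))))).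

Lemma lowering_linear r : linear (lowering_fun r).
Proof.
move=> a f g; apply: l2_ext; rewrite /lowering_fun.
by case=> [|[|[|n]]]; rewrite ?l2E; ring.
Qed.

Definition lowering r : {linear l2 R -> l2 R} := linop (lowering_linear r).

Definition head_fun f : l2 R :=
  l2_cons (f 0%N) (l2_cons (f 1%N) (l2_cons (f 2%N) 0)).

Lemma head_linear : linear head_fun.
Proof.
move=> a f g; apply: l2_ext; rewrite /head_fun.
by case=> [|[|[|n]]]; rewrite ?l2E; ring.
Qed.

Definition head_op : {linear l2 R -> l2 R} := linop head_linear.

Definition coupling_fun f : l2 R :=
  l2_cons (f 0%N) (l2_cons (f 1%N + f 2%N) (l2_cons (f 1%N + f 2%N) 0)).

Lemma coupling_linear : linear coupling_fun.
Proof.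
move=> a f g; apply: l2_ext; rewrite /coupling_fun.
by case=> [|[|[|n]]]; rewrite ?l2E; ring.
Qed.

Definition coupling : {linear l2 R -> l2 R} := linop coupling_linear.

Definition hamiltonian r : {linear l2 R -> l2 R} :=
  (raising r \+ lowering r) \+ (r%:C \*: head_op).

Lemma hamiltonianE r f :
  hamiltonian r f = raising_fun r f + lowering_fun r f + r%:C *: head_fun f.
Proof. by []. Qed.

Lemma hamiltonian_affine r f :
  hamiltonian r f = hamiltonian 0 f + r%:C *: coupling f.
Proof.
rewrite !hamiltonianE (_ : coupling f = coupling_fun f)// (_ : 0%:C = 0)//.
apply: l2_ext; rewrite /raising_fun /lowering_fun /head_fun /coupling_fun.
by case=> [|[|[|[|n]]]]; rewrite ?l2E; ring.
Qed.

Lemma raising_adjoint r f g : ip (raising r f) g = ip f (lowering r g).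
Proof.
rewrite /raising /lowering /= /raising_fun /lowering_fun !ip_consl !ip_consr.
rewrite ripZl ripZr ?l2E /rprod.
case: (f 0%N) (f 1%N) (f 2%N) (g 0%N) (g 1%N) (g 2%N) (g 3%N) =>
  [a a'] [b b'] [c c'] [d d'] [u u'] [v v'] [w w'] /=.
by ring.
Qed.

Lemma head_symmetric : symmetric_op head_op.
Proof.
move=> f g; rewrite /head_op /= /head_fun !ip_consl !ip_consr.
by rewrite rip0l rip0r ?l2E.
Qed.

Lemma coupling_symmetric : symmetric_op coupling.
Proof.
move=> f g; rewrite /coupling /= /coupling_fun !ip_consl !ip_consr.
rewrite rip0l rip0r ?l2E /rprod.
case: (f 0%N) (f 1%N) (f 2%N) (g 0%N) (g 1%N) (g 2%N) =>
  [a a'] [b b'] [c c'] [d d'] [u u'] [v v'] /=.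
by ring.
Qed.

Lemma hamiltonian_symmetric r : symmetric_op (hamiltonian r).
Proof.
move=> f g; rewrite !hamiltonianE !ripDl !ripDr ripZl ripZr.
rewrite (raising_adjoint r f g) (head_symmetric f g).
rewrite (ripC _ (lowering_fun r f) g) -(raising_adjoint r g f).
by rewrite (ripC _ (raising r g) f) (addrC (ip f (lowering r g))).
Qed.

Lemma raising_sqr r f : ip (raising r f) (raising r f) =
  sqm (f 0%N + r%:C * f 1%N) + 4 * sqm (f 2%N) +
  9 * ip (L (L (L f))) (L (L (L f))).
Proof.
rewrite /raising /= /raising_fun !ip_consl !l2_consK ripZl ripZr ?l2E.
rewrite /rprod /sqm; case: (f 0%N) (f 1%N) (f 2%N) => [a a'] [b b'] [c c'] /=.
by ring.
Qed.

Lemma lowering_sqr r f : ip (lowering r f) (lowering r f) =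
  (1 + r ^+ 2) * sqm (f 2%N) + 4 * sqm (f 3%N) +
  9 * ip (L (L (L (L f)))) (L (L (L (L f)))).
Proof.
rewrite /lowering /= /lowering_fun !ip_consl !l2_consK ripZl ripZr ?l2E.
rewrite /rprod /sqm; case: (f 2%N) (f 3%N) => [a a'] [b b'] /=.
by ring.
Qed.

Lemma ip_head f : ip f f = sqm (f 0%N) + (sqm (f 1%N) + (sqm (f 2%N) +
  ip (L (L (L f))) (L (L (L f))))).
Proof.
by rewrite ip_tail (ip_tail (L f)) (ip_tail (L (L f))) !rprod_self ?l2E.
Qed.

Lemma ip_tail3 f : ip (L (L (L f))) (L (L (L f))) =
  sqm (f 3%N) + ip (L (L (L (L f)))) (L (L (L (L f)))).
Proof. by rewrite ip_tail rprod_self. Qed.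

Lemma sqm_add_mul r (a b : R[i]) :
  sqm (a + r%:C * b) <= 2 * sqm a + 2 * r ^+ 2 * sqm b.
Proof.
rewrite /sqm; case: a b => [a a'] [b b'] /=.
rewrite -subr_ge0 [leRHS](_ : _ = (a - r * b) ^+ 2 + (a' - r * b') ^+ 2).
  by rewrite addr_ge0// sqr_ge0.
by ring.
Qed.

Lemma raising_bounded r : bounded_op (raising r).
Proof.
(* A crude norm bound, polynomial in r: its square dominates 2 + 2 r^2, 4 and 9. *)
have c0 : 0 < 9 + r ^+ 2 by rewrite ltr_wpDr// sqr_ge0.
apply: (bounded_op_sqr c0) => f; rewrite raising_sqr (ip_head f).
have r0 := sqr_ge0 r.
have h0 := mulr_ge0 r0 (sqm_ge0 (f 0%N)).
have h1 := mulr_ge0 r0 (sqm_ge0 (f 1%N)).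
have h2 := mulr_ge0 r0 (sqm_ge0 (f 2%N)).
have h3 := mulr_ge0 r0 (rip_ge0 (@inner _ (l2 R)) (L (L (L f)))).
have n0 : 0 <= ip f f by exact: rip_ge0.
rewrite (ip_head f) in n0; have := mulr_ge0 (sqr_ge0 (r ^+ 2)) n0.
have := sqm_add_mul r (f 0%N) (f 1%N).
have := sqm_ge0 (f 0%N); have := sqm_ge0 (f 1%N); have := sqm_ge0 (f 2%N).
have := rip_ge0 (@inner _ (l2 R)) (L (L (L f))).
by lra.
Qed.

Lemma lowering_bounded r : bounded_op (lowering r).
Proof.
have c0 : 0 < 9 + r ^+ 2 by rewrite ltr_wpDr// sqr_ge0.
apply: (bounded_op_sqr c0) => f; rewrite lowering_sqr (ip_head f) (ip_tail3 f).
have r0 := sqr_ge0 r.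
have h0 := mulr_ge0 r0 (sqm_ge0 (f 0%N)).
have h1 := mulr_ge0 r0 (sqm_ge0 (f 1%N)).
have h2 := mulr_ge0 r0 (sqm_ge0 (f 2%N)).
have h3 := mulr_ge0 r0 (sqm_ge0 (f 3%N)).
have h4 := mulr_ge0 r0 (rip_ge0 (@inner _ (l2 R)) (L (L (L (L f))))).
have n0 : 0 <= ip f f by exact: rip_ge0.
rewrite (ip_head f) (ip_tail3 f) in n0; have := mulr_ge0 (sqr_ge0 (r ^+ 2)) n0.
have := sqm_ge0 (f 0%N); have := sqm_ge0 (f 1%N); have := sqm_ge0 (f 2%N).
have := sqm_ge0 (f 3%N); have := rip_ge0 (@inner _ (l2 R)) (L (L (L (L f)))).
by lra.
Qed.

Lemma head_bounded : bounded_op head_op.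
Proof.
apply: (bounded_op_sqr ltr01) => f; rewrite expr1n mul1r (ip_head f).
rewrite /head_op /= /head_fun !ip_consl !l2_consK rip0l ?l2E.
rewrite !rprod_self addr0 !lerD2l lerDl rip_ge0//.
Qed.

Lemma hamiltonian_bounded r : bounded_op (hamiltonian r).
Proof.
apply: bounded_opD; last by apply: bounded_opZ; exact: head_bounded.
by apply: bounded_opD; [exact: raising_bounded|exact: lowering_bounded].
Qed.

(** The skew operator of the commutator argument. The difference is written with the scalar -1 so
    that boundedness comes from [bounded_opD] and [bounded_opZ]. *)
Definition conjugate r : {linear l2 R -> l2 R} :=
  raising r \+ ((-1)%:C \*: lowering r).

Lemma conjugateE r f : conjugate r f = raising r f - lowering r f.
Proof.
rewrite -[LHS]/(raising r f + (-1)%:C *: lowering r f).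
by rewrite (rmorphN1 (real_complex R)) scaleN1r.
Qed.

Lemma conjugate_bounded r : bounded_op (conjugate r).
Proof.
apply: bounded_opD; first exact: raising_bounded.
by apply: bounded_opZ; exact: lowering_bounded.
Qed.

Lemma conjugate_antisym r f : ip f (conjugate r f) = 0.
Proof.
by rewrite conjugateE ripBr -raising_adjoint (ripC _ f) subrr.
Qed.

Definition moving_vec r : l2 R := l2_cons 1 (l2_cons r%:C 0).

Lemma ip_moving r f : ip f (moving_vec r) = complex.Re (f 0%N + r%:C * f 1%N).
Proof.
rewrite /moving_vec !ip_consr rip0r ?l2E /rprod.
by case: (f 0%N) (f 1%N) => [a a'] [b b'] /=; ring.
Qed.

(** Symmetry of [ip] cancels the mixed terms of W_r and its adjoint, leaving |W_r f|^2 - |W_r^* f|^2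
    and the contribution of r D, which is the cross term. In the difference of squares the equal
    weights 3 cancel on the tail. *)
Lemma hamiltonian_conjugate r f : ip (hamiltonian r f) (conjugate r f) =
  sqm (f 0%N + r%:C * f 1%N) + (3 - r ^+ 2) * sqm (f 2%N) + 5 * sqm (f 3%N) -
  2 * r * rprod (f 2%N) (f 3%N).
Proof.
have -> : ip (hamiltonian r f) (conjugate r f) =
   ip (raising r f) (raising r f) - ip (lowering r f) (lowering r f) +
   r * ip (head_op f) (raising r f - lowering r f).
  rewrite conjugateE hamiltonianE.
  rewrite -[raising_fun r f]/(raising r f) -[lowering_fun r f]/(lowering r f).
  rewrite -[head_fun f]/(head_op f).
  move: (raising r f) (lowering r f) (head_op f) => u v w.
  by rewrite !ripDl ripZl !ripBr (ripC _ v u); ring.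
rewrite raising_sqr lowering_sqr ip_tail3.
have -> : ip (head_op f) (raising r f - lowering r f) = - 2 * rprod (f 2%N) (f 3%N).
  rewrite ripBr /head_op /= /head_fun /raising_fun /lowering_fun.
  rewrite !ip_consl !l2_consK rip0l ?l2E /rprod.
  case: (f 0%N) (f 1%N) (f 2%N) (f 3%N) => [a a'] [b b'] [c c'] [d d'] /=.
  by rewrite rip0l; ring.
by ring.
Qed.

(** The cross term costs at most r (|f_2|^2 + |f_3|^2). On [0, 1] the remaining coefficients 3 - r^2
    - r and 5 - r are at least 1 and 4; this is where the range of r enters. *)
Lemma commutator_positive r f : 0 <= r <= 1 ->
  ip f (moving_vec r) ^+ 2 <= ip (hamiltonian r f) (conjugate r f).
Proof.
move=> /andP[r0 r1]; rewrite hamiltonian_conjugate ip_moving.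
have h : `|2 * rprod (f 2%N) (f 3%N)| <= sqm (f 2%N) + sqm (f 3%N).
  rewrite /rprod /sqm; case: (f 2%N) (f 3%N) => [a b] [c d] /=.
  rewrite ler_norml; apply/andP; split; rewrite -subr_ge0.
    rewrite [leRHS](_ : _ = (a + c) ^+ 2 + (b + d) ^+ 2); last by ring.
    by rewrite addr_ge0// sqr_ge0.
  rewrite [leRHS](_ : _ = (a - c) ^+ 2 + (b - d) ^+ 2); last by ring.
  by rewrite addr_ge0// sqr_ge0.
have z0 : complex.Re (f 0%N + r%:C * f 1%N) ^+ 2 <= sqm (f 0%N + r%:C * f 1%N).
  by rewrite /sqm lerDl sqr_ge0.
apply: le_trans z0 _; move: h; rewrite ler_norml => /andP[h1 h2].
have a0 := sqm_ge0 (f 2%N); have b0 := sqm_ge0 (f 3%N).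
have s1 : 0 <= 1 - r by rewrite subr_ge0.
have h3 := mulr_ge0 s1 (addr_ge0 a0 b0).
have h4 := mulr_ge0 r0 a0; have h5 := mulr_ge0 s1 h4; have h6 := mulr_ge0 s1 a0.
have h7 : 0 <= r * (sqm (f 2%N) + sqm (f 3%N) - 2 * rprod (f 2%N) (f 3%N)).
  by rewrite mulr_ge0// subr_ge0.
by lra.
Qed.

End model.

Section subspace_closure.
Context {R : realType} {H : hilbertType R}.
Variables (K : set H) (KS : Defs.subspace K).
Implicit Types (a : R[i]) (f g : H).

Lemma subspaceZ a f : K f -> K (a *: f).
Proof. by have [K0 KD] := KS => Kf; rewrite -[_ *: _]addr0; exact: KD. Qed.

Lemma subspaceD f g : K f -> K g -> K (f + g).
Proof. by have [_ KD] := KS => Kf Kg; rewrite -[f]scale1r; exact: KD. Qed.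

Lemma subspaceB f g : K f -> K g -> K (f - g).
Proof.
by have [_ KD] := KS => Kf Kg; rewrite addrC -scaleN1r; exact: KD.
Qed.

Lemma subspaceZ_inv a f : a != 0 -> K (a *: f) -> K f.
Proof.
by move=> a0 Kf; rewrite -[f]scale1r -(mulVf a0) -scalerA; exact: subspaceZ.
Qed.

Lemma subspaceD_inv f g : K f -> K (f + g) -> K g.
Proof. by move=> Kf Kfg; rewrite -(addKr f g) addrC; exact: subspaceB. Qed.

End subspace_closure.

Lemma ip_rank_one (R : realType) (H : hilbertType R) (f g v : H) (c : R) :
  ip ((inner f v / c%:C) *: v) g = rprod (inner f v) (inner g v) / c.
Proof.
rewrite /rip sesquilinear.linearZl_LR/= -(fmorphV (real_complex R)).
rewrite (rip_conj _ v g) /rprod.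
by case: (inner f v) (inner g v) => [x y] [u w]; simpc => /=; ring.
Qed.

(** * The eigenvector v_r and its orthogonal complement *)

Section eigenvector.
Context {R : realType}.
Implicit Types (f g : l2 R) (r : R).

Lemma hamiltonian0E r f : hamiltonian r f 0%N = f 2%N + r%:C * f 0%N.
Proof.
by rewrite hamiltonianE /raising_fun /lowering_fun /head_fun ?l2E add0r.
Qed.

Lemma hamiltonian1E r f : hamiltonian r f 1%N = r%:C * f 2%N + r%:C * f 1%N.
Proof.
by rewrite hamiltonianE /raising_fun /lowering_fun /head_fun ?l2E add0r.
Qed.

Lemma hamiltonian2E r f : hamiltonian r f 2%N =
  f 0%N + r%:C * f 1%N + 2%:C * f 3%N + r%:C * f 2%N.
Proof. by rewrite hamiltonianE /raising_fun /lowering_fun /head_fun ?l2E. Qed.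

Lemma hamiltonian3E r f : hamiltonian r f 3%N = 2%:C * f 2%N + 3%:C * f 4%N.
Proof.
by rewrite hamiltonianE /raising_fun /lowering_fun /head_fun ?l2E mulr0 addr0.
Qed.

Lemma hamiltonian_tailE r f n :
  hamiltonian r f n.+4 = 3%:C * f n.+3 + 3%:C * f n.+4.+1.
Proof.
by rewrite hamiltonianE /raising_fun /lowering_fun /head_fun ?l2E mulr0 addr0.
Qed.

Definition hamiltonian_coordE := (hamiltonian0E, hamiltonian1E, hamiltonian2E,
  hamiltonian3E, hamiltonian_tailE).

Definition eigenvector r : l2 R := l2_cons (- r)%:C (l2_cons 1 0).

Lemma hamiltonian_eigenvector r :
  hamiltonian r (eigenvector r) = r%:C *: eigenvector r.
Proof.
apply: l2_ext; case=> [|[|[|[|n]]]]; rewrite hamiltonian_coordE l2Z /eigenvector ?l2E;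
  rewrite ?rmorphN/=; by ring.
Qed.

Lemma eigenvector_self r :
  inner (eigenvector r) (eigenvector r) = (1 + r ^+ 2)%:C.
Proof.
rewrite form_selfE (_ : ip _ _ = 1 + r ^+ 2)//.
by rewrite /eigenvector !ip_consl !l2_consK rip0l ?l2E /rprod/=; ring.
Qed.

Lemma eigenvector_self_neq0 r : (1 + r ^+ 2)%:C != 0 :> R[i].
Proof.
by rewrite (fmorph_eq0 (real_complex R)) gt_eqF// ltr_wpDr// sqr_ge0.
Qed.

Definition eigen_projector_fun r f : l2 R :=
  (inner f (eigenvector r) / (1 + r ^+ 2)%:C) *: eigenvector r.

Lemma eigen_projector_linear r : linear (eigen_projector_fun r).
Proof.
move=> a f g; rewrite /eigen_projector_fun.
by rewrite sesquilinear.linearPl/= mulrDl scalerDl scalerA mulrA.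
Qed.

Definition eigen_projector r : {linear l2 R -> l2 R} :=
  linop (eigen_projector_linear r).

Lemma eigen_projectorE r f : eigen_projector r f =
  (inner f (eigenvector r) / (1 + r ^+ 2)%:C) *: eigenvector r.
Proof. by []. Qed.

Lemma eigen_projector_symmetric r : symmetric_op (eigen_projector r).
Proof.
move=> f g; rewrite (ripC _ f (eigen_projector r g)).
rewrite (ip_rank_one f g (eigenvector r)) (ip_rank_one g f (eigenvector r)) /rprod.
by congr (_ / _); ring.
Qed.

Lemma eigen_projector_eigenvector r :
  eigen_projector r (eigenvector r) = eigenvector r.
Proof.
by rewrite eigen_projectorE eigenvector_self divff ?scale1r ?eigenvector_self_neq0.
Qed.

Lemma eigen_projectorZ r (a : R[i]) :
  eigen_projector r (a *: eigenvector r) = a *: eigenvector r.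
Proof.
have h := linearZZ (eigen_projector r) a (eigenvector r).
by rewrite h eigen_projector_eigenvector.
Qed.

Lemma eigen_projector_idem r f :
  eigen_projector r (eigen_projector r f) = eigen_projector r f.
Proof. exact: (eigen_projectorZ r (inner f (eigenvector r) / (1 + r ^+ 2)%:C)). Qed.

Lemma hamiltonian_eigen_projector r f :
  hamiltonian r (eigen_projector r f) = r%:C *: eigen_projector r f.
Proof.
rewrite (eigen_projectorE r f); set a := (_ / _).
have h := linearZZ (hamiltonian r) a (eigenvector r).
by rewrite h hamiltonian_eigenvector !scalerA mulrC.
Qed.

Lemma eigen_projector_bounded r : bounded_op (eigen_projector r).
Proof.
apply: (bounded_op_sqr ltr01) => f; rewrite expr1n mul1r.
have := rip_ge0 (@inner _ (l2 R)) (f - eigen_projector r f).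
have e := eigen_projector_symmetric r f (eigen_projector r f).
rewrite eigen_projector_idem in e.
by rewrite ripBB -e; lra.
Qed.

Section invariant_subspace.
Variables (r : R) (K : set (l2 R)).
Hypotheses (KS : Defs.subspace K) (KH : forall f, K f -> K (hamiltonian r f)).

Lemma hamiltonian_moving : hamiltonian r (moving_vec r) =
  r%:C *: moving_vec r + (1 + r ^+ 2)%:C *: l2_basis 2.
Proof.
apply: l2_ext => k; rewrite rmorphD rmorphXn.
by case: k => [|[|[|[|n]]]]; rewrite hamiltonian_coordE !l2D !l2Z;
  rewrite /moving_vec !l2_basisE ?l2E /=; ring.
Qed.

Lemma hamiltonian_basis2 : hamiltonian r (l2_basis 2) =
  r%:C *: l2_basis 2 + moving_vec r + 2%:C *: l2_basis 3.
Proof.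
apply: l2_ext => k.
by case: k => [|[|[|[|n]]]]; rewrite hamiltonian_coordE !l2D !l2Z;
  rewrite /moving_vec !l2_basisE ?l2E /=; ring.
Qed.

Lemma hamiltonian_basis3 : hamiltonian r (l2_basis 3) =
  2%:C *: l2_basis 2 + 3%:C *: l2_basis 4.
Proof.
apply: l2_ext => k.
by case: k => [|[|[|[|[|n]]]]]; rewrite hamiltonian_coordE !l2D !l2Z;
  rewrite !l2_basisE /=; ring.
Qed.

Lemma hamiltonian_basis n : hamiltonian r (l2_basis n.+4) =
  3%:C *: l2_basis n.+3 + 3%:C *: l2_basis n.+4.+1.
Proof.
apply: l2_ext => k.
by case: k => [|[|[|[|k]]]]; rewrite hamiltonian_coordE !l2D !l2Z;
  rewrite !l2_basisE ?eqSS /=; ring.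
Qed.

(** No weight on the chain vanishes: H_r u_r exposes e_2 with coefficient 1 + r^2, and from then on
    each application of H_r exposes the next basis vector beside vectors already in K. *)
Lemma invariant_basis : K (moving_vec r) -> forall n, K (l2_basis n.+2).
Proof.
move=> Ku.
have K2 : K (l2_basis 2).
  apply: (subspaceZ_inv KS (eigenvector_self_neq0 r)).
  apply: (subspaceD_inv KS (f := r%:C *: moving_vec r)); first exact: subspaceZ.
  by rewrite -hamiltonian_moving; exact: KH.
have two0 : 2%:C != 0 :> R[i] by rewrite (fmorph_eq0 (real_complex R)) pnatr_eq0.
have three0 : 3%:C != 0 :> R[i] by rewrite (fmorph_eq0 (real_complex R)) pnatr_eq0.
have K3 : K (l2_basis 3).
  apply: (subspaceZ_inv KS two0).
  apply: (subspaceD_inv KS (f := r%:C *: l2_basis 2 + moving_vec r)).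
    by apply: subspaceD => //; exact: subspaceZ.
  by rewrite -hamiltonian_basis2; exact: KH.
have K4 : K (l2_basis 4).
  apply: (subspaceZ_inv KS three0).
  apply: (subspaceD_inv KS (f := 2%:C *: l2_basis 2)); first exact: subspaceZ.
  by rewrite -hamiltonian_basis3; exact: KH.
suff Kn n : K (l2_basis n.+3) /\ K (l2_basis n.+4) by case=> // n; have [] := Kn n.
elim: n => [//|n [Kn Kn1]]; split=> //.
apply: (subspaceZ_inv KS three0).
apply: (subspaceD_inv KS (f := 3%:C *: l2_basis n.+3)); first exact: subspaceZ.
by rewrite -hamiltonian_basis; exact: KH.
Qed.

End invariant_subspace.

Lemma moving_vec0 : moving_vec 0 = l2_basis 0 :> l2 R.
Proof. by apply: l2_ext => -[|[|n]]. Qed.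

Lemma inner_basisl n f : inner (l2_basis n) f = (f n)^*%C.
Proof.
elim: n f => [|n IH] f; rewrite inner_tail l2_basisE/= l2_consK.
  by rewrite sesquilinear.linear0l mul1r addr0.
by rewrite mul0r add0r IH.
Qed.

Lemma inner_basis_eigenvector0 r :
  inner (l2_basis 0) (eigenvector r) = (- r)%:C.
Proof. by rewrite inner_basisl /eigenvector l2E; simpc. Qed.

Lemma inner_basis_eigenvector1 r : inner (l2_basis 1) (eigenvector r) = 1.
Proof. by rewrite inner_basisl /eigenvector !l2E rmorph1. Qed.

Lemma eigen_projector_basis r n : eigen_projector r (l2_basis n.+2) = 0.
Proof.
rewrite eigen_projectorE inner_basisl /eigenvector !l2E.
by rewrite (_ : (0 : l2 R) n = 0)// rmorph0 mul0r scale0r.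
Qed.

(** In the plane of e_0 and e_1 the orthogonal complement of v_r is the line of u_r. *)
Lemma eigen_complement0 r : l2_basis 0 - eigen_projector r (l2_basis 0) =
  (1 / (1 + r ^+ 2)%:C) *: moving_vec r.
Proof.
have r0 := eigenvector_self_neq0 r; rewrite rmorphD rmorphXn in r0 *.
rewrite eigen_projectorE inner_basis_eigenvector0 rmorphD rmorphXn.
apply: l2_ext => k; rewrite l2D l2N !l2Z l2_basisE /moving_vec /eigenvector.
by case: k => [|[|k]]; rewrite ?l2E rmorphN /=; field.
Qed.

Lemma eigen_complement1 r : l2_basis 1 - eigen_projector r (l2_basis 1) =
  (r%:C / (1 + r ^+ 2)%:C) *: moving_vec r.
Proof.
have r0 := eigenvector_self_neq0 r; rewrite rmorphD rmorphXn in r0 *.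
rewrite eigen_projectorE inner_basis_eigenvector1 rmorphD rmorphXn.
apply: l2_ext => k; rewrite l2D l2N !l2Z l2_basisE /moving_vec /eigenvector.
by case: k => [|[|k]]; rewrite ?l2E ?rmorphN /=; field.
Qed.

Section absolutely_continuous.
Variables (r : R) (E : resolution [set: l2 R]).
Hypotheses (r01 : 0 <= r <= 1)
  (EA : forall l, commuting (E l) (hamiltonian r))
  (E_le : forall l f, E l f = f -> ip (hamiltonian r f) f <= l * ip f f)
  (E_ge : forall l f, E l f = 0 -> l * ip f f <= ip (hamiltonian r f) f)
  (E_out : exists2 c : R, 0 < c &
      forall l f, (l < - c -> E l f = 0) /\ (c < l -> E l f = f)).

Lemma ac_subspace : Defs.subspace (ac_space E).
Proof.
split; first exact: (ac_0 E_out).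
by move=> a f g; exact: ac_lin.
Qed.

Lemma ac_moving : ac_space E (moving_vec r).
Proof.
have [c c0 cK] := conjugate_bounded r.
apply: (lipschitz_ac (ltW c0)).
apply: (commutator_lipschitz (hamiltonian_symmetric r) EA E_le E_ge (ltW c0) cK).
  exact: conjugate_antisym.
by move=> f; exact: commutator_positive.
Qed.

Lemma ac_basis n : ac_space E (l2_basis n.+2).
Proof.
apply: (invariant_basis ac_subspace _ ac_moving) => f.
exact: (ac_op (hamiltonian_bounded r) EA).
Qed.

(** By linearity and closedness it suffices to treat basis vectors: e_0 and e_1 project to multiples
    of u_r, and the others are orthogonal to v_r. *)
Lemma ac_eigen_complement f : ac_space E (f - eigen_projector r f).
Proof.
have [c c0 cP] := eigen_projector_bounded r.
pose K (g : l2 R) := ac_space E (g - eigen_projector r g).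
apply: (@l2_dense_span R K); rewrite /K.
- by rewrite (linear0 (eigen_projector r)) subrr; have [] := ac_subspace.
- move=> a u v; have -> : a *: u + v - eigen_projector r (a *: u + v) =
      a *: (u - eigen_projector r u) + (v - eigen_projector r v).
    by rewrite (linearP (eigen_projector r)) opprD addrACA scalerBr.
  exact: ac_lin.
- move=> u uK; apply: (ac_closed E_out) => e e0.
  have c1 : 0 < 1 + c by rewrite addr_gt0.
  have [v vK uv] := uK _ (divr_gt0 e0 c1).
  exists (v - eigen_projector r v) => //.
  have -> : u - eigen_projector r u - (v - eigen_projector r v) =
      (u - v) - eigen_projector r (u - v).
    rewrite (linearB (eigen_projector r)).
    move: (eigen_projector r u) (eigen_projector r v) => p q.
    by rewrite !opprB addrACA [RHS]addrACA (addrC (- p)).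
  apply: le_lt_trans (ler_rnB _ _ _) _; have := cP (u - v).
  move: uv; rewrite ltr_pdivlMr//; lra.
- case=> [|[|n]].
  + rewrite eigen_complement0; apply: (subspaceZ ac_subspace).
    exact: ac_moving.
  + rewrite eigen_complement1; apply: (subspaceZ ac_subspace).
    exact: ac_moving.
  + by rewrite eigen_projector_basis subr0; exact: ac_basis.
Qed.

End absolutely_continuous.

End eigenvector.

(** * Absolutely continuous spectrum of H_0 and irreducibility *)

Section spectrum_and_irreducibility.
Context {R : realType}.
Implicit Types (f g : l2 R) (r : R).

Lemma l2_cvg0 f (e : R) : 0 < e -> exists N, sqm (f N) + sqm (f N.+1) < e.
Proof.
move=> e0; have s0 : 0 < Num.sqrt e by rewrite sqrtr_gt0.
have [N fN] := tail_cvg0 f s0; exists N.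
have : ip (iter N (@l2_tail R) f) (iter N (@l2_tail R) f) < e.
  by rewrite -sqr_rn -(sqr_sqrtr (ltW e0)) ltr_pXn2r// nnegrE ?rn_ge0// ltW.
rewrite (ip_tail_iter 2 (iter N _ f)) !big_ord_recr big_ord0/= add0r.
rewrite !iter_tailE addn0 addn1.
have := rip_ge0 (@inner _ (l2 R)) (l2_tail (l2_tail (iter N (@l2_tail R) f))).
by move=> h1 h2; apply: le_lt_trans h2; rewrite lerDl.
Qed.

(* A conserved quantity of the recurrence f_(n+2) = l f_(n+1) - f_n, comparable
   to |f_n|^2 + |f_(n+1)|^2 when |l| <= 1. *)
Definition flux (l : R) f n : R :=
  sqm (f n) + sqm (f n.+1) - l * rprod (f n) (f n.+1).

Lemma flux_const (l : R) f : (forall n, f n.+2 = l%:C * f n.+1 - f n) ->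
  forall n, flux l f n = flux l f 0.
Proof.
move=> fE; elim=> // n <-; rewrite /flux fE /sqm /rprod.
by case: (f n) (f n.+1) => [x y] [u v] /=; ring.
Qed.

Lemma flux_bounds (l : R) f n : `|l| <= 1 ->
  (sqm (f n) + sqm (f n.+1)) / 2 <= flux l f n <=
  2 * (sqm (f n) + sqm (f n.+1)).
Proof.
move=> l1; rewrite /flux.
have h : `|l * rprod (f n) (f n.+1)| <= (sqm (f n) + sqm (f n.+1)) / 2.
  apply: (@le_trans _ _ `|rprod (f n) (f n.+1)|).
    by rewrite normrM ler_piMl.
  rewrite /rprod /sqm; case: (f n) (f n.+1) => [x y] [u v] /=.
  have := sqr_ge0 (x - u); have := sqr_ge0 (y - v).
  have := sqr_ge0 (x + u); have := sqr_ge0 (y + v).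
  by rewrite ler_norml => ? ? ? ?; apply/andP; split; lra.
move: h; rewrite ler_norml => /andP[? ?].
have := sqm_ge0 (f n); have := sqm_ge0 (f n.+1).
by move=> ? ?; apply/andP; split; lra.
Qed.

(** Square summability makes the flux arbitrarily small at some index; being constant it is then not
    positive, and its lower bound kills both initial values. *)
Lemma l2_recurrence_eq0 (l : R) f : `|l| <= 1 ->
  (forall n, f n.+2 = l%:C * f n.+1 - f n) -> f 0%N = 0 /\ f 1%N = 0.
Proof.
move=> l1 fE.
have f0 : flux l f 0 <= 0.
  apply/ler_addgt0Pr => e e0; rewrite add0r.
  have e40 : 0 < e / 4 by rewrite divr_gt0.
  have [N NP] := l2_cvg0 f e40; rewrite -(flux_const fE N).
  have /andP[_ h] := flux_bounds f N l1; apply: le_trans h _.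
  by lra.
have /andP[h _] := flux_bounds f 0 l1.
have sqm_eq0 z : sqm z <= 0 -> z = 0.
  by move=> z0; apply/eqP/contraT => /sqm_gt0; rewrite ltNge z0.
have := sqm_ge0 (f 0%N); have := sqm_ge0 (f 1%N).
by split; apply: sqm_eq0; lra.
Qed.

(** The rows from 4 on form the recurrence with parameter l / 3, so f_3 = f_4 = 0. Row 3 then gives
    f_2 = 0, row 2 gives f_0 = 0, and row 0 reads 0 = 1. *)
Lemma hamiltonian0_range (l : R) f : `|l| <= 1 ->
  hamiltonian 0 f - l%:C *: f <> l2_basis 0.
Proof.
move=> l1 fE.
have row k : hamiltonian 0 f k = l%:C * f k + l2_basis 0 k.
  have e : (hamiltonian 0 f - l%:C *: f) k = hamiltonian 0 f k - l%:C * f k by [].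
  by rewrite -fE e addrC subrK.
have [f3 f4] : f 3%N = 0 /\ f 4%N = 0.
  apply: (@l2_recurrence_eq0 (l / 3) (iter 3 (@l2_tail R) f)).
    rewrite normrM [X in _ * X]ger0_norm ?invr_ge0//.
    by have := normr_ge0 l; lra.
  move=> n; rewrite !iter_tailE !addSn add0n.
  have := row n.+4; rewrite hamiltonian_tailE l2_basisE/= addr0.
  have three0 : 3%:C != 0 :> R[i].
    by rewrite (fmorph_eq0 (real_complex R)) pnatr_eq0.
  rewrite rmorphM (fmorphV (real_complex R)) => h.
  apply: (mulfI three0); rewrite mulrBr mulrA (mulrCA 3%:C) mulfV// mulr1 -h.
  by rewrite addrC addKr.
have two0 : 2%:C != 0 :> R[i].
  by rewrite (fmorph_eq0 (real_complex R)) pnatr_eq0.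
have f2 : f 2%N = 0.
  have := row 3; rewrite hamiltonian3E f3 f4 l2_basisE !mulr0 !addr0 => /eqP.
  by rewrite mulf_eq0 (negbTE two0) => /eqP.
have f0 : f 0%N = 0.
  by have := row 2; rewrite hamiltonian2E f3 f2 l2_basisE/= !mulr0 ?mul0r !addr0.
have := row 0; rewrite hamiltonian0E f2 f0 l2_basisE/= !mulr0 !add0r => /eqP.
by rewrite eq_sym oner_eq0.
Qed.

Lemma ac_spectrum_hamiltonian0 (l : R) : `|l| <= 1 ->
  ac_spectrum (everywhere (hamiltonian (0 : R))) l.
Proof.
move=> l1.
have [E [EA E_le E_ge E_out]] :=
  spectral_family_exists (@hamiltonian_symmetric R 0) (@hamiltonian_bounded R 0).
exists E.
  exact: (bounded_spectral_resolution (@hamiltonian_symmetric R 0) EA E_le E_ge E_out).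
move=> [S [_ SP _]].
have r01 : 0 <= (0 : R) <= 1 by rewrite lexx ler01.
have ac0 := ac_moving r01 EA E_le E_ge.
rewrite moving_vec0 in ac0; have [_ ] := SP _ ac0.
exact: hamiltonian0_range.
Qed.

Lemma closed_approx (K : set (l2 R)) : closed K ->
  forall u, (forall e : R, 0 < e -> exists2 v, K v & nrm (u - v) < e) -> K u.
Proof.
move=> cK u uK; apply: cK => O /nbhs_ballP[[e e'] /=].
rewrite ltcE/= => /andP[/eqP -> e0] uO.
have [v Kv uv] := uK _ e0; exists v; split=> //.
by apply: uO; rewrite -ball_normE/= norm_rn ltcR.
Qed.

(** The eigenvalues of V are 0, 1 and 2, and e_0 spans the eigenspace of 1; the polynomial V (V - 2)
    isolates the coordinate f_0. *)
Lemma coupling_coupling f :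
  coupling (coupling f) - 2%:C *: coupling f = (- f 0%N) *: l2_basis 0.
Proof.
apply: l2_ext => k; rewrite l2D l2N !l2Z l2_basisE.
rewrite /coupling /= /coupling_fun.
by case: k => [|[|[|k]]]; rewrite ?l2E /=; ring.
Qed.

Lemma coupling_basis2 : coupling (l2_basis 2) = l2_basis 2 + l2_basis 1 :> l2 R.
Proof.
apply: l2_ext => k; rewrite l2D !l2_basisE.
by case: k => [|[|[|k]]]; rewrite /coupling /= /coupling_fun ?l2E /=; ring.
Qed.

(** If some f in K has f_0 != 0, then K contains e_0, hence every e_n with n >= 2 through H_0, and
    e_1, which H_0 annihilates, through V. Otherwise the zeroth coordinate vanishes on K, and
    invariance propagates this row by row to all coordinates. *)
Lemma model_irreducible :
  irreducible (everywhere (hamiltonian (0 : R))) (everywhere coupling).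
Proof.
move=> K [KS cK] [_ KH] [_ KV].
have {}KH f : K f -> K (hamiltonian 0 f) by move=> Kf; exact: KH.
have {}KV f : K f -> K (coupling f) by move=> Kf; exact: KV.
have [[f [Kf f0]]|K0] := pselect (exists f, K f /\ f 0%N != 0).
  right; have Ke0 : K (l2_basis 0).
    apply: (subspaceZ_inv KS (a := - f 0%N)); first by rewrite oppr_eq0.
    rewrite -coupling_coupling; apply: (subspaceB KS); first exact/KV/KV.
    exact/(subspaceZ KS)/KV.
  have Ke2 n : K (l2_basis n.+2).
    by apply: (invariant_basis KS KH); rewrite moving_vec0.
  apply/seteqP; split=> // u _; have [K00 KD] := KS.
  apply: (@l2_dense_span R K K00 KD (closed_approx cK)) => -[//|[|//]].
  apply: (subspaceD_inv KS (f := l2_basis 2)) => //.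
  by rewrite -coupling_basis2; exact: KV.
have {}K0 f : K f -> f 0%N = 0.
  by move=> Kf; apply/eqP/contraT => f0; case: K0; exists f.
left; apply/seteqP; split=> [f Kf|_ ->]; last by have [] := KS.
have K2 g : K g -> g 2%N = 0.
  move=> Kg; have := K0 _ (KH _ Kg); rewrite hamiltonian0E (K0 g)//.
  by rewrite mulr0 addr0.
have K1 g : K g -> g 1%N = 0.
  move=> Kg; have := K2 _ (KV _ Kg).
  by rewrite /coupling /= /coupling_fun ?l2E (K2 g)// addr0.
have K3 g : K g -> g 3%N = 0.
  move=> Kg; have := K2 _ (KH _ Kg).
  rewrite hamiltonian2E (K0 g)// (K2 g)// !rmorph0 !mul0r !add0r addr0 => /eqP.
  by rewrite mulf_eq0 (fmorph_eq0 (real_complex R)) pnatr_eq0 => /eqP.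
have three0 : 3%:C != 0 :> R[i].
  by rewrite (fmorph_eq0 (real_complex R)) pnatr_eq0.
have K4 g : K g -> g 4%N = 0.
  move=> Kg; have := K3 _ (KH _ Kg).
  rewrite hamiltonian3E (K2 g)// mulr0 add0r => /eqP.
  by rewrite mulf_eq0 (negbTE three0) => /eqP.
have Kn n : forall g, K g -> g n.+3 = 0 /\ g n.+4 = 0.
  elim: n => [|n IH] g Kg; first by split; [exact: K3|exact: K4].
  have [g3 g4] := IH _ Kg; split=> //.
  have := (IH _ (KH _ Kg)).2; rewrite hamiltonian_tailE g3 mulr0 add0r => /eqP.
  by rewrite mulf_eq0 (negbTE three0) => /eqP.
apply: l2_ext => -[|[|[|n]]] /=; first exact: K0.
- exact: K1.
- exact: K2.
- exact: (Kn n _ Kf).1.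
Qed.

End spectrum_and_irreducibility.

Lemma symmetric_selfadjoint (R : realType) (H : hilbertType R)
    (A : {linear H -> H}) : symmetric_op A -> selfadjoint (everywhere A).
Proof.
move=> sA; split.
- by split; [split|move=> a f g _ _; exact: (linearP A)].
- by move=> O O0 _; have [f Of] := O0; exists f.
- move=> g h; split=> [gh|[_ <-] f _]; last exact: (symmetric_inner sA).
  split=> //; apply/eqP; rewrite -subr_eq0; apply/eqP.
  apply: (@rip_eq0 _ _ (@inner _ H)); rewrite ripBr.
  (* The adjoint relation is tested on the vector A g - h itself. *)
  set k := A g - h; have := gh k I; rewrite /= => e.
  by rewrite -sA /rip e subrr.
Qed.

(** * Traces and the singular spectral shift function *)

Section model_trace.
Context {R : realType}.
Implicit Types (f g : l2 R) (r : R).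

Lemma coupling_form f : ip (coupling f) f = sqm (f 0%N) + sqm (f 1%N + f 2%N).
Proof.
rewrite /coupling /= /coupling_fun !ip_consl rip0l ?l2E /rprod /sqm.
by case: (f 0%N) (f 1%N) (f 2%N) => [a a'] [b b'] [c c'] /=; ring.
Qed.

Lemma coupling_bounded : bounded_op (@coupling R).
Proof.
apply: (bounded_op_sqr (c := 2)) => // f; rewrite (ip_head f).
rewrite /coupling /= /coupling_fun !ip_consl !l2_consK rip0l ?l2E !rprod_self.
have := sqm_add_mul 1 (f 1%N) (f 2%N); rewrite mul1r expr1n mulr1.
have := sqm_ge0 (f 0%N); have := sqm_ge0 (f 1%N); have := sqm_ge0 (f 2%N).
have := rip_ge0 (@inner _ (l2 R)) (l2_tail (l2_tail (l2_tail f))).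
by lra.
Qed.

Lemma coupling_form_inner f : ip (coupling f) f =
  sqm (inner (l2_basis 0) f) + sqm (inner (l2_basis 1 + l2_basis 2) f).
Proof.
rewrite coupling_form.
have -> : inner (l2_basis 1 + l2_basis 2) f =
    inner (l2_basis 1) f + inner (l2_basis 2) f by exact: sesquilinear.linearDl.
rewrite !inner_basisl /sqm.
by case: (f 0%N) (f 1%N) (f 2%N) => [a a'] [b b'] [c c'] /=; ring.
Qed.

(** V is positive, hence its own absolute value, and its quadratic form is a sum of two squared
    moduli; Bessel's inequality for e_0 and e_1 + e_2 bounds the trace in every basis. *)
Lemma coupling_trace_class : trace_class (@coupling R).
Proof.
have cC : continuous (@coupling R) by exact/bounded_continuous/coupling_bounded.
split=> //; exists (@coupling R) => [|I e [eO _]].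
  split=> // [f|f g]; last exact/symmetric_inner/coupling_symmetric.
  rewrite (symmetric_inner_real coupling_symmetric) coupling_form ler0c.
  by rewrite addr_ge0 ?sqm_ge0.
set b1 : l2 R := l2_basis 0; set b2 : l2 R := l2_basis 1 + l2_basis 2.
apply: (@le_lt_trans _ _ (ip b1 b1 + ip b2 b2)%:E); last exact: ltry.
apply: ge_ereal_sup => _ [A [fA _] <-].
rewrite fsbig_finite// sumEFin lee_fin.
under eq_bigr do rewrite -[complex.Re _]/(ip _ _) coupling_form_inner.
by rewrite big_split lerD// bessel.
Qed.

(** This is the Hellmann-Feynman relation: the eigenvalue r has derivative 1 in r, so <V v_r, v_r> =
    |v_r|^2. *)
Lemma coupling_eigen_form r :
  inner (coupling (eigenvector r)) (eigenvector r) = (1 + r ^+ 2)%:C.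
Proof.
rewrite (symmetric_inner_real coupling_symmetric) coupling_form.
rewrite (_ : sqm _ + sqm _ = 1 + r ^+ 2)// /eigenvector ?l2E /sqm /=; ring.
Qed.

(** The operator V T is z / |v|^2 times the rank one map f -> <f, v> V v, whose trace is <V v, v> by
    Parseval. *)
Lemma trace_projector r (z : R[i]) (T : {linear l2 R -> l2 R}) :
  (forall f, T f = z *: eigen_projector r f) -> is_trace (coupling \o T) z.
Proof.
move=> TE I e eP; pose v := eigenvector r.
pose c := z / (1 + r ^+ 2)%:C.
have E i : inner (coupling (T (e i))) (e i) =
    c * (inner (coupling v) (e i) * inner (e i) v).
  rewrite TE eigen_projectorE -/v scalerA (linearZZ coupling).
  rewrite sesquilinear.linearZl_LR/=; set p := inner (coupling v) _.
  by rewrite /c; ring.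
have -> : partial_sum (fun i => inner ((coupling \o T) (e i)) (e i)) =
    (fun A => c * partial_sum (fun i => inner (coupling v) (e i) * inner (e i) v) A).
  apply/funext => A; rewrite /partial_sum big_distrr.
  by apply: eq_bigr => i _; exact: E.
have -> : z = c * inner (coupling v) v.
  by rewrite coupling_eigen_form /c divfK// eigenvector_self_neq0.
apply: (@cvgMl_tmp R[i] _ _ _ _ c); last exact: parseval.
have := @totally_filter I; exact.
Qed.

Lemma perturb_hamiltonian r : perturb (everywhere (hamiltonian 0)) coupling r =
  everywhere (hamiltonian r) :> operator (l2 R).
Proof.
by congr Operator; apply/funext => f; rewrite [RHS]hamiltonian_affine.
Qed.

Lemma smooth_continuous (phi : R -> R) : smooth phi -> continuous phi.
Proof.
move=> sphi x; apply/differentiable_continuous/derivable1_diffP.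
exact: (sphi 0%N).
Qed.

(** The singular subspace is the range of the rank one projector, where H_r is the scalar r. Two
    resolutions are exhibited: that of H_r and the one-jump resolution of its singular part. *)
Lemma singular_calculus r (phi : R -> R[i]) : 0 <= r <= 1 -> test_function phi ->
  is_singular_functional_calculus (perturb (everywhere (hamiltonian 0)) coupling r)
    phi (phi r \*: eigen_projector r).
Proof.
move=> r01 [sR sI _]; rewrite perturb_hamiltonian.
have [E [EA E_le E_ge E_out]] :=
  spectral_family_exists (hamiltonian_symmetric r) (hamiltonian_bounded r).
exists E.
  exact: (bounded_spectral_resolution (hamiltonian_symmetric r) EA E_le E_ge E_out).
have KP := singular_spaceP EA E_le E_ge E_out (eigen_projector_symmetric r)
  (eigen_projector_idem r) (hamiltonian_eigen_projector r)
  (ac_eigen_complement r01 EA E_le E_ge E_out).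
exists (eigen_resolution r (eigen_projector_symmetric r) KP (eigen_projector_idem r)).
  apply: eigen_spectral_resolution; first exact: setTI.
  move=> f /KP fE; rewrite -[LHS]/(hamiltonian r f) -{1}fE.
  by rewrite hamiltonian_eigen_projector fE.
split.
  exact/bounded_continuous/bounded_opZ/eigen_projector_bounded.
apply: eigen_functional_calculus => //.
  exact: (continuous_measurable_fun (smooth_continuous sR)).
exact: (continuous_measurable_fun (smooth_continuous sI)).
Qed.

Local Notation leb := (@lebesgue_measure R).
Local Notation xi := (\1_(`[0, 1]%classic : set R) : R -> R).

Lemma integrable_unit (h : R -> R) : continuous h ->
  leb.-integrable `[0, 1] (EFin \o h).
Proof.
move=> ch; apply: continuous_compact_integrable; first exact: segment_compact.
exact: continuous_subspaceT.
Qed.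

Lemma Rintegral_unit (h : R -> R) :
  (\int[leb]_(x in `[0, 1]) h x)%R = (\int[leb]_x (xi x * h x))%R.
Proof.
rewrite /Rintegral integral_mkcond; congr fine; apply: eq_integral => x _.
by rewrite patchE indicE; case: ifP => _; rewrite ?mul1r ?mul0r.
Qed.

Lemma indicator_is_ssf :
  is_singular_ssf (everywhere (hamiltonian (0 : R))) coupling xi.
Proof.
split; first exact: integrable_indic_itv.
(* The function r -> Tr(V phi(H_r^(s))) is [phi] itself. *)
move=> phi tphi; have [sR sI _] := tphi; exists phi; split.
- move=> r; rewrite in_itv => r01.
  exists (phi r \*: eigen_projector r); first exact: singular_calculus.
  exact: trace_projector.
- by split; apply: integrable_unit;
    [exact: (smooth_continuous sR)|exact: (smooth_continuous sI)].
- rewrite /cintegral; congr (_ +i* _); rewrite Rintegral_unit.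
    by apply: eq_Rintegral => x _; case: (phi x) => a b /=; rewrite mul0r subr0.
  by apply: eq_Rintegral => x _; case: (phi x) => a b /=; rewrite mul0r addr0.
Qed.

(** An exceptional null set would contain all of [0, 1]. *)
Lemma indicator_nonzero :
  ~ {ae leb, forall x, ac_spectrum (everywhere (hamiltonian (0 : R))) x -> xi x = 0}.
Proof.
move=> [N [mN N0 sN]].
have : (leb (`[0%R, 1%R]%classic : set R) <= leb N)%E.
  apply: le_measure; [by apply/mem_set; exact: measurable_itv|exact/mem_set|].
  move=> x x01; apply: sN => /= h; move: (x01); rewrite /= in_itv/= => /andP[x0 x1].
  have /h : ac_spectrum (everywhere (hamiltonian (0 : R))) x.
    by apply: ac_spectrum_hamiltonian0; rewrite ger0_norm.
  by rewrite indicE mem_set// => /eqP; rewrite oner_eq0.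
by rewrite N0 lebesgue_measure_itv/= lte_fin ltr01 sube0 lee_fin ler10.
Qed.

End model_trace.

Theorem theorem2p4 (R : realType) :
  exists (H : hilbertType R) (H0 : operator H) (V : {linear H -> H})
         (xi : R -> R),
    separable_space H /\
    selfadjoint H0 /\
    ac_spectrum H0 !=set0 /\
    trace_class V /\
    selfadjoint (everywhere V) /\
    irreducible H0 (everywhere V) /\
    is_singular_ssf H0 V xi /\
    ~ {ae @lebesgue_measure R, forall x, ac_spectrum H0 x -> xi x = 0}.
Proof.
exists (l2 R), (everywhere (hamiltonian 0)), coupling, (\1_(`[0, 1]%classic : set R)).
split; first exact: l2_separable.
split; first exact/symmetric_selfadjoint/hamiltonian_symmetric.
split; first by exists 0; apply: ac_spectrum_hamiltonian0; rewrite normr0 ler01.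
split; first exact: coupling_trace_class.
split; first exact/symmetric_selfadjoint/coupling_symmetric.
split; first exact: model_irreducible.
split; first exact: indicator_is_ssf.
exact: indicator_nonzero.
Qed.
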